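(* Let $d\ge 2$ and let $\mathbf{T}$ be a Fourier multiplier operator on $\mathbb{T}^d$ with symbol $\widehat{\mathbf{T}}:\mathbb{Z}^d\to\mathbb{R}^d$ such that $\mathbf{T}\theta$ is divergence-free for every $\theta$, and such that $|\widehat{\mathbf{T}}(\mathbf{k})|\le C|\mathbf{k}|^{r_0}$ for all $\mathbf{k}\in\mathbb{Z}^d$, for some constants $C>0$ and $r_0\in[0,1]$. Consider the initial value problem $$\partial_t\theta+u\cdot\nabla\theta=0,\qquad \nabla\cdot u=0,\qquad u=\mathbf{T}\theta,\qquad \theta(\mathbf{x},0)=\theta_0(\mathbf{x})$$ on $\mathbb{T}^d\times[0,\infty)$. Fix $r>3$ and $K_0>0$. (i) If $r_0\in(0,1]$, fix $s\in[1,\frac{1}{r_0}]$. Let $\theta_0\in G^s$ with radius $\tau_0>0$ and $\|(-\Delta)^{r/2}e^{\tau_0(-\Delta)^{1/(2s)}}\theta_0\|_{L^2}\le K_0$. Then there exist a time $T_*=T_*(\tau_0,K_0)>0$ and a unique solution in $G^s$ on $[0,T_* )$ of the initial value problem. (ii) If $r_0=0$, then for every $s\ge1$ and every $\theta_0\in G^s$ with radius $\tau_0>0$ and $\|(-\Delta)^{r/2}e^{\tau_0(-\Delta)^{1/(2s)}}\theta_0\|_{L^2}\le K_0$, there exist $T_*=T_*(\tau_0,K_0)>0$ and a unique solution in $G^s$ on $[0,T_* )$ of the initial value problem.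
   Context: $\mathbb{T}^d=[0,2\pi]^d$ with periodic boundary conditions. Functions are taken mean-free: $\int_{\mathbb{T}^d}\theta(\mathbf{x},t)\,d\mathbf{x}=0$ (the mean is conserved by the flow). Let $\mathbb{Z}^d_*=\mathbb{Z}^d\setminus\{0\}$. For fixed $r>3$, $s\ge1$, $\tau>0$, the Gevrey norm is $\|\theta\|_{G^s_\tau}^2=\|(-\Delta)^{r/2}e^{\tau(-\Delta)^{1/(2s)}}\theta\|_{L^2}^2=\sum_{\mathbf{k}\in\mathbb{Z}^d_*}|\mathbf{k}|^{2r}e^{2\tau|\mathbf{k}|^{1/s}}|\widehat{\theta}(\mathbf{k})|^2$; $G^s_\tau$ is the space of (mean-free, smooth) functions with finite such norm, $\tau$ is called the Gevrey radius, and $G^s=\bigcup_{\tau>0}G^s_\tau$ (for $s=1$ these are the real-analytic functions). A Fourier multiplier $\mathbf{T}$ with symbol $\widehat{\mathbf{T}}$ acts by $\widehat{\mathbf{T}\theta}(\mathbf{k})=\widehat{\mathbf{T}}(\mathbf{k})\widehat{\theta}(\mathbf{k})$.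
   Formalization: Functions are taken real-valued and the symbol is additionally assumed even, T̂(−k)=T̂(k), so that u=Tθ is a real velocity; for a real odd symbol such as k^⊥/|k| real solutions fail to exist. *)

(* Defs.v *)
From Stdlib Require Import Reals List ZArith Lia.
From Coquelicot Require Import Coquelicot.
Import ListNotations.
Open Scope R_scope.

(* Lattice points of Z^d are represented as lists of integers of length d;
   a (mean-free, real-valued) function on T^d is represented by its Fourier
   coefficients  list Z -> C  (only the values on lists of length d matter). *)

Definition zc (k : list Z) (i : nat) : Z := nth i k 0%Z.

Definition zsub (d : nat) (k j : list Z) : list Z :=
  map (fun i => (zc k i - zc j i)%Z) (seq 0 d).
Definition zneg (d : nat) (k : list Z) : list Z :=
  map (fun i => (- zc k i)%Z) (seq 0 d).

Definition zzero (d : nat) : list Z := repeat 0%Z d.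
Definition zis0 (k : list Z) : bool := forallb (Z.eqb 0) k.

Definition znorm (k : list Z) : R :=
  sqrt (fold_right (fun z acc => IZR z ^ 2 + acc) 0 k).

(* vectors of R^d as coordinate functions nat -> R (coordinates i < d) *)
Definition vnorm (d : nat) (v : nat -> R) : R :=
  sqrt (fold_right Rplus 0 (map (fun i => v i ^ 2) (seq 0 d))).
Definition vdotZ (d : nat) (v : nat -> R) (k : list Z) : R :=
  fold_right Rplus 0 (map (fun i => v i * IZR (zc k i)) (seq 0 d)).

(* x^a for x >= 0, with the convention 0^0 = 1 and 0^a = 0 for a > 0 *)
Definition pw (x a : R) : R :=
  if Req_EM_T x 0 then (if Req_EM_T a 0 then 1 else 0) else Rpower x a.

Definition zrange (N : nat) : list Z :=
  map (fun m => (Z.of_nat m - Z.of_nat N)%Z) (seq 0 (2 * N + 1)).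
Fixpoint cube (d N : nat) : list (list Z) :=
  match d with
  | O => [[]]
  | S d' => flat_map (fun z => map (cons z) (cube d' N)) (zrange N)
  end.

Definition Rsum_list {A} (f : A -> R) (l : list A) : R :=
  fold_right Rplus 0 (map f l).
Definition Csum_list {A} (f : A -> C) (l : list A) : C :=
  fold_right Cplus (RtoC 0) (map f l).

Definition gev_psum (d : nat) (r s tau : R) (th : list Z -> C) (N : nat) : R :=
  Rsum_list (fun k => if zis0 k then 0 else
     Rpower (znorm k) (2 * r) * exp (2 * tau * Rpower (znorm k) (1 / s))
       * (Cmod (th k)) ^ 2) (cube d N).

Definition in_Gevrey (d : nat) (r s tau : R) (th : list Z -> C) : Prop :=
  exists M : R, forall N, gev_psum d r s tau th N <= M.

Definition Gevrey_norm_le (d : nat) (r s tau : R) (th : list Z -> C) (K : R) : Prop :=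
  forall N, gev_psum d r s tau th N <= K ^ 2.

Definition real_meanfree (d : nat) (th : list Z -> C) : Prop :=
  th (zzero d) = RtoC 0 /\
  forall k, length k = d -> th (zneg d k) = Cconj (th k).

(* Fourier coefficient at k of  u . grad theta  with  u = T theta :
   sum_{j in Z^d} i (That(j) . (k - j)) theta^(j) theta^(k-j),
   the series being summed along the cubes [-N,N]^d. *)
Definition nonlin_psum (d : nat) (That : list Z -> nat -> R)
    (th : list Z -> C) (k : list Z) (N : nat) : C :=
  Csum_list (fun j =>
     Cmult (Cmult Ci (RtoC (vdotZ d (That j) (zsub d k j))))
           (Cmult (th j) (th (zsub d k j)))) (cube d N).

(* theta : [0,Tstar) -> G^s is a solution of
     d_t theta + u . grad theta = 0,  div u = 0,  u = T theta,
     theta(0) = theta0,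
   written on the Fourier side: for each k in Z^d, t |-> theta^(t,k) is
   continuous at 0 from the right, differentiable on (0,Tstar), and
     d/dt theta^(t,k) = - (u . grad theta)^(t,k).
   "In G^s on [0,Tstar)": theta(t) is real-valued and mean-free, and on each
   compact subinterval [0,T'] of [0,Tstar) it stays bounded in some fixed
   Gevrey space G^s_tau, tau > 0. *)
Definition is_Gevrey_solution (d : nat) (That : list Z -> nat -> R) (r s : R)
    (th0 : list Z -> C) (Tstar : R) (th : R -> list Z -> C) : Prop :=
  (forall k, length k = d -> th 0 k = th0 k) /\
  (forall t, 0 <= t < Tstar -> real_meanfree d (th t)) /\
  (forall T', 0 <= T' < Tstar ->
     exists tau M, 0 < tau /\
       forall t, 0 <= t <= T' -> forall N, gev_psum d r s tau (th t) N <= M) /\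
  (forall k, length k = d ->
     filterlim (fun t => th t k) (at_right 0) (locally (th0 k))) /\
  (forall k, length k = d -> forall t, 0 < t < Tstar ->
     exists L : C,
       filterlim (nonlin_psum d That (th t) k) eventually (locally L) /\
       is_derive (fun t' => th t' k) t (Copp L)).

(* Main.v *)
Require Import Defs.
From Stdlib Require Import Reals List ZArith Lia Lra Permutation Classical ClassicalEpsilon.
From Coquelicot Require Import Coquelicot.
From mathcomp Require filter.
Open Scope R_scope.

(** Write theta in Fourier variables and measure it with the weight
    m(k) = |k|^p exp(sigma(t) |k|^(1/s)), where the radius sigma(t) decreases linearly at speed
    lambda.  The decreasing radius yields the damping -2 lambda sum |k|^(1/s) m^2 |theta^(k)|^2.
    In the transport term, u.grad is skew-adjoint, so only the commutator m(k) - m(l) survives;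
    it costs |k|^(1/s) instead of a full derivative, and the symbol costs |k|^r0 <= |k|^(1/s), so
    the damping absorbs the whole nonlinearity once lambda dominates the size of theta.

    Solutions are limits, along an ultrafilter, of explicit Euler approximations of the system
    truncated to the cube [-N,N]^d, the time step being so small that the discretization errors
    in the energy inequality add up to at most 1.  Uniqueness follows from the same estimates
    applied to the difference of two solutions, on successive short time intervals. *)

(** * Finite sums over lists *)

(** The exponent r enters through comparisons of norms: a slightly smaller radius absorbs any power
    of |k|, so the energy carries the convenient power p = 4d + 5, and the initial radius is cut to
    a quarter before the flow starts. The relation between s and r0 is used in the form r0 <= 1/s.

    The energy estimates are made on finite sums, with constants independent of the list of
    frequencies. Summability comes from one explicit weight [rho], whose sum over any duplicate-free
    list is at most 10^d; the factors 10^d in the constants are its trace. Restricting the output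
    and the interacting frequencies to the same cube keeps the skew symmetry exact, so truncation
    adds no error to the energy inequality of the approximations. The difference of two given
    solutions is not confined to a cube: there truncation leaves a tail, which is why uniqueness
    works with faster decaying coefficients and with tail bounds uniform in time.

    An ultrafilter gives limits for all times and frequencies at once, in place of extracted
    subsequences, and Euler steps are explicit, in place of an existence theorem for ordinary
    differential equations. *)

Section ListSums.
Context {A : Type}.
Implicit Types (f g : A -> R) (l : list A).

Lemma Rsum_app f l l' : Rsum_list f (l ++ l') = Rsum_list f l + Rsum_list f l'.
Proof. unfold Rsum_list; induction l as [|x l IH]; simpl; [ring | rewrite IH; ring]. Qed.

Lemma Rsum_perm f l l' : Permutation l l' -> Rsum_list f l = Rsum_list f l'.
Proof.
unfold Rsum_list; induction 1; simpl; try lra; congruence.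
Qed.

Lemma Rsum_le f g l : (forall x, In x l -> f x <= g x) -> Rsum_list f l <= Rsum_list g l.
Proof.
unfold Rsum_list; induction l as [|x l IH]; simpl; intros H; [lra|].
generalize (H x (or_introl eq_refl)) (IH (fun y hy => H y (or_intror hy))); lra.
Qed.

Lemma Rsum_ext f g l : (forall x, In x l -> f x = g x) -> Rsum_list f l = Rsum_list g l.
Proof. intros H; apply Rle_antisym; apply Rsum_le; intros x hx; rewrite (H x hx); lra. Qed.

Lemma Rsum_plus f g l : Rsum_list (fun x => f x + g x) l = Rsum_list f l + Rsum_list g l.
Proof. unfold Rsum_list; induction l as [|x l IH]; simpl; [ring | rewrite IH; ring]. Qed.

Lemma Rsum_scal c f l : Rsum_list (fun x => c * f x) l = c * Rsum_list f l.
Proof. unfold Rsum_list; induction l as [|x l IH]; simpl; [ring | rewrite IH; ring]. Qed.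

Lemma Rsum_opp f l : Rsum_list (fun x => - f x) l = - Rsum_list f l.
Proof. unfold Rsum_list; induction l as [|x l IH]; simpl; [ring | rewrite IH; ring]. Qed.

Lemma Rsum_nonneg f l : (forall x, In x l -> 0 <= f x) -> 0 <= Rsum_list f l.
Proof.
unfold Rsum_list; induction l as [|x l IH]; simpl; intros H; [lra|].
generalize (H x (or_introl eq_refl)) (IH (fun y hy => H y (or_intror hy))); lra.
Qed.

Lemma Rsum_zero f l : (forall x, In x l -> f x = 0) -> Rsum_list f l = 0.
Proof.
unfold Rsum_list; induction l as [|x l IH]; simpl; intros H; [lra|].
rewrite (H x (or_introl eq_refl)), (IH (fun y hy => H y (or_intror hy))); lra.
Qed.

Lemma Rsum_abs f l : Rabs (Rsum_list f l) <= Rsum_list (fun x => Rabs (f x)) l.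
Proof.
unfold Rsum_list; induction l as [|x l IH]; simpl; [rewrite Rabs_R0; lra|].
eapply Rle_trans; [apply Rabs_triang|]; lra.
Qed.

Lemma Rsum_term f l x : (forall y, In y l -> 0 <= f y) -> In x l -> f x <= Rsum_list f l.
Proof.
intros H hx; destruct (in_split _ _ hx) as (l1 & l2 & ->).
rewrite Rsum_app; change (Rsum_list f (x :: l2)) with (f x + Rsum_list f l2).
assert (0 <= Rsum_list f l1) by (apply Rsum_nonneg; intros; apply H, in_or_app; now left).
assert (0 <= Rsum_list f l2)
  by (apply Rsum_nonneg; intros; apply H, in_or_app; right; now right).
lra.
Qed.

(** Each element of l' with a nonzero value is struck out of l once; what is left of l is
    nonnegative. *)
Lemma Rsum_support_le f l l' : NoDup l' ->
  (forall x, In x l -> 0 <= f x) -> (forall x, In x l' -> f x <> 0 -> In x l) ->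
  Rsum_list f l' <= Rsum_list f l.
Proof.
revert l; induction l' as [|x l' IH]; intros l Hn Hp Hs.
  now apply Rsum_nonneg.
inversion_clear Hn as [|? ? hx Hn'].
change (Rsum_list f (x :: l')) with (f x + Rsum_list f l').
destruct (Req_dec (f x) 0) as [E|E].
  rewrite E, Rplus_0_l; apply IH; auto; intros; apply Hs; auto; now right.
assert (hi : In x l) by (apply Hs; auto; now left).
destruct (in_split _ _ hi) as (l1 & l2 & ->).
rewrite Rsum_app; change (Rsum_list f (x :: l2)) with (f x + Rsum_list f l2).
assert (Rsum_list f l' <= Rsum_list f (l1 ++ l2)); [|rewrite Rsum_app in *; lra].
apply IH; auto.
- intros y hy; apply Hp; apply in_app_or in hy; apply in_or_app.
  destruct hy; [now left | right; now right].
- intros y hy ny; assert (hyl : In y (l1 ++ x :: l2)) by (apply Hs; auto; now right).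
  apply in_app_or in hyl; apply in_or_app; destruct hyl as [|[->|]]; auto.
  contradiction.
Qed.

(** The comparison above wants nonnegative terms, so the positive and the negative part of f are
    treated separately. This serves to reindex convolution sums by reflections, where the two lists
    agree on the support of the summand. *)
Lemma Rsum_support_eq f l l' : NoDup l -> NoDup l' ->
  (forall x, f x <> 0 -> (In x l <-> In x l')) -> Rsum_list f l = Rsum_list f l'.
Proof.
intros hl hl' H.
assert (K : forall h : A -> R, (forall x, 0 <= h x) -> (forall x, h x <> 0 -> f x <> 0) ->
  Rsum_list h l = Rsum_list h l').
  intros h hp hf; apply Rle_antisym; apply Rsum_support_le; auto; intros; apply H; auto.
assert (E1 : Rsum_list (fun x => Rmax (f x) 0) l = Rsum_list (fun x => Rmax (f x) 0) l').
  apply K; [intros; apply Rmax_r | intros x hx E; apply hx; rewrite E; apply Rmax_left; lra].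
assert (E2 : Rsum_list (fun x => Rmax (- f x) 0) l = Rsum_list (fun x => Rmax (- f x) 0) l').
  apply K; [intros; apply Rmax_r | intros x hx E; apply hx; rewrite E, Ropp_0; apply Rmax_left; lra].
assert (D : forall L, Rsum_list f L =
  Rsum_list (fun x => Rmax (f x) 0) L - Rsum_list (fun x => Rmax (- f x) 0) L).
  intros L; unfold Rminus; rewrite <- Rsum_opp, <- Rsum_plus; apply Rsum_ext; intros x _.
  unfold Rmax; destruct (Rle_dec (f x) 0), (Rle_dec (- f x) 0); lra.
rewrite !D, E1, E2; reflexivity.
Qed.

Lemma split_incl l l' : NoDup l' -> (forall x, In x l' -> In x l) ->
  exists r, (forall x, In x r -> In x l) /\ Permutation l (l' ++ r).
Proof.
revert l; induction l' as [|x l' IH]; intros l Hn Hi.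
  exists l; split; auto.
inversion_clear Hn as [|? ? hx Hn'].
destruct (in_split _ _ (Hi x (or_introl eq_refl))) as (l1 & l2 & ->).
destruct (IH (l1 ++ l2) Hn') as (r & hr & hp).
  intros y hy; assert (h := Hi y (or_intror hy)); apply in_app_or in h; apply in_or_app.
  destruct h as [|[->|]]; auto; contradiction.
exists r; split.
- intros y hy; apply hr in hy; apply in_app_or in hy; apply in_or_app; simpl; tauto.
- simpl; rewrite <- hp; symmetry; apply Permutation_middle.
Qed.

End ListSums.

Lemma Rsum_map {A B} (f : B -> R) (h : A -> B) l :
  Rsum_list f (map h l) = Rsum_list (fun x => f (h x)) l.
Proof. unfold Rsum_list; now rewrite map_map. Qed.

Lemma Rsum_swap {A B} (f : A -> B -> R) l l' :
  Rsum_list (fun x => Rsum_list (f x) l') l = Rsum_list (fun y => Rsum_list (fun x => f x y) l) l'.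
Proof.
induction l as [|x l IH].
  symmetry; apply Rsum_zero; reflexivity.
change (Rsum_list (fun x0 => Rsum_list (f x0) l') (x :: l))
  with (Rsum_list (f x) l' + Rsum_list (fun x0 => Rsum_list (f x0) l') l).
rewrite IH, <- Rsum_plus; apply Rsum_ext; reflexivity.
Qed.

Lemma Re_Csum {A} (f : A -> C) l : Re (Csum_list f l) = Rsum_list (fun x => Re (f x)) l.
Proof.
unfold Csum_list, Rsum_list; induction l as [|x l IH]; simpl; [reflexivity|].
now rewrite <- IH.
Qed.

Lemma Im_Csum {A} (f : A -> C) l : Im (Csum_list f l) = Rsum_list (fun x => Im (f x)) l.
Proof.
unfold Csum_list, Rsum_list; induction l as [|x l IH]; simpl; [reflexivity|].
now rewrite <- IH.
Qed.

Lemma C_eq_parts (z w : C) : Re z = Re w -> Im z = Im w -> z = w.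
Proof. destruct z, w; unfold Re, Im; simpl; congruence. Qed.

Lemma Cmod_Csum {A} (f : A -> C) l : Cmod (Csum_list f l) <= Rsum_list (fun x => Cmod (f x)) l.
Proof.
unfold Csum_list, Rsum_list; induction l as [|x l IH]; simpl; [rewrite Cmod_0; lra|].
eapply Rle_trans; [apply Cmod_triangle|]; lra.
Qed.

Lemma Csum_app {A} (f : A -> C) l l' :
  Csum_list f (l ++ l') = Cplus (Csum_list f l) (Csum_list f l').
Proof.
apply C_eq_parts; [change Re with (fst (A:=R) (B:=R)) | change Im with (snd (A:=R) (B:=R))]; simpl;
 [change (fst (A:=R) (B:=R)) with Re | change (snd (A:=R) (B:=R)) with Im];
 rewrite ?Re_Csum, ?Im_Csum; apply Rsum_app.
Qed.

Lemma Csum_ext {A} (f g : A -> C) l :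
  (forall x, In x l -> f x = g x) -> Csum_list f l = Csum_list g l.
Proof.
intros H; apply C_eq_parts; rewrite ?Re_Csum, ?Im_Csum; apply Rsum_ext;
intros x hx; now rewrite H.
Qed.

Lemma Csum_perm {A} (f : A -> C) l l' : Permutation l l' -> Csum_list f l = Csum_list f l'.
Proof. intros H; apply C_eq_parts; rewrite ?Re_Csum, ?Im_Csum; now apply Rsum_perm. Qed.

Lemma Csum_map {A B} (f : B -> C) (h : A -> B) l :
  Csum_list f (map h l) = Csum_list (fun x => f (h x)) l.
Proof. unfold Csum_list; now rewrite map_map. Qed.

Lemma Csum_support_eq {A} (f : A -> C) l l' : NoDup l -> NoDup l' ->
  (forall x, f x <> RtoC 0 -> (In x l <-> In x l')) -> Csum_list f l = Csum_list f l'.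
Proof.
intros hl hl' H; apply C_eq_parts; rewrite ?Re_Csum, ?Im_Csum; apply Rsum_support_eq; auto;
intros x hx; apply H; intros E; apply hx; rewrite E; reflexivity.
Qed.

Lemma Csum_minus {A} (f g : A -> C) l :
  Csum_list (fun x => Cminus (f x) (g x)) l = Cminus (Csum_list f l) (Csum_list g l).
Proof. unfold Csum_list; induction l as [|x l IH]; simpl; [|rewrite IH]; ring. Qed.

Lemma Csum_plus {A} (f g : A -> C) l :
  Csum_list (fun x => Cplus (f x) (g x)) l = Cplus (Csum_list f l) (Csum_list g l).
Proof. unfold Csum_list; induction l as [|x l IH]; simpl; [|rewrite IH]; ring. Qed.

Lemma Csum_scal {A} c (f : A -> C) l :
  Csum_list (fun x => Cmult c (f x)) l = Cmult c (Csum_list f l).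
Proof. unfold Csum_list; induction l as [|x l IH]; simpl; [|rewrite IH]; ring. Qed.

Lemma Csum_zero {A} (f : A -> C) l : (forall x, In x l -> f x = RtoC 0) -> Csum_list f l = RtoC 0.
Proof.
intros H; apply C_eq_parts; rewrite ?Re_Csum, ?Im_Csum; apply Rsum_zero;
intros x hx; now rewrite H.
Qed.

Lemma NoDup_map_inj {A B} (h : A -> B) l : NoDup l ->
  (forall x y, In x l -> In y l -> h x = h y -> x = y) -> NoDup (map h l).
Proof.
induction l as [|x l IH]; intros hn hi; simpl; [constructor|].
inversion_clear hn as [|? ? hx hn']; constructor.
- intros hm; apply in_map_iff in hm as (y & E & hy); apply hx.
  rewrite <- (hi y x); auto; [now right | now left].
- apply IH; auto; intros; apply hi; auto; now right.
Qed.

(** * Fourier lattice *)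

Lemma Rsum_Cauchy_Schwarz {A} (f g : A -> R) l :
  (Rsum_list (fun x => f x * g x) l) ^ 2
  <= Rsum_list (fun x => f x ^ 2) l * Rsum_list (fun x => g x ^ 2) l.
Proof.
set (a := Rsum_list (fun x => f x ^ 2) l); set (b := Rsum_list (fun x => g x ^ 2) l).
set (c := Rsum_list (fun x => f x * g x) l).
assert (Q : forall t, 0 <= a * t ^ 2 + 2 * t * c + b).
  intros t; replace (a * t ^ 2 + 2 * t * c + b) with
    (Rsum_list (fun x => (t * f x + g x) ^ 2) l).
    apply Rsum_nonneg; intros; apply pow2_ge_0.
  unfold a, b, c; rewrite (Rmult_comm _ (t ^ 2)), <- !Rsum_scal, <- !Rsum_plus.
  apply Rsum_ext; intros; ring.
assert (ha : 0 <= a) by (apply Rsum_nonneg; intros; apply pow2_ge_0).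
assert (hb : 0 <= b) by (apply Rsum_nonneg; intros; apply pow2_ge_0).
destruct (Req_dec a 0) as [E|E].
- rewrite E in *; assert (c = 0); [|subst; nra].
  destruct (Req_dec c 0) as [|nc]; auto; exfalso.
  (* With a = 0 the quadratic is affine in t; at this t it takes the value -1. *)
  generalize (Q (- (b + 1) / (2 * c))).
  replace (0 * (- (b + 1) / (2 * c)) ^ 2 + 2 * (- (b + 1) / (2 * c)) * c + b) with (-1)
    by (field; auto); lra.
- assert (0 < a) by lra. generalize (Q (- c / a)).
  replace (a * (- c / a) ^ 2 + 2 * (- c / a) * c + b) with ((a * b - c ^ 2) / a)
    by (field; auto).
  intros h; apply (Rmult_le_compat_r a) in h; [|lra].
  unfold Rdiv in h; rewrite Rmult_assoc, Rinv_l, Rmult_1_r, Rmult_0_l in h; auto; lra.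
Qed.

Lemma Rsum_Cauchy_Schwarz_sqrt {A} (f g : A -> R) l :
  Rabs (Rsum_list (fun x => f x * g x) l)
  <= sqrt (Rsum_list (fun x => f x ^ 2) l) * sqrt (Rsum_list (fun x => g x ^ 2) l).
Proof.
rewrite <- sqrt_mult by (apply Rsum_nonneg; intros; apply pow2_ge_0).
rewrite <- sqrt_Rsqr_abs; apply sqrt_le_1_alt; rewrite Rsqr_pow2.
apply Rsum_Cauchy_Schwarz.
Qed.

Lemma Rsum_Minkowski {A} (f g : A -> R) l :
  sqrt (Rsum_list (fun x => (f x + g x) ^ 2) l)
  <= sqrt (Rsum_list (fun x => f x ^ 2) l) + sqrt (Rsum_list (fun x => g x ^ 2) l).
Proof.
assert (hf : 0 <= Rsum_list (fun x => f x ^ 2) l)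
  by (apply Rsum_nonneg; intros; apply pow2_ge_0).
assert (hg : 0 <= Rsum_list (fun x => g x ^ 2) l)
  by (apply Rsum_nonneg; intros; apply pow2_ge_0).
generalize (Rsum_Cauchy_Schwarz_sqrt f g l)
  (Rle_abs (Rsum_list (fun x => f x * g x) l)) (sqrt_pos (Rsum_list (fun x => f x ^ 2) l))
  (sqrt_pos (Rsum_list (fun x => g x ^ 2) l)) (sqrt_sqrt _ hf) (sqrt_sqrt _ hg); intros.
apply Rsqr_incr_0_var; [|lra]; unfold Rsqr; rewrite sqrt_sqrt
  by (apply Rsum_nonneg; intros; apply pow2_ge_0).
replace (Rsum_list (fun x => (f x + g x) ^ 2) l) with
  (Rsum_list (fun x => f x ^ 2) l + 2 * Rsum_list (fun x => f x * g x) l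
   + Rsum_list (fun x => g x ^ 2) l); [nra|].
rewrite <- Rsum_scal, <- !Rsum_plus; apply Rsum_ext; intros; ring.
Qed.

Section Lattice.
Variable d : nat.
Implicit Types (k l j : list Z).

Lemma zsub_length k j : length (zsub d k j) = d.
Proof. unfold zsub; now rewrite length_map, length_seq. Qed.

Lemma zneg_length k : length (zneg d k) = d.
Proof. unfold zneg; now rewrite length_map, length_seq. Qed.

Lemma nth_map_seq (f : nat -> Z) i : (i < d)%nat -> nth i (map f (seq 0 d)) 0%Z = f i.
Proof.
intros hi; rewrite nth_indep with (d' := f 0%nat) by now rewrite length_map, length_seq.
now rewrite map_nth, seq_nth.
Qed.

Lemma zc_zsub k j i : (i < d)%nat -> zc (zsub d k j) i = (zc k i - zc j i)%Z.
Proof. intros hi; unfold zsub, zc at 1; now rewrite nth_map_seq. Qed.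

Lemma zc_zneg k i : (i < d)%nat -> zc (zneg d k) i = (- zc k i)%Z.
Proof. intros hi; unfold zneg, zc at 1; now rewrite nth_map_seq. Qed.

Lemma zc_zzero i : zc (zzero d) i = 0%Z.
Proof. unfold zc, zzero; apply nth_repeat. Qed.

Lemma zlist_ext k l : length k = d -> length l = d ->
  (forall i, (i < d)%nat -> zc k i = zc l i) -> k = l.
Proof.
intros hk hl H; apply nth_ext with (d := 0%Z) (d' := 0%Z); [congruence|].
intros i hi; apply H; congruence.
Qed.

Lemma zsub_zsub k j : length j = d -> zsub d k (zsub d k j) = j.
Proof.
intros hj; apply zlist_ext; auto using zsub_length.
intros i hi; rewrite !zc_zsub by auto; lia.
Qed.

Lemma zneg_zneg k : length k = d -> zneg d (zneg d k) = k.
Proof.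
intros hk; apply zlist_ext; auto using zneg_length.
intros i hi; rewrite !zc_zneg by auto; lia.
Qed.

Lemma zneg_zsub k j : zneg d (zsub d k j) = zsub d j k.
Proof.
apply zlist_ext; auto using zsub_length, zneg_length.
intros i hi; rewrite zc_zneg, !zc_zsub by auto; lia.
Qed.

Lemma zsub_zneg k j : zsub d (zneg d k) (zneg d j) = zneg d (zsub d k j).
Proof.
apply zlist_ext; auto using zsub_length, zneg_length.
intros i hi; rewrite zc_zneg, !zc_zsub, !zc_zneg by auto; lia.
Qed.

Lemma zsub_inj_r k j j' : length j = d -> length j' = d ->
  zsub d k j = zsub d k j' -> j = j'.
Proof. intros hj hj' E; rewrite <- (zsub_zsub k j), E, zsub_zsub; auto. Qed.

Lemma zsub_inj_l l k k' : length k = d -> length k' = d ->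
  zsub d k l = zsub d k' l -> k = k'.
Proof.
intros hk hk' E; apply zlist_ext; auto; intros i hi.
assert (h : zc (zsub d k l) i = zc (zsub d k' l) i) by now rewrite E.
rewrite !zc_zsub in h by auto; lia.
Qed.

Lemma zzero_length : length (zzero d) = d.
Proof. apply repeat_length. Qed.

Lemma znorm_seq k : length k = d ->
  znorm k = sqrt (Rsum_list (fun i => IZR (zc k i) ^ 2) (seq 0 d)).
Proof.
intros <-; clear; unfold znorm; f_equal; induction k as [|z k IH]; [reflexivity|].
cbn [fold_right length seq]; rewrite IH, <- seq_shift.
unfold Rsum_list; cbn [map fold_right]; f_equal; rewrite map_map; reflexivity.
Qed.

Lemma znorm_zsub_le k l : length k = d -> length l = d ->
  znorm k <= znorm l + znorm (zsub d k l).
Proof.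
intros hk hl; rewrite !znorm_seq by auto using zsub_length.
eapply Rle_trans; [|apply Rsum_Minkowski]; right; f_equal; apply Rsum_ext.
intros i hi; apply in_seq in hi; rewrite zc_zsub, minus_IZR by lia; f_equal; ring.
Qed.

Lemma znorm_zneg k : length k = d -> znorm (zneg d k) = znorm k.
Proof.
intros hk; rewrite !znorm_seq by auto using zneg_length; f_equal; apply Rsum_ext.
intros i hi; apply in_seq in hi; rewrite zc_zneg, opp_IZR by lia; ring.
Qed.

Lemma znorm_zsub_sym k l : znorm (zsub d k l) = znorm (zsub d l k).
Proof. rewrite <- (zneg_zsub l k), znorm_zneg; auto using zsub_length. Qed.

Lemma znorm_coord k i : length k = d -> (i < d)%nat -> Rabs (IZR (zc k i)) <= znorm k.
Proof.
intros hk hi; rewrite znorm_seq, <- sqrt_Rsqr_abs by auto; apply sqrt_le_1_alt.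
rewrite Rsqr_pow2; apply (Rsum_term (fun i => IZR (zc k i) ^ 2)).
- intros; apply pow2_ge_0.
- apply in_seq; lia.
Qed.

Lemma zis0_true k : length k = d -> zis0 k = true -> k = zzero d.
Proof.
intros hk h; unfold zis0 in h; rewrite forallb_forall in h.
apply zlist_ext; auto using zzero_length; intros i hi; rewrite zc_zzero.
symmetry; apply Z.eqb_eq, h, nth_In; congruence.
Qed.

Lemma zis0_false k : length k = d -> zis0 k = false -> 1 <= znorm k.
Proof.
intros hk h.
assert (exists i, (i < d)%nat /\ zc k i <> 0%Z) as (i & hi & hz).
  apply NNPP; intros H; assert (zis0 k = true); [|congruence].
  unfold zis0; apply forallb_forall; intros z hz; apply Z.eqb_eq.
  destruct (In_nth _ _ 0%Z hz) as (i & hi & E); rewrite <- E.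
  destruct (Z.eq_dec 0 (nth i k 0%Z)); auto; exfalso; apply H; exists i.
  rewrite <- hk; auto.
eapply Rle_trans; [|apply (znorm_coord k i hk hi)].
rewrite <- abs_IZR; apply IZR_le; lia.
Qed.

Lemma vdotZ_bound v k : length k = d -> Rabs (vdotZ d v k) <= vnorm d v * znorm k.
Proof. intros hk; rewrite znorm_seq by auto; apply Rsum_Cauchy_Schwarz_sqrt. Qed.

Lemma vdotZ_zsub v k l : vdotZ d v (zsub d k l) = vdotZ d v k - vdotZ d v l.
Proof.
change (Rsum_list (fun i => v i * IZR (zc (zsub d k l) i)) (seq 0 d) =
  Rsum_list (fun i => v i * IZR (zc k i)) (seq 0 d) -
  Rsum_list (fun i => v i * IZR (zc l i)) (seq 0 d)).
unfold Rminus; rewrite <- Rsum_opp, <- Rsum_plus; apply Rsum_ext; intros i hi.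
apply in_seq in hi; rewrite zc_zsub, minus_IZR by lia; ring.
Qed.

Lemma vdotZ_zneg v k : vdotZ d v (zneg d k) = - vdotZ d v k.
Proof.
change (Rsum_list (fun i => v i * IZR (zc (zneg d k) i)) (seq 0 d) =
  - Rsum_list (fun i => v i * IZR (zc k i)) (seq 0 d)).
rewrite <- Rsum_opp; apply Rsum_ext; intros i hi.
apply in_seq in hi; rewrite zc_zneg, opp_IZR by lia; ring.
Qed.

Lemma vdotZ_ext v w k : (forall i, (i < d)%nat -> v i = w i) -> vdotZ d v k = vdotZ d w k.
Proof.
intros H; apply (Rsum_ext (fun i => v i * IZR (zc k i)) (fun i => w i * IZR (zc k i))).
intros i hi; apply in_seq in hi; rewrite H; auto; lia.
Qed.

End Lattice.

(** * Frequency cubes and a summable weight on the lattice *)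

Lemma in_zrange N z : In z (zrange N) <-> (Z.abs z <= Z.of_nat N)%Z.
Proof.
unfold zrange; rewrite in_map_iff; split.
- intros (m & <- & hm); apply in_seq in hm; lia.
- intros h; exists (Z.to_nat (z + Z.of_nat N)); split; [|apply in_seq]; lia.
Qed.

Lemma NoDup_zrange N : NoDup (zrange N).
Proof. apply NoDup_map_inj; [apply seq_NoDup | intros; lia]. Qed.

Lemma in_cube d N k : In k (cube d N) <->
  length k = d /\ forall z, In z k -> (Z.abs z <= Z.of_nat N)%Z.
Proof.
revert k; induction d as [|d IH]; intros k; simpl.
- split; [intros [<-|[]]; simpl; split; [reflexivity | tauto] |].
  intros [h _]; left; destruct k; auto; discriminate.
- rewrite in_flat_map; split.
  + intros (z & hz & hk); apply in_map_iff in hk as (k' & <- & hk').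
    apply IH in hk' as [hl hk']; apply in_zrange in hz; simpl; split; auto.
    intros y [<-|hy]; auto.
  + intros [hl hk]; destruct k as [|z k]; [discriminate|]; exists z; split.
      apply in_zrange, hk; now left.
    apply in_map, IH; split; [now injection hl | intros; apply hk; now right].
Qed.

Lemma cube_length d N k : In k (cube d N) -> length k = d.
Proof. now intros h; apply in_cube in h. Qed.

Lemma NoDup_cube d N : NoDup (cube d N).
Proof.
induction d as [|d IH]; simpl; [constructor; [tauto | constructor]|].
generalize (NoDup_zrange N); generalize (zrange N) as r; induction r as [|z r IHr]; intros hr.
  constructor.
inversion_clear hr as [|? ? hz hr']; simpl; apply NoDup_app; auto.
- apply NoDup_map_inj; auto; congruence.
- intros k hk hk'; apply in_map_iff in hk as (k1 & <- & _).
  apply in_flat_map in hk' as (z' & hz' & hk'); apply in_map_iff in hk' as (k2 & E & _).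
  injection E as -> ->; contradiction.
Qed.

Lemma cube_mono d M N k : (M <= N)%nat -> In k (cube d M) -> In k (cube d N).
Proof.
rewrite !in_cube; intros h [hl hk]; split; auto; intros z hz; specialize (hk z hz); lia.
Qed.

Lemma cube_exists d k : length k = d -> exists N, In k (cube d N).
Proof.
intros hk; assert (H : exists N, forall z, In z k -> (Z.abs z <= Z.of_nat N)%Z).
  clear; induction k as [|z k [N IH]]; [exists 0%nat; simpl; tauto|].
  exists (Nat.max N (Z.to_nat (Z.abs z))); intros y [<-|hy]; [|specialize (IH y hy)]; lia.
destruct H as [N H]; exists N; apply in_cube; auto.
Qed.

Lemma list_in_cube d L : (forall k, In k L -> length k = d) ->
  exists N, forall k, In k L -> In k (cube d N).
Proof.
induction L as [|k L IH]; intros H; [exists 0%nat; simpl; tauto|].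
destruct IH as [N hN]; [intros; apply H; now right|].
destruct (cube_exists d k (H k (or_introl eq_refl))) as [M hM].
exists (Nat.max N M); intros j [<-|hj].
- apply (cube_mono d M); auto; lia.
- apply (cube_mono d N); auto; lia.
Qed.

Lemma cube_zneg d N k : In k (cube d N) -> In (zneg d k) (cube d N).
Proof.
rewrite !in_cube; intros [hl hk]; split; [apply zneg_length|].
intros z hz; apply in_map_iff in hz as (i & <- & hi); apply in_seq in hi.
rewrite Z.abs_opp; apply hk, nth_In; lia.
Qed.

(* A summable majorant of |k|^(-2d) whose sum factorizes over the coordinates. *)
Definition rho (k : list Z) : R := fold_right (fun z acc => 2 / (1 + IZR z ^ 2) * acc) 1 k.

Lemma rho_factor_pos z : 0 < 2 / (1 + IZR z ^ 2).
Proof. generalize (pow2_ge_0 (IZR z)); intros; apply Rdiv_lt_0_compat; lra. Qed.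

Lemma rho_pos k : 0 < rho k.
Proof.
induction k as [|z k IH]; simpl; [lra|]; apply Rmult_lt_0_compat; auto.
apply (rho_factor_pos z).
Qed.

(** The numerator 2 in [rho] is made for this: 1 + z^2 <= 2 B^2 when |z| <= B and B >= 1, so each
    coordinate contributes at least B^(-2). *)
Lemma rho_lower B k : 1 <= B -> (forall z, In z k -> Rabs (IZR z) <= B) ->
  / B ^ (2 * length k) <= rho k.
Proof.
intros hB; induction k as [|z k IH]; intros H.
  simpl; lra.
assert (h1 := IH (fun y hy => H y (or_intror hy))).
assert (h2 := H z (or_introl eq_refl)).
replace (2 * length (z :: k))%nat with (2 + 2 * length k)%nat by (simpl; lia).
rewrite pow_add, Rinv_mult; cbn [rho fold_right].
apply Rmult_le_compat.
- left; apply Rinv_0_lt_compat, pow_lt; lra.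
- left; apply Rinv_0_lt_compat, pow_lt; lra.
- assert (hz : IZR z ^ 2 <= B ^ 2) by (rewrite <- pow2_abs; apply pow_incr; split; [apply Rabs_pos | auto]).
  assert (0 <= IZR z ^ 2) by apply pow2_ge_0.
  apply (Rmult_le_reg_r (B ^ 2 * (1 + IZR z ^ 2))); [nra|].
  replace (/ B ^ 2 * (B ^ 2 * (1 + IZR z ^ 2))) with (1 + IZR z ^ 2) by (field; nra).
  replace (2 / (1 + IZR z ^ 2) * (B ^ 2 * (1 + IZR z ^ 2))) with (2 * B ^ 2)
    by (field; nra).
  nra.
- exact h1.
Qed.

Lemma rho_cube d N :
  Rsum_list rho (cube d N) = (Rsum_list (fun z => 2 / (1 + IZR z ^ 2)) (zrange N)) ^ d.
Proof.
induction d as [|d IH].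
  unfold Rsum_list; simpl; ring.
rewrite <- tech_pow_Rmult, <- IH; cbn [cube]; set (S := Rsum_list rho (cube d N)).
generalize (zrange N) as r; induction r as [|z r IHr]; cbn [flat_map].
  unfold Rsum_list; simpl; ring.
rewrite Rsum_app, Rsum_map, IHr.
change (Rsum_list (fun z0 => 2 / (1 + IZR z0 ^ 2)) (z :: r)) with
  (2 / (1 + IZR z ^ 2) + Rsum_list (fun z0 => 2 / (1 + IZR z0 ^ 2)) r).
change (fun x => rho (z :: x)) with (fun x => 2 / (1 + IZR z ^ 2) * rho x).
rewrite Rsum_scal; fold S; unfold Rsum_list; simpl; ring.
Qed.

(** The right-hand side telescopes: the two terms new at N + 1 add 4 / (1 + (N+1)^2), which is at
    most 8 / ((N+1)(N+2)) = 8/(N+1) - 8/(N+2). At N = 0 both sides equal 2. *)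
Lemma rho_zrange_bound N :
  Rsum_list (fun z => 2 / (1 + IZR z ^ 2)) (zrange N) <= 10 - 8 / (INR N + 1).
Proof.
induction N as [|N IH].
  unfold Rsum_list; simpl; lra.
rewrite (Rsum_perm _ _ (Z.of_nat (S N) :: (- Z.of_nat (S N))%Z :: zrange N)).
  set (f := fun z => 2 / (1 + IZR z ^ 2)) in *.
  change (f (Z.of_nat (S N)) + (f (- Z.of_nat (S N))%Z + Rsum_list f (zrange N))
    <= 10 - 8 / (INR (S N) + 1)).
  unfold f at 1 2; rewrite opp_IZR, <- INR_IZR_INZ, S_INR.
  assert (hN := pos_INR N); set (x := INR N) in *.
  assert (2 / (1 + (x + 1) ^ 2) + 2 / (1 + (- (x + 1)) ^ 2) <= 8 / (x + 1) - 8 / (x + 1 + 1));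
    [|lra].
  apply (Rmult_le_reg_r ((1 + (x + 1) ^ 2) * (x + 1) * (x + 1 + 1)));
    [repeat apply Rmult_lt_0_compat; nra|].
  replace ((2 / (1 + (x + 1) ^ 2) + 2 / (1 + (- (x + 1)) ^ 2)) *
    ((1 + (x + 1) ^ 2) * (x + 1) * (x + 1 + 1))) with (4 * (x + 1) * (x + 2))
    by (field; repeat split; nra).
  replace ((8 / (x + 1) - 8 / (x + 1 + 1)) * ((1 + (x + 1) ^ 2) * (x + 1) * (x + 1 + 1)))
    with (8 * (1 + (x + 1) ^ 2)) by (field; repeat split; nra).
  nra.
apply NoDup_Permutation.
- apply NoDup_zrange.
- constructor; [|constructor; [|apply NoDup_zrange]].
  + intros [h|h]; [|apply in_zrange in h]; lia.
  + intros h; apply in_zrange in h; lia.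
- intros z; cbn [In]; rewrite !in_zrange; lia.
Qed.

Lemma rho_sum_bound d L : NoDup L -> (forall k, In k L -> length k = d) ->
  Rsum_list rho L <= 10 ^ d.
Proof.
intros hn hl; destruct (list_in_cube d L hl) as [N hN].
apply Rle_trans with (Rsum_list rho (cube d N)).
  apply Rsum_support_le; auto; intros; left; apply rho_pos.
rewrite rho_cube; apply pow_incr; split.
  apply Rsum_nonneg; intros; left; apply rho_factor_pos.
eapply Rle_trans; [apply rho_zrange_bound|].
assert (0 < 8 / (INR N + 1)) by (apply Rdiv_lt_0_compat; [lra | generalize (pos_INR N); lra]).
lra.
Qed.

(** N0 is taken with the sum over its cube within eps of the supremum of all cube sums. A list
    disjoint from that cube fits, together with it, into a larger cube, whose sum is still below the
    supremum. *)
Lemma rho_tail d eps : 0 < eps -> exists N0, forall L, NoDup L ->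
  (forall k, In k L -> length k = d /\ ~ In k (cube d N0)) -> Rsum_list rho L <= eps.
Proof.
intros he; set (E := fun x => exists N, x = Rsum_list rho (cube d N)).
destruct (completeness E) as [S [hS1 hS2]].
- exists (10 ^ d); intros x [N ->]; apply rho_sum_bound; [apply NoDup_cube | apply cube_length].
- exists (Rsum_list rho (cube d 0)); now exists 0%nat.
- assert (exists N0, S - eps < Rsum_list rho (cube d N0)) as [N0 hN0].
    apply NNPP; intros H; assert (S <= S - eps); [|lra].
    apply hS2; intros x [N ->]; apply Rnot_lt_le; intros h; apply H; now exists N.
  exists N0; intros L hn hL.
  destruct (list_in_cube d (L ++ cube d N0)) as [N hN].
    intros k hk; apply in_app_or in hk as [hk|hk]; [apply hL, hk | now apply cube_length in hk].
  assert (Rsum_list rho (L ++ cube d N0) <= Rsum_list rho (cube d N)).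
    apply Rsum_support_le; auto; [|intros; left; apply rho_pos].
    apply NoDup_app; auto using NoDup_cube; intros k hk; apply hL, hk.
  rewrite Rsum_app in H; assert (Rsum_list rho (cube d N) <= S) by (apply hS1; now exists N).
  lra.
Qed.

(** The order of quantifiers matters: N0 depends on eps alone, so one cube serves a whole family of
    summands, such as all approximations or all times. *)
Lemma Csum_dominated_tail d eps : 0 < eps -> exists N0,
  forall D (f : list Z -> C), 0 <= D -> (forall k, length k = d -> Cmod (f k) <= D * rho k) ->
  forall L, NoDup L -> (forall k, In k L -> length k = d) ->
  (forall k, In k (cube d N0) -> In k L) ->
  Cmod (Cminus (Csum_list f L) (Csum_list f (cube d N0))) <= D * eps.
Proof.
intros he; destruct (rho_tail d eps he) as [N0 hN0]; exists N0; intros D f hD hf L hL hl hi.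
destruct (split_incl L (cube d N0) (NoDup_cube d N0) hi) as (r & hr & hp).
assert (hnr : NoDup (cube d N0 ++ r)) by (now apply Permutation_NoDup in hp).
rewrite (Csum_perm _ _ _ hp), Csum_app.
replace (Cminus _ _) with (Csum_list f r) by ring.
eapply Rle_trans; [apply Cmod_Csum|].
apply Rle_trans with (Rsum_list (fun k => D * rho k) r).
  apply Rsum_le; intros; apply hf, hl, hr; auto.
rewrite Rsum_scal; apply Rmult_le_compat_l; auto; apply hN0.
  now apply NoDup_app_remove_l in hnr.
intros k hk; split; [apply hl, hr, hk|]; intros hc.
clear - hnr hk hc; induction (cube d N0) as [|y c IH]; [destruct hc|].
inversion_clear hnr as [|? ? hy hn']; destruct hc as [->|hc]; auto.
apply hy, in_or_app; now right.
Qed.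

Lemma Csum_dominated_close d eps : 0 < eps -> exists N0,
  forall D (f : list Z -> C), 0 <= D -> (forall k, length k = d -> Cmod (f k) <= D * rho k) ->
  forall L L', NoDup L -> NoDup L' -> (forall k, In k L -> length k = d) ->
  (forall k, In k L' -> length k = d) ->
  (forall k, In k (cube d N0) -> In k L) -> (forall k, In k (cube d N0) -> In k L') ->
  Cmod (Cminus (Csum_list f L) (Csum_list f L')) <= D * eps.
Proof.
intros he; destruct (Csum_dominated_tail d (eps / 2) ltac:(lra)) as [N0 hN0]; exists N0.
intros D f hD hf L L' hn hn' hl hl' hi hi'.
assert (h1 := hN0 D f hD hf L hn hl hi); assert (h2 := hN0 D f hD hf L' hn' hl' hi').
replace (Cminus (Csum_list f L) (Csum_list f L')) with
  (Cplus (Cminus (Csum_list f L) (Csum_list f (cube d N0)))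
    (Copp (Cminus (Csum_list f L') (Csum_list f (cube d N0))))) by ring.
eapply Rle_trans; [apply Cmod_triangle|]; rewrite Cmod_opp; lra.
Qed.

(** * Gevrey weights *)

Section PowerWeights.
Variable a : R.
Hypothesis ha : 0 < a <= 1.

Lemma Rpower_pos x : 0 < Rpower x a.
Proof. apply exp_pos. Qed.

Lemma Rpower_ge1 x : 1 <= x -> 1 <= Rpower x a.
Proof.
intros hx; rewrite <- (Rpower_O x) by lra; apply Rle_Rpower; lra.
Qed.

Lemma Rpower_le_self x : 1 <= x -> Rpower x a <= x.
Proof.
intros hx; rewrite <- (Rpower_1 x) at 2 by lra; apply Rle_Rpower; lra.
Qed.

Lemma Rpower_le1_ge_self u : 0 < u <= 1 -> u <= Rpower u a.
Proof.
intros hu; unfold Rpower; rewrite <- (exp_ln u) at 1 by lra.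
assert (ln u <= 0).
  rewrite <- ln_1; destruct (proj2 hu) as [h| ->]; [left; apply ln_increasing|]; lra.
assert (ln u <= a * ln u) by nra.
destruct H0 as [h| <-]; [left; now apply exp_increasing | lra].
Qed.

(** The two proportions x/(x+y) and y/(x+y) add up to 1, and u <= u^a for u in (0,1]. With a = 1/s
    this is where s >= 1 makes exp(sg |k|^a) submultiplicative under convolution. *)
Lemma Rpower_subadd x y : 0 < x -> 0 < y -> Rpower (x + y) a <= Rpower x a + Rpower y a.
Proof.
intros hx hy.
assert (K : forall u, 0 < u -> u <= x + y ->
  u / (x + y) * Rpower (x + y) a <= Rpower u a).
  intros u hu hu'; replace (Rpower u a) with (Rpower (u / (x + y)) a * Rpower (x + y) a).
  - apply Rmult_le_compat_r; [left; apply Rpower_pos|]; apply Rpower_le1_ge_self; split.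
      apply Rdiv_lt_0_compat; lra.
    apply (Rmult_le_reg_r (x + y)); [lra|]; unfold Rdiv; rewrite Rmult_assoc, Rinv_l; lra.
  - rewrite Rpower_mult_distr; [f_equal; field; lra | apply Rdiv_lt_0_compat | ]; lra.
generalize (K x hx ltac:(lra)) (K y hy ltac:(lra)).
replace (Rpower (x + y) a) with (x / (x + y) * Rpower (x + y) a + y / (x + y) * Rpower (x + y) a)
  at 3 by (field; lra); lra.
Qed.

Lemma Rpower_add_le x y z : 1 <= x -> 1 <= y -> 1 <= z -> x <= y + z ->
  Rpower x a <= Rpower y a + Rpower z a.
Proof.
intros hx hy hz h; eapply Rle_trans; [|apply Rpower_subadd; lra]; apply Rle_Rpower_l; lra.
Qed.

Lemma Rpower_submult x y z : 1 <= x -> 1 <= y -> 1 <= z -> x <= y + z ->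
  Rpower x a <= 2 * (Rpower y a * Rpower z a).
Proof.
intros hx hy hz h; generalize (Rpower_add_le x y z hx hy hz h) (Rpower_ge1 y hy)
  (Rpower_ge1 z hz); nra.
Qed.

(** With y = (n+1) u one has exp y = (exp u)^(n+1), while u <= exp u and 1 <= exp u. *)
Lemma exp_ge_pow n y : 0 <= y -> y ^ n <= INR (S n) ^ n * exp y.
Proof.
intros hy; assert (hn : 0 < INR (S n)) by (apply lt_0_INR; lia).
set (u := y / INR (S n)); assert (hu : 0 <= u) by (apply Rdiv_le_0_compat; lra).
assert (E : y = INR (S n) * u) by (unfold u; field; lra).
assert (he : exp y = exp u ^ S n).
  rewrite E at 1; clearbody u; clear; induction (S n) as [|m IH].
    simpl; rewrite Rmult_0_l, exp_0; lra.
  rewrite S_INR, <- tech_pow_Rmult, <- IH, <- exp_plus; f_equal; ring.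
rewrite he, E at 1; rewrite Rpow_mult_distr; apply Rmult_le_compat_l; [apply pow_le; lra|].
assert (h1 : u <= exp u) by (destruct (Req_dec u 0) as [-> | hn0];
  [rewrite exp_0; lra | left; generalize (exp_ineq1 u hn0); lra]).
assert (h2 : 1 <= exp u) by (destruct (Req_dec u 0) as [-> | hn0];
  [rewrite exp_0; lra | generalize (exp_ineq1 u hn0); lra]).
rewrite <- tech_pow_Rmult; apply Rle_trans with (exp u ^ n); [apply pow_incr; lra|].
assert (0 <= exp u ^ n) by (apply pow_le; lra); nra.
Qed.

(** For q > n/a, x^n <= (x^a)^q, and a power of c x^a is dominated by its exponential. Hence any
    power of |k| can be bought with an arbitrarily small loss of Gevrey radius. *)
Lemma pow_le_exp_Rpower n c : 0 < c ->
  exists B, 0 < B /\ forall x, 1 <= x -> x ^ n <= B * exp (c * Rpower x a).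
Proof.
intros hc; destruct (INR_unbounded (INR n / a)) as [q hq].
exists (INR (S q) ^ q * (/ c) ^ q); split.
  apply Rmult_lt_0_compat; apply pow_lt; [apply lt_0_INR; lia | now apply Rinv_0_lt_compat].
intros x hx; set (y := Rpower x a).
assert (hy : 0 < y) by apply Rpower_pos.
assert (h1 : x ^ n <= y ^ q).
  unfold y; rewrite <- !Rpower_pow, Rpower_mult by (try apply Rpower_pos; lra).
  apply Rle_Rpower; auto; left; apply (Rmult_lt_reg_r (/ a)); [apply Rinv_0_lt_compat; lra|].
  replace (a * INR q * / a) with (INR q) by (field; lra); exact hq.
assert (h2 : (c * y) ^ q <= INR (S q) ^ q * exp (c * y)) by (apply exp_ge_pow; nra).
rewrite Rpow_mult_distr in h2; eapply Rle_trans; [exact h1|].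
replace (y ^ q) with ((/ c) ^ q * (c ^ q * y ^ q)).
- rewrite (Rmult_comm (INR (S q) ^ q)), Rmult_assoc; apply Rmult_le_compat_l; auto.
  apply pow_le; left; now apply Rinv_0_lt_compat.
- rewrite <- Rmult_assoc, <- Rpow_mult_distr, Rinv_l, pow1; lra.
Qed.

Definition mw (p : nat) (sg x : R) : R := x ^ p * exp (sg * Rpower x a).

Lemma mwE p sg x : mw p sg x = x ^ p * exp (sg * Rpower x a).
Proof. reflexivity. Qed.

Lemma mw_pos p sg x : 1 <= x -> 0 < mw p sg x.
Proof. intros hx; apply Rmult_lt_0_compat; [apply pow_lt; lra | apply exp_pos]. Qed.

Lemma exp_le u v : u <= v -> exp u <= exp v.
Proof. intros [h| ->]; [left; now apply exp_increasing | lra]. Qed.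

Lemma mw_ge_pow p sg x : 0 <= sg -> 1 <= x -> x ^ p <= mw p sg x.
Proof.
intros hs hx; unfold mw; rewrite <- (Rmult_1_r (x ^ p)) at 1.
apply Rmult_le_compat_l; [apply pow_le; lra|]; rewrite <- exp_0; apply exp_le.
apply Rmult_le_pos; auto; left; apply Rpower_pos.
Qed.

Lemma mw_exp_le sg x y z : 0 <= sg -> 1 <= x -> 1 <= y -> 1 <= z -> x <= y + z ->
  exp (sg * Rpower x a) <= exp (sg * Rpower y a) * exp (sg * Rpower z a).
Proof.
intros; rewrite <- exp_plus, <- Rmult_plus_distr_l; apply exp_le.
apply Rmult_le_compat_l; auto; apply Rpower_add_le; auto.
Qed.

Lemma mw_submult p sg x y z : 0 <= sg -> 1 <= x -> 1 <= y -> 1 <= z -> x <= y + z ->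
  mw p sg x <= 2 ^ p * (mw p sg y * mw p sg z).
Proof.
intros hs hx hy hz h; unfold mw.
replace (2 ^ p * (y ^ p * exp (sg * Rpower y a) * (z ^ p * exp (sg * Rpower z a)))) with
  ((2 * (y * z)) ^ p * (exp (sg * Rpower y a) * exp (sg * Rpower z a)))
  by (rewrite !Rpow_mult_distr; ring).
apply Rmult_le_compat; [apply pow_le; lra | left; apply exp_pos | apply pow_incr; nra |].
apply mw_exp_le; auto.
Qed.

Lemma mw_derive p sg x : 0 < x ->
  is_derive (mw p sg) x ((INR p + sg * a * Rpower x a) * mw p sg x / x).
Proof.
intros hx; unfold mw, Rpower; auto_derive; [lra|].
destruct p as [|p]; [simpl; field; lra|].
change (pred (S p)) with p; rewrite <- tech_pow_Rmult; field; lra.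
Qed.

(* If z >= y/2 the two weights are comparable to m(z) and nothing cancels; if z < y/2
   the mean value theorem trades one power of y for z y^a. *)
Lemma mw_diff p sg S x y z : 0 <= sg <= S -> 1 <= x -> 1 <= y -> 1 <= z ->
  Rabs (x - y) <= z ->
  y * Rabs (mw p sg x - mw p sg y) <= (3 ^ p + 4 * (INR p + S) * 2 ^ p) *
    (Rpower y a * mw p sg y * (z * exp (sg * Rpower z a))
     + mw p sg z * (y * exp (sg * Rpower y a))).
Proof.
intros hs hx hy hz hxy.
assert (hp := pos_INR p).
assert (h3 : 0 < 3 ^ p) by (apply pow_lt; lra).
assert (h2 : 0 < 2 ^ p) by (apply pow_lt; lra).
assert (hmy := mw_pos p sg y hy); assert (hmz := mw_pos p sg z hz).
assert (hmx := mw_pos p sg x hx).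
assert (hey := exp_pos (sg * Rpower y a)); assert (hez := exp_pos (sg * Rpower z a)).
assert (hya := Rpower_pos y); assert (hza := Rpower_ge1 z hz).
set (I1 := Rpower y a * mw p sg y * (z * exp (sg * Rpower z a))).
set (I2 := mw p sg z * (y * exp (sg * Rpower y a))).
assert (hI1 : 0 < I1).
  apply Rmult_lt_0_compat; apply Rmult_lt_0_compat; lra.
assert (hI2 : 0 < I2).
  apply Rmult_lt_0_compat; [|apply Rmult_lt_0_compat]; lra.
assert (hK : 0 <= 4 * (INR p + S) * 2 ^ p) by (apply Rmult_le_pos; nra).
assert (hb := Rabs_def2 _ _ (Rle_lt_trans _ _ _ hxy (Rlt_plus_1 z))).
assert (hxz : x - y <= z) by (eapply Rle_trans; [apply Rle_abs | auto]).
assert (hyz : y - x <= z) by (rewrite Rabs_minus_sym in hxy; eapply Rle_trans; [apply Rle_abs | auto]).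
clear hb; destruct (Rle_lt_dec (y / 2) z) as [c|c].
(* Here y <= 2 z, so x and y are both at most 3 z: the origin of 3^p. *)
- assert (Hb : forall u, 1 <= u -> u <= y + z ->
    mw p sg u <= 3 ^ p * (mw p sg z * exp (sg * Rpower y a))).
    intros u hu hu'; unfold mw.
    replace (3 ^ p * (z ^ p * exp (sg * Rpower z a) * exp (sg * Rpower y a))) with
      ((3 * z) ^ p * (exp (sg * Rpower y a) * exp (sg * Rpower z a)))
      by (rewrite Rpow_mult_distr; ring).
    apply Rmult_le_compat; [apply pow_le; lra | left; apply exp_pos
      | apply pow_incr; lra | apply mw_exp_le; lra].
  assert (A : Rabs (mw p sg x - mw p sg y) <= 3 ^ p * (mw p sg z * exp (sg * Rpower y a))).
    generalize (Hb x hx ltac:(lra)) (Hb y hy ltac:(lra)); intros.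
    apply Rabs_le; lra.
  apply Rle_trans with (3 ^ p * I2).
  + unfold I2; replace (3 ^ p * (mw p sg z * (y * exp (sg * Rpower y a)))) with
      (y * (3 ^ p * (mw p sg z * exp (sg * Rpower y a)))) by ring.
    apply Rmult_le_compat_l; lra.
  + nra.
(* The intermediate point t lies between y/2 and 2 y. From t >= y/2 comes y/t <= 2, and from t <= y
   + z <= 2 y come t^a <= 2 y^a and t^p <= 2^p y^p; together they give 4 (p + S) 2^p. *)
- destruct (MVT_gen (mw p sg) y x
    (fun t => (INR p + sg * a * Rpower t a) * mw p sg t / t)) as (t & ht & Et).
  + intros t ht; apply mw_derive; unfold Rmin in ht; destruct (Rle_dec y x); lra.
  + intros t ht; apply derivable_continuous_pt.
    eexists; apply is_derive_Reals, mw_derive; unfold Rmin in ht; destruct (Rle_dec y x); lra.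
  + assert (h1 : 1 <= t) by (unfold Rmin in ht; destruct (Rle_dec y x); lra).
    assert (h4 : y / 2 <= t) by (unfold Rmin in ht; destruct (Rle_dec y x); lra).
    assert (h5 : t <= y + z) by (unfold Rmax in ht; destruct (Rle_dec y x); lra).
    assert (hta := Rpower_ge1 t h1); assert (hmt := mw_pos p sg t h1).
    rewrite Et, Rabs_mult.
    set (A := (INR p + sg * a * Rpower t a) * mw p sg t).
    assert (hA0 : 0 <= sg * a * Rpower t a) by (apply Rmult_le_pos; [apply Rmult_le_pos|]; lra).
    assert (hA : 0 <= A) by (apply Rmult_le_pos; lra).
    assert (hA2 : A <= (INR p + S) * Rpower t a * mw p sg t).
      apply Rmult_le_compat_r; [lra|].
      assert (sg * a <= S) by nra.
      assert (sg * a * Rpower t a <= S * Rpower t a) by (apply Rmult_le_compat_r; lra).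
      nra.
    assert (hta2 : Rpower t a <= 2 * Rpower y a).
      assert (Rpower z a <= Rpower y a) by (apply Rle_Rpower_l; lra).
      generalize (Rpower_add_le t y z h1 hy hz h5); lra.
    assert (hmt2 : mw p sg t <= 2 ^ p * (mw p sg y * exp (sg * Rpower z a))).
      unfold mw.
      replace (2 ^ p * (y ^ p * exp (sg * Rpower y a) * exp (sg * Rpower z a))) with
        ((2 * y) ^ p * (exp (sg * Rpower y a) * exp (sg * Rpower z a)))
        by (rewrite Rpow_mult_distr; ring).
      apply Rmult_le_compat; [apply pow_le; lra | left; apply exp_pos
        | apply pow_incr; lra | apply mw_exp_le; lra].
    assert (hyt : y * (A / t) <= 2 * A).
      apply (Rmult_le_reg_r t); [lra|]; replace (y * (A / t) * t) with (y * A) by (field; lra).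
      nra.
    rewrite (Rabs_pos_eq (A / t)) by (apply Rdiv_le_0_compat; lra).
    rewrite <- Rmult_assoc.
    assert (hA3 : A <= (INR p + S) * (2 * Rpower y a) * (2 ^ p * (mw p sg y * exp (sg * Rpower z a)))).
      eapply Rle_trans; [exact hA2|]; apply Rmult_le_compat; try lra.
      * apply Rmult_le_pos; lra.
      * apply Rmult_le_compat_l; lra.
    apply Rle_trans with (2 * A * z).
      apply Rmult_le_compat; auto using Rabs_pos.
      apply Rmult_le_pos; [lra | apply Rdiv_le_0_compat; lra].
    apply Rle_trans with (4 * (INR p + S) * 2 ^ p * I1); [unfold I1 | nra].
    replace (4 * (INR p + S) * 2 ^ p * (Rpower y a * mw p sg y * (z * exp (sg * Rpower z a))))
     with (2 * ((INR p + S) * (2 * Rpower y a) * (2 ^ p * (mw p sg y * exp (sg * Rpower z a)))) * z)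
      by ring.
    apply Rmult_le_compat_r; lra.
Qed.

End PowerWeights.

(* [Rmax 1] only matters at the zero frequency, where it keeps every weight positive. *)
Definition bn (k : list Z) : R := Rmax 1 (znorm k).

Section Bracket.
Variable d : nat.

Lemma bn_ge1 k : 1 <= bn k.
Proof. apply Rmax_l. Qed.

Lemma znorm_le_bn k : znorm k <= bn k.
Proof. apply Rmax_r. Qed.

Lemma bn_add k l : length k = d -> length l = d -> bn k <= bn l + bn (zsub d k l).
Proof.
intros hk hl; generalize (znorm_zsub_le d k l hk hl) (znorm_le_bn l) (bn_ge1 l)
  (znorm_le_bn (zsub d k l)) (bn_ge1 (zsub d k l)); intros; apply Rmax_lub; lra.
Qed.

Lemma bn_zsub_sym k l : bn (zsub d k l) = bn (zsub d l k).
Proof. unfold bn; now rewrite znorm_zsub_sym. Qed.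

Lemma bn_diff k l : length k = d -> length l = d -> Rabs (bn k - bn l) <= bn (zsub d k l).
Proof.
intros hk hl; generalize (bn_add k l hk hl) (bn_add l k hl hk).
rewrite (bn_zsub_sym l k); intros; apply Rabs_le; lra.
Qed.

Lemma bn_zneg k : length k = d -> bn (zneg d k) = bn k.
Proof. intros; unfold bn; now rewrite znorm_zneg. Qed.

Lemma bn_zsub_le k l : length k = d -> length l = d -> bn (zsub d k l) <= bn k + bn l.
Proof.
intros hk hl; rewrite <- (bn_zneg l) by auto.
replace (zneg d l) with (zsub d (zsub d k l) k); [apply bn_add; auto using zsub_length|].
apply (zlist_ext d); auto using zsub_length, zneg_length; intros i hi.
rewrite zc_zneg, !zc_zsub by auto; lia.
Qed.

Lemma bn_zis0_false k : length k = d -> zis0 k = false -> bn k = znorm k.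
Proof. intros hk h; apply Rmax_right, (zis0_false d); auto. Qed.

Lemma rho_ge_bn k : length k = d -> / bn k ^ (2 * d) <= rho k.
Proof.
intros hk; rewrite <- hk; apply rho_lower; [apply bn_ge1|].
intros z hz; destruct (In_nth _ _ 0%Z hz) as (i & hi & <-).
eapply Rle_trans; [apply (znorm_coord (length k)); auto | apply znorm_le_bn].
Qed.

End Bracket.

(** * The bilinear transport term in Fourier variables *)

(** The j-th contribution to the k-th coefficient of (T th).grad ph. The advecting and the advected
    function are kept apart because the energy estimate for the difference of two solutions treats
    them differently. *)
Definition nl_term (d : nat) (That : list Z -> nat -> R) (th ph : list Z -> C) (k j : list Z) : C :=
  Cmult (Cmult Ci (RtoC (vdotZ d (That j) (zsub d k j)))) (Cmult (th j) (ph (zsub d k j))).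

Lemma Cmod_Ci : Cmod Ci = 1.
Proof. unfold Cmod, Ci; simpl; transitivity (sqrt 1); [f_equal; ring | apply sqrt_1]. Qed.

Lemma Cmod_nl_term d That th ph k j : Cmod (nl_term d That th ph k j) =
  Rabs (vdotZ d (That j) (zsub d k j)) * Cmod (th j) * Cmod (ph (zsub d k j)).
Proof. unfold nl_term; rewrite !Cmod_mult, Cmod_Ci, Cmod_R; ring. Qed.

Definition decay (d q : nat) (A : R) (th : list Z -> C) : Prop :=
  forall k, length k = d -> Cmod (th k) * bn k ^ q <= A.

Lemma bn_pow_ge1 k q : 1 <= bn k ^ q.
Proof. apply pow_R1_Rle, bn_ge1. Qed.

Lemma bn_pow_mono k q q' : (q <= q')%nat -> bn k ^ q <= bn k ^ q'.
Proof. intros; apply Rle_pow; auto; apply bn_ge1. Qed.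

Lemma decay_mono d q q' A th : (q <= q')%nat -> decay d q' A th -> decay d q A th.
Proof.
intros h H k hk; eapply Rle_trans; [|apply (H k hk)].
apply Rmult_le_compat_l; [apply Cmod_ge_0 | now apply bn_pow_mono].
Qed.

Lemma decay_bound d q A th k : decay d q A th -> length k = d -> Cmod (th k) <= A.
Proof.
intros H hk; generalize (H k hk) (bn_pow_ge1 k q) (Cmod_ge_0 (th k)); nra.
Qed.

Lemma decay_nonneg d q A th : decay d q A th -> 0 <= A.
Proof.
intros H; generalize (decay_bound d q A th (zzero d) H (zzero_length d))
  (Cmod_ge_0 (th (zzero d))); lra.
Qed.

Lemma decay_rho d q A th k : decay d (q + 2 * d) A th -> length k = d ->
  Cmod (th k) * bn k ^ q <= A * rho k.
Proof.
intros H hk; assert (h := H k hk); rewrite pow_add in h.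
assert (hA := decay_nonneg _ _ _ _ H).
assert (hp := bn_pow_ge1 k (2 * d)).
apply Rle_trans with (A * / bn k ^ (2 * d)).
- apply (Rmult_le_reg_r (bn k ^ (2 * d))); [lra|].
  replace (A * / bn k ^ (2 * d) * bn k ^ (2 * d)) with A by (field; lra); lra.
- apply Rmult_le_compat_l; auto; now apply rho_ge_bn.
Qed.

Section Nonlinearity.
Variables (d : nat) (That : list Z -> nat -> R) (C0 a : R).
Hypothesis ha : 0 < a <= 1.
Hypothesis hC0 : 0 < C0.
Hypothesis hdiv : forall k, length k = d -> vdotZ d (That k) k = 0.
Hypothesis hsym : forall j l, length j = d -> length l = d -> zis0 j = false ->
  Rabs (vdotZ d (That j) l) <= C0 * Rpower (bn j) a * bn l.

Let tm := nl_term d That.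

(** [hsym] speaks of nonzero frequencies; at zero the coefficient of a mean-free function
    vanishes. *)
Lemma sym_term th j l : length j = d -> length l = d -> th (zzero d) = RtoC 0 ->
  Rabs (vdotZ d (That j) l) * Cmod (th j) <= C0 * Rpower (bn j) a * bn l * Cmod (th j).
Proof.
intros hj hl h0; destruct (zis0 j) eqn:E.
  apply (zis0_true d) in E; auto; rewrite E, h0, Cmod_0; lra.
apply Rmult_le_compat_r; [apply Cmod_ge_0 | now apply hsym].
Qed.

(** Since That(j).j = 0, That(j).(k - j) = That(j).k: the derivative can be put on the output
    frequency k, which leaves the sum over j. *)
Lemma sym_term_k th k j : length j = d -> length k = d -> th (zzero d) = RtoC 0 ->
  Rabs (vdotZ d (That j) (zsub d k j)) * Cmod (th j) <= C0 * bn k * (Cmod (th j) * bn j).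
Proof.
intros hj hk h0; rewrite vdotZ_zsub, (hdiv j), Rminus_0_r by auto.
eapply Rle_trans; [now apply sym_term|].
assert (h := Rpower_le_self a ha (bn j) (bn_ge1 j)).
assert (h1 := bn_ge1 k); assert (h2 := Cmod_ge_0 (th j)).
replace (C0 * Rpower (bn j) a * bn k * Cmod (th j)) with
  (C0 * bn k * Cmod (th j) * Rpower (bn j) a) by ring.
replace (C0 * bn k * (Cmod (th j) * bn j)) with (C0 * bn k * Cmod (th j) * bn j) by ring.
apply Rmult_le_compat_l; auto; apply Rmult_le_pos; nra.
Qed.

Lemma bn_submult k j : length k = d -> length j = d -> bn k <= 2 * (bn j * bn (zsub d k j)).
Proof.
intros hk hj; generalize (bn_add d k j hk hj) (bn_ge1 j) (bn_ge1 (zsub d k j)); nra.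
Qed.

(** The weight |k|^q is shared by the two factors through |k| <= 2 |j| |k-j|. The advecting factor
    spends one more power on the symbol and 2d powers on [rho]. *)
Lemma nl_term_decay q A B th ph k j : length k = d -> length j = d ->
  th (zzero d) = RtoC 0 -> decay d (S q + 2 * d) A th -> decay d q B ph ->
  Cmod (tm th ph k j) * bn k ^ q <= 2 ^ q * C0 * A * B * bn k * rho j.
Proof.
intros hk hj h0 hA hB; unfold tm; rewrite Cmod_nl_term.
assert (h1 := sym_term_k th k j hj hk h0).
assert (h2 := decay_rho d (S q) A th j hA hj).
assert (h3 := hB (zsub d k j) (zsub_length d k j)).
assert (h4 : bn k ^ q <= 2 ^ q * (bn j ^ q * bn (zsub d k j) ^ q)).
  rewrite <- !Rpow_mult_distr; apply pow_incr; split;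
  [generalize (bn_ge1 k); lra | now apply bn_submult].
assert (hb := bn_ge1 k); assert (hq := bn_pow_ge1 j q); assert (hq' := bn_pow_ge1 (zsub d k j) q).
assert (ht := Cmod_ge_0 (th j)); assert (hp := Cmod_ge_0 (ph (zsub d k j))).
assert (h2q : 0 < 2 ^ q) by (apply pow_lt; lra).
set (V := Rabs (vdotZ d (That j) (zsub d k j))) in *.
assert (hV : 0 <= V) by apply Rabs_pos.
set (x := Cmod (th j)) in *; set (y := Cmod (ph (zsub d k j))) in *.
set (bj := bn j ^ q) in *; set (bl := bn (zsub d k j) ^ q) in *.
apply Rle_trans with (V * x * y * (2 ^ q * (bj * bl))).
  apply Rmult_le_compat_l; auto; repeat apply Rmult_le_pos; auto.
replace (V * x * y * (2 ^ q * (bj * bl))) with (2 ^ q * ((V * x) * bj) * (y * bl)) by ring.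
replace (2 ^ q * C0 * A * B * bn k * rho j) with (2 ^ q * (C0 * bn k * (A * rho j)) * B) by ring.
assert (hVx : 0 <= V * x) by now apply Rmult_le_pos.
apply Rmult_le_compat; auto.
- repeat apply Rmult_le_pos; lra.
- apply Rmult_le_pos; lra.
- apply Rmult_le_compat_l; [lra|].
  apply Rle_trans with (C0 * bn k * (x * bn j) * bj); [apply Rmult_le_compat_r; lra|].
  rewrite <- tech_pow_Rmult in h2; fold bj in h2; rewrite Rmult_assoc.
  apply Rmult_le_compat_l; [nra | lra].
Qed.

Lemma nl_term_rho A B th ph k j : length k = d -> length j = d ->
  th (zzero d) = RtoC 0 -> decay d (1 + 2 * d) A th -> decay d 0 B ph ->
  Cmod (tm th ph k j) <= C0 * A * B * bn k * rho j.
Proof.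
intros hk hj h0 hA hB; generalize (nl_term_decay 0 A B th ph k j hk hj h0 hA hB).
rewrite !pow_O, Rmult_1_r, Rmult_1_l; auto.
Qed.

(** Here summability is drawn from the advected function, as is wanted when the sum is truncated in
    its frequency k - j. *)
Lemma nl_term_rho_swap A B th ph k j : length k = d -> length j = d ->
  th (zzero d) = RtoC 0 -> decay d 1 A th -> decay d (2 * d) B ph ->
  Cmod (tm th ph k j) <= C0 * A * B * bn k * rho (zsub d k j).
Proof.
intros hk hj h0 hA hB; unfold tm; rewrite Cmod_nl_term.
assert (h1 := sym_term_k th k j hj hk h0).
assert (h2 := hA j hj); rewrite pow_1 in h2.
assert (h3 := decay_rho d 0 B ph (zsub d k j) hB (zsub_length d k j)).
rewrite pow_O, Rmult_1_r in h3.
assert (hb := bn_ge1 k).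
replace (C0 * A * B * bn k * rho (zsub d k j)) with
  ((C0 * bn k * A) * (B * rho (zsub d k j))) by ring.
apply Rmult_le_compat; auto using Cmod_ge_0.
- apply Rmult_le_pos; [apply Rabs_pos | apply Cmod_ge_0].
- eapply Rle_trans; [exact h1|]; apply Rmult_le_compat_l; [nra | auto].
Qed.

Lemma nl_sum_decay q A B th ph k L : length k = d -> NoDup L ->
  (forall j, In j L -> length j = d) ->
  th (zzero d) = RtoC 0 -> decay d (S q + 2 * d) A th -> decay d q B ph ->
  Cmod (Csum_list (tm th ph k) L) * bn k ^ q <= 2 ^ q * C0 * A * B * bn k * 10 ^ d.
Proof.
intros hk hn hL h0 hA hB.
assert (hA0 := decay_nonneg _ _ _ _ hA); assert (hB0 := decay_nonneg _ _ _ _ hB).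
assert (hb := bn_pow_ge1 k q); assert (h2q : 0 < 2 ^ q) by (apply pow_lt; lra).
eapply Rle_trans.
  apply Rmult_le_compat_r; [lra | apply Cmod_Csum].
rewrite Rmult_comm, <- Rsum_scal.
apply Rle_trans with (Rsum_list (fun j => 2 ^ q * C0 * A * B * bn k * rho j) L).
  apply Rsum_le; intros j hj; rewrite Rmult_comm; apply nl_term_decay; auto.
rewrite Rsum_scal; apply Rmult_le_compat_l; [|apply rho_sum_bound; auto].
assert (h1 := bn_ge1 k); repeat apply Rmult_le_pos; lra.
Qed.

End Nonlinearity.

(** * Energy estimates for the transport term *)

Local Opaque mw.

Section Energy.
Variables (d : nat) (That : list Z -> nat -> R) (C0 a S0 : R) (p : nat).
Hypothesis ha : 0 < a <= 1.
Hypothesis hC0 : 0 < C0.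
Hypothesis hdiv : forall k, length k = d -> vdotZ d (That k) k = 0.
Hypothesis heven : forall k, length k = d -> forall i, (i < d)%nat ->
  That (zneg d k) i = That k i.
Hypothesis hsym : forall j l, length j = d -> length l = d -> zis0 j = false ->
  Rabs (vdotZ d (That j) l) <= C0 * Rpower (bn j) a * bn l.
Hypothesis hp : (2 * d + 3 <= p)%nat.

Let tm := nl_term d That.
Let g (k : list Z) := Rpower (bn k) a.
Let M (sg : R) (k : list Z) := mw a p sg (bn k).
Let K := 3 ^ p + 4 * (INR p + S0) * 2 ^ p.

Lemma bn_power_ge1 k : 1 <= g k.
Proof. apply Rpower_ge1; [lra | apply bn_ge1]. Qed.

Lemma bn_power_submult k l : length k = d -> length l = d -> g k <= 2 * (g l * g (zsub d k l)).
Proof.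
intros; apply Rpower_submult; auto using bn_ge1; now apply bn_add.
Qed.

Lemma weight_pos sg k : 0 < M sg k.
Proof. apply mw_pos, bn_ge1. Qed.

Lemma nl_term_zsub th ph k l : length l = d -> tm th ph k (zsub d k l) =
  Cmult (Cmult Ci (RtoC (vdotZ d (That (zsub d k l)) l))) (Cmult (th (zsub d k l)) (ph l)).
Proof. intros hl; unfold tm, nl_term; now rewrite zsub_zsub. Qed.

(* u.grad is skew-adjoint because u is divergence-free and real. *)
Lemma nl_term_skew th ph k l : length k = d -> length l = d -> real_meanfree d th ->
  Re (Cmult (Cconj (ph l)) (tm th ph l (zsub d l k))) =
  - Re (Cmult (Cconj (ph k)) (tm th ph k (zsub d k l))).
Proof.
intros hk hl [_ hr]; rewrite !nl_term_zsub by auto.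
assert (E : vdotZ d (That (zsub d l k)) k = vdotZ d (That (zsub d k l)) l).
  rewrite <- (zneg_zsub d k l); rewrite (vdotZ_ext d _ (That (zsub d k l)))
    by (intros; apply heven; auto using zsub_length).
  generalize (hdiv (zsub d k l) (zsub_length d k l)); rewrite vdotZ_zsub; lra.
rewrite E, <- (zneg_zsub d k l), hr by apply zsub_length.
set (V := vdotZ d (That (zsub d k l)) l).
destruct (th (zsub d k l)) as [x y], (ph k) as [u v], (ph l) as [u' v'].
unfold Cmult, Cconj, Ci, RtoC, Re; simpl; ring.
Qed.

Lemma Re_le_Cmod z : Rabs (Re z) <= Cmod z.
Proof.
eapply Rle_trans; [|apply Rmax_Cmod]; apply Rmax_l.
Qed.

(** By [nl_term_skew] the form q(k,l) is antisymmetric, so its sum against the symmetric weight m(k)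
    m(l) vanishes; subtracting it turns m(k)^2 into m(k) (m(k) - m(l)). Both indices must run
    through the same list. *)
Lemma transport_commutator th ph sg L : (forall k, In k L -> length k = d) ->
  real_meanfree d th ->
  Rabs (Rsum_list (fun k => Rsum_list (fun l =>
    M sg k ^ 2 * Re (Cmult (Cconj (ph k)) (tm th ph k (zsub d k l)))) L) L)
  <= Rsum_list (fun k => Rsum_list (fun l =>
    M sg k * Cmod (ph k) * Rabs (M sg k - M sg l) * Cmod (tm th ph k (zsub d k l))) L) L.
Proof.
intros hL hr; set (q := fun k l => Re (Cmult (Cconj (ph k)) (tm th ph k (zsub d k l)))).
assert (Z : Rsum_list (fun k => Rsum_list (fun l => M sg k * M sg l * q k l) L) L = 0).
  assert (E : Rsum_list (fun k => Rsum_list (fun l => M sg k * M sg l * q k l) L) L =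
     - Rsum_list (fun k => Rsum_list (fun l => M sg k * M sg l * q k l) L) L); [|lra].
  rewrite Rsum_swap at 1; rewrite <- Rsum_opp; apply Rsum_ext; intros l hl.
  rewrite <- Rsum_opp; apply Rsum_ext; intros k hk.
  unfold q; rewrite (nl_term_skew th ph l k); auto; ring.
change (Rabs (Rsum_list (fun k => Rsum_list (fun l => M sg k ^ 2 * q k l) L) L) <=
  Rsum_list (fun k => Rsum_list (fun l =>
    M sg k * Cmod (ph k) * Rabs (M sg k - M sg l) * Cmod (tm th ph k (zsub d k l))) L) L).
replace (Rsum_list (fun k => Rsum_list (fun l => M sg k ^ 2 * q k l) L) L) with
  (Rsum_list (fun k => Rsum_list (fun l => M sg k * (M sg k - M sg l) * q k l) L) L).
- eapply Rle_trans; [apply Rsum_abs|]; apply Rsum_le; intros k hk.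
  eapply Rle_trans; [apply Rsum_abs|]; apply Rsum_le; intros l hl.
  rewrite (Rabs_mult _ (q k l)). rewrite (Rabs_mult (M sg k)), (Rabs_pos_eq (M sg k)) by (left; apply weight_pos).
  assert (h := Re_le_Cmod (Cmult (Cconj (ph k)) (tm th ph k (zsub d k l)))).
  rewrite Cmod_mult, Cmod_conj in h.
  replace (M sg k * Cmod (ph k) * Rabs (M sg k - M sg l) * Cmod (tm th ph k (zsub d k l)))
    with (M sg k * Rabs (M sg k - M sg l) * (Cmod (ph k) * Cmod (tm th ph k (zsub d k l)))) by ring.
  apply Rmult_le_compat_l; auto.
  apply Rmult_le_pos; [left; apply weight_pos | apply Rabs_pos].
- rewrite <- (Rplus_0_r (Rsum_list _ L)), <- Z, <- Rsum_plus; apply Rsum_ext; intros k hk.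
  rewrite <- Rsum_plus; apply Rsum_ext; intros l hl; ring.
Qed.

(** The derivative |l| of the transport term is the factor y of [mw_diff]. Of the two resulting
    products, the first leaves the full weight m on the frequencies k and l, the second on k and
    z. *)
Lemma commutator_term th ph sg k l : 0 <= sg <= S0 -> length k = d -> length l = d ->
  th (zzero d) = RtoC 0 ->
  let z := zsub d k l in
  M sg k * Cmod (ph k) * Rabs (M sg k - M sg l) * Cmod (tm th ph k z) <=
  C0 * K * (g z * bn z * exp (sg * g z) * Cmod (th z) * (g l * (M sg k * Cmod (ph k))
                                                     * (M sg l * Cmod (ph l)))
    + (M sg k * Cmod (ph k)) * (g z * (M sg z * Cmod (th z)))
        * (bn l * exp (sg * g l) * Cmod (ph l))).
Proof.
intros hs hk hl h0 z; unfold tm; rewrite Cmod_nl_term; unfold z at 2 4; rewrite zsub_zsub by auto.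
fold z; assert (hz : length z = d) by apply zsub_length.
assert (h1 := sym_term d That C0 a hsym th z l hz hl h0).
assert (h2 := mw_diff a ha p sg S0 (bn k) (bn l) (bn z) hs (bn_ge1 k) (bn_ge1 l) (bn_ge1 z)
  (bn_diff d k l hk hl)).
fold (M sg k) (M sg l) (M sg z) (g l) (g z) K in h1, h2.
set (x := Cmod (ph k)); set (y := Cmod (ph l)) in *; set (t := Cmod (th z)) in *.
assert (hx : 0 <= x) by apply Cmod_ge_0; assert (hy : 0 <= y) by apply Cmod_ge_0.
assert (ht : 0 <= t) by apply Cmod_ge_0.
assert (hM := weight_pos sg k); assert (hg := bn_power_ge1 z).
set (D := Rabs (M sg k - M sg l)) in *; assert (hD : 0 <= D) by apply Rabs_pos.
set (V := Rabs (vdotZ d (That z) l)) in *.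
replace (M sg k * x * D * (V * t * y)) with (M sg k * x * y * D * (V * t)) by ring.
apply Rle_trans with (M sg k * x * y * D * (C0 * g z * bn l * t)).
  apply Rmult_le_compat_l; auto; repeat apply Rmult_le_pos; lra.
replace (M sg k * x * y * D * (C0 * g z * bn l * t)) with
  ((C0 * (M sg k * x * y) * (g z * t)) * (bn l * D)) by ring.
eapply Rle_trans.
  apply Rmult_le_compat_l; [|exact h2]; repeat apply Rmult_le_pos; lra.
right; ring.
Qed.

(* AM-GM, after moving the weight g from one frequency to the two others. *)
Lemma weighted_AMGM u v w x y : 1 <= u -> 1 <= v -> 1 <= w -> u <= 2 * (v * w) ->
  u * x * y <= w * (u * y ^ 2 + v * x ^ 2).
Proof.
intros hu hv hw h.
apply Rle_trans with (u * ((x ^ 2 + y ^ 2) / 2)).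
  rewrite Rmult_assoc; apply Rmult_le_compat_l; [lra|]; generalize (pow2_ge_0 (x - y)); nra.
assert (0 <= x ^ 2) by apply pow2_ge_0; assert (0 <= y ^ 2) by apply pow2_ge_0.
assert (u * x ^ 2 <= 2 * (v * w) * x ^ 2) by (apply Rmult_le_compat_r; auto).
assert (u * y ^ 2 <= w * (u * y ^ 2)).
  rewrite <- (Rmult_1_l (u * y ^ 2)) at 1; apply Rmult_le_compat_r; auto; nra.
assert (0 <= u * y ^ 2) by nra; nra.
Qed.

(** Origin of the requirement p >= 2d + 3: g(z)^2 |z| is at most |z|^3, and 2d further powers give
    [rho]. *)
Lemma low_freq_weight th sg A z : 0 <= sg -> length z = d -> M sg z * Cmod (th z) <= A ->
  g z * (g z * bn z * exp (sg * g z) * Cmod (th z)) <= A * rho z.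
Proof.
intros hs hz hA.
assert (hb := bn_ge1 z); assert (hg := bn_power_ge1 z).
assert (hgb : g z <= bn z) by (apply Rpower_le_self; auto).
set (e := exp (sg * g z) * Cmod (th z)).
assert (he : 0 <= e) by (apply Rmult_le_pos; [left; apply exp_pos | apply Cmod_ge_0]).
assert (h1 : bn z ^ (3 + 2 * d) * e <= A).
  eapply Rle_trans; [|exact hA]; unfold M; rewrite mwE; fold (g z); rewrite Rmult_assoc; fold e.
  apply Rmult_le_compat_r; auto; apply bn_pow_mono; lia.
rewrite pow_add in h1; assert (hr := rho_ge_bn d z hz).
assert (hp2 := bn_pow_ge1 z (2 * d)).
apply Rle_trans with (bn z ^ 3 * e).
  replace (g z * (g z * bn z * exp (sg * g z) * Cmod (th z))) with ((g z * g z * bn z) * e)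
    by (unfold e; ring).
  apply Rmult_le_compat_r; auto; simpl; rewrite Rmult_1_r, <- Rmult_assoc.
  apply Rmult_le_compat_r; [lra|]; apply Rmult_le_compat; lra.
assert (hA0 : 0 <= A) by (eapply Rle_trans; [|exact hA];
  apply Rmult_le_pos; [left; apply weight_pos | apply Cmod_ge_0]).
apply Rle_trans with (A * / bn z ^ (2 * d)).
- apply (Rmult_le_reg_r (bn z ^ (2 * d))); [lra|].
  replace (A * / bn z ^ (2 * d) * bn z ^ (2 * d)) with A by (field; lra); lra.
- apply Rmult_le_compat_l; auto.
Qed.

Lemma Rsum_rho_zsub_l k L : length k = d -> NoDup L -> (forall l, In l L -> length l = d) ->
  Rsum_list (fun l => rho (zsub d k l)) L <= 10 ^ d.
Proof.
intros hk hn hL; rewrite <- (Rsum_map rho (zsub d k)); apply rho_sum_bound.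
- apply NoDup_map_inj; auto; intros x y hx hy; apply zsub_inj_r; auto.
- intros x hx; apply in_map_iff in hx as (y & <- & _); apply zsub_length.
Qed.

Lemma Rsum_rho_zsub_r l L : length l = d -> NoDup L -> (forall k, In k L -> length k = d) ->
  Rsum_list (fun k => rho (zsub d k l)) L <= 10 ^ d.
Proof.
intros hl hn hL; rewrite <- (Rsum_map rho (fun k => zsub d k l)); apply rho_sum_bound.
- apply NoDup_map_inj; auto; intros x y hx hy; apply zsub_inj_l; auto.
- intros x hx; apply in_map_iff in hx as (y & <- & _); apply zsub_length.
Qed.

(** * Schur tests for the convolution kernels *)

Section Schur.
Variables (L : list (list Z)) (Y : list Z -> R).
Hypothesis hn : NoDup L.
Hypothesis hL : forall k, In k L -> length k = d.
Hypothesis hY : forall k, 0 <= Y k.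
Let G := Rsum_list Y L.

Lemma Schur_scal (c : list Z -> R) : (forall k, In k L -> c k <= 10 ^ d) ->
  Rsum_list (fun k => c k * Y k) L <= 10 ^ d * G.
Proof.
intros hc; unfold G; rewrite <- Rsum_scal; apply Rsum_le; intros k hk.
apply Rmult_le_compat_r; auto.
Qed.

Lemma Schur_diff_row : Rsum_list (fun k => Rsum_list (fun l => rho (zsub d k l) * Y k) L) L
  <= 10 ^ d * G.
Proof.
eapply Rle_trans; [right; apply Rsum_ext; intros k hk|].
  rewrite (Rsum_ext _ (fun l => Y k * rho (zsub d k l))) by (intros; ring).
  rewrite Rsum_scal, Rmult_comm; reflexivity.
apply Schur_scal; intros; apply Rsum_rho_zsub_l; auto.
Qed.

Lemma Schur_diff_col : Rsum_list (fun k => Rsum_list (fun l => rho (zsub d k l) * Y l) L) L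
  <= 10 ^ d * G.
Proof.
rewrite Rsum_swap; eapply Rle_trans; [right; apply Rsum_ext; intros k hk|].
  rewrite (Rsum_ext _ (fun l => Y k * rho (zsub d l k))) by (intros; ring).
  rewrite Rsum_scal, Rmult_comm; reflexivity.
apply Schur_scal; intros; apply Rsum_rho_zsub_r; auto.
Qed.

Lemma Schur_col : Rsum_list (fun k => Rsum_list (fun l => rho l * Y k) L) L <= 10 ^ d * G.
Proof.
eapply Rle_trans; [right; apply Rsum_ext; intros k hk|].
  rewrite (Rsum_ext _ (fun l => Y k * rho l)) by (intros; ring).
  rewrite Rsum_scal, Rmult_comm; reflexivity.
apply Schur_scal; intros; apply rho_sum_bound; auto.
Qed.

(** The differences k - l may leave L, hence the support condition on Y. *)
Lemma Schur_col_diff : (forall k, length k = d -> ~ In k L -> Y k = 0) ->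
  Rsum_list (fun k => Rsum_list (fun l => rho l * Y (zsub d k l)) L) L <= 10 ^ d * G.
Proof.
intros hs; rewrite Rsum_swap.
apply Rle_trans with (Rsum_list (fun l => G * rho l) L).
- apply Rsum_le; intros l hl; rewrite Rsum_scal, Rmult_comm.
  apply Rmult_le_compat_r; [left; apply rho_pos|].
  rewrite <- (Rsum_map Y (fun k => zsub d k l)); apply Rsum_support_le; auto.
  + apply NoDup_map_inj; auto; intros x y hx hy; apply zsub_inj_l; auto.
  + intros x hx hz; apply in_map_iff in hx as (k & <- & _); apply NNPP; intros h.
    apply hz, hs; auto using zsub_length.
- rewrite Rsum_scal, Rmult_comm; apply Rmult_le_compat_r.
    now apply Rsum_nonneg.
  now apply rho_sum_bound.
Qed.

End Schur.

(** The summand of the damping produced by the shrinking radius: the energy density with the extra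
    factor |k|^(1/s). *)
Definition gnorm (sg : R) (ph : list Z -> C) (k : list Z) : R :=
  g k * (M sg k * Cmod (ph k)) ^ 2.

Lemma gnorm_nonneg sg ph k : 0 <= gnorm sg ph k.
Proof. apply Rmult_le_pos; [generalize (bn_power_ge1 k); lra | apply pow2_ge_0]. Qed.

(** The advecting frequency z is the summable one. AM-GM, with g(l) <= 2 g(k) g(z), leaves one
    factor g on each squared term and one g(z), which the decay of th absorbs. *)
Lemma low_high_term th ph sg A k l : 0 <= sg -> length k = d -> length l = d ->
  (forall z, length z = d -> M sg z * Cmod (th z) <= A) ->
  let z := zsub d k l in
  g z * bn z * exp (sg * g z) * Cmod (th z) * (g l * (M sg k * Cmod (ph k))
     * (M sg l * Cmod (ph l)))
  <= A * (rho z * gnorm sg ph k + rho z * gnorm sg ph l).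
Proof.
intros hs hk hl hA z; assert (hz : length z = d) by apply zsub_length.
assert (h1 := low_freq_weight th sg A z hs hz (hA z hz)).
set (c := g z * bn z * exp (sg * g z) * Cmod (th z)) in *.
assert (hc : 0 <= c).
  repeat apply Rmult_le_pos; auto using Cmod_ge_0.
  - generalize (bn_power_ge1 z); lra.
  - generalize (bn_ge1 z); lra.
  - left; apply exp_pos.
assert (hgg : g l <= 2 * (g k * g z)) by
  (unfold z, g at 3; rewrite bn_zsub_sym; now apply bn_power_submult).
assert (h2 := weighted_AMGM _ _ _ (M sg k * Cmod (ph k)) (M sg l * Cmod (ph l))
   (bn_power_ge1 l) (bn_power_ge1 k) (bn_power_ge1 z) hgg).
eapply Rle_trans; [apply Rmult_le_compat_l; [exact hc | exact h2]|].
fold (gnorm sg ph k) (gnorm sg ph l).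
replace (c * (g z * (gnorm sg ph l + gnorm sg ph k))) with
  ((g z * c) * (gnorm sg ph k + gnorm sg ph l)) by ring.
rewrite <- Rmult_plus_distr_l, <- Rmult_assoc; apply Rmult_le_compat_r; auto.
generalize (gnorm_nonneg sg ph k) (gnorm_nonneg sg ph l); lra.
Qed.

(** The self-advection estimate of the existence proof. Since th is both the advecting and the
    advected function, the single bound A controls whichever of the two carries the low weight. *)
Lemma transport_energy th sg A L : 0 <= sg <= S0 -> NoDup L ->
  (forall k, In k L -> length k = d) ->
  (forall k, length k = d -> ~ In k L -> th k = RtoC 0) ->
  real_meanfree d th -> (forall z, length z = d -> M sg z * Cmod (th z) <= A) ->
  Rabs (Rsum_list (fun k => Rsum_list (fun l =>
    M sg k ^ 2 * Re (Cmult (Cconj (th k)) (tm th th k (zsub d k l)))) L) L)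
  <= 4 * C0 * K * 10 ^ d * A * Rsum_list (gnorm sg th) L.
Proof.
intros hs hn hL hsup hr hA; set (G := Rsum_list (gnorm sg th) L).
assert (hK : 0 < K).
  apply Rplus_lt_le_0_compat; [apply pow_lt; lra|]; apply Rmult_le_pos; [|apply pow_le; lra].
  generalize (pos_INR p); lra.
assert (hA0 : 0 <= A) by (eapply Rle_trans; [|exact (hA (zzero d) (zzero_length d))];
  apply Rmult_le_pos; [left; apply weight_pos | apply Cmod_ge_0]).
eapply Rle_trans; [now apply transport_commutator|].
set (Y := gnorm sg th).
apply Rle_trans with (Rsum_list (fun k => Rsum_list (fun l => C0 * K * (A *
  ((rho (zsub d k l) * Y k + rho (zsub d k l) * Y l) + (rho l * Y k + rho l * Y (zsub d k l))))) L) L).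
- apply Rsum_le; intros k hk; apply Rsum_le; intros l hl.
  eapply Rle_trans; [apply commutator_term; auto; apply hr|].
  apply Rmult_le_compat_l; [nra|]; rewrite Rmult_plus_distr_l.
  apply Rplus_le_compat; [apply low_high_term; auto; lra|].
  assert (hz := zsub_length d k l); set (z := zsub d k l) in *.
  (* In the second product the roles are exchanged: l is the summable frequency, k and z carry the
     energy. *)
  assert (h1 := low_freq_weight th sg A l (proj1 hs) (hL l hl) (hA l (hL l hl))).
  assert (hgg : g z <= 2 * (g k * g l)).
    apply Rpower_submult; auto using bn_ge1; apply bn_zsub_le; auto.
  assert (h2 := weighted_AMGM _ _ _ (M sg k * Cmod (th k)) (M sg z * Cmod (th z))
   (bn_power_ge1 z) (bn_power_ge1 k) (bn_power_ge1 l) hgg).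
  fold (gnorm sg th z) (gnorm sg th k) in h2; fold Y in h2.
  set (e := bn l * exp (sg * g l) * Cmod (th l)) in *.
  assert (he : 0 <= e).
    repeat apply Rmult_le_pos; auto using Cmod_ge_0; [generalize (bn_ge1 l); lra | left; apply exp_pos].
  replace (M sg k * Cmod (th k) * (g z * (M sg z * Cmod (th z))) * e) with
    ((g z * (M sg k * Cmod (th k)) * (M sg z * Cmod (th z))) * e) by ring.
  eapply Rle_trans; [apply Rmult_le_compat_r; [exact he | exact h2]|].
  assert (hY : 0 <= Y z + Y k) by (generalize (gnorm_nonneg sg th k) (gnorm_nonneg sg th z);
    unfold Y; lra).
  replace (g l * (Y z + Y k) * e) with ((g l * e) * (Y z + Y k)) by ring.
  replace (A * (rho l * Y k + rho l * Y z)) with ((A * rho l) * (Y z + Y k)) by ring.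
  apply Rmult_le_compat_r; auto.
  assert (g l * e <= g l * (g l * bn l * exp (sg * g l) * Cmod (th l))); [|lra].
  apply Rmult_le_compat_l; [generalize (bn_power_ge1 l); lra|].
  replace (g l * bn l * exp (sg * g l) * Cmod (th l)) with (g l * e) by (unfold e; ring).
  generalize (bn_power_ge1 l); nra.
- assert (hYn : forall k, 0 <= Y k) by apply gnorm_nonneg.
  assert (hYs : forall k, length k = d -> ~ In k L -> Y k = 0).
    intros k hk hnk; unfold Y, gnorm; rewrite hsup, Cmod_0 by auto; ring.
  generalize (Schur_diff_row L Y hn hL hYn) (Schur_diff_col L Y hn hL hYn)
    (Schur_col L Y hn hL hYn) (Schur_col_diff L Y hn hL hYn hYs); intros s1 s2 s3 s4.
  eapply Rle_trans with (C0 * K * (A * ((10 ^ d * G + 10 ^ d * G) + (10 ^ d * G + 10 ^ d * G))));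
    [|right; ring].
  rewrite (Rsum_ext _ (fun k => C0 * K * (A *
    ((Rsum_list (fun l => rho (zsub d k l) * Y k) L + Rsum_list (fun l => rho (zsub d k l) * Y l) L)
    + (Rsum_list (fun l => rho l * Y k) L + Rsum_list (fun l => rho l * Y (zsub d k l)) L))))).
    rewrite !Rsum_scal, !Rsum_plus; apply Rmult_le_compat_l; [nra|].
    apply Rmult_le_compat_l; auto; unfold G; fold Y; lra.
  intros k hk; rewrite !Rsum_scal, !Rsum_plus; reflexivity.
Qed.

(** In the uniqueness proof ph is the difference of two solutions, so its size must stay out of the
    constant. The product in which th carries the full weight is therefore closed by 1 + 2d extra
    powers of decay of th. *)
Lemma transport_energy_smooth th ph sg A L : 0 <= sg <= S0 -> NoDup L ->
  (forall k, In k L -> length k = d) -> real_meanfree d th ->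
  (forall z, length z = d -> M sg z * Cmod (th z) * bn z ^ (1 + 2 * d) <= A) ->
  Rabs (Rsum_list (fun k => Rsum_list (fun l =>
    M sg k ^ 2 * Re (Cmult (Cconj (ph k)) (tm th ph k (zsub d k l)))) L) L)
  <= 4 * C0 * K * 10 ^ d * A * Rsum_list (gnorm sg ph) L.
Proof.
intros hs hn hL hr hA; set (G := Rsum_list (gnorm sg ph) L).
assert (hK : 0 < K).
  apply Rplus_lt_le_0_compat; [apply pow_lt; lra|]; apply Rmult_le_pos; [|apply pow_le; lra].
  generalize (pos_INR p); lra.
assert (hZ : forall z, 0 <= M sg z * Cmod (th z))
  by (intros; apply Rmult_le_pos; [left; apply weight_pos | apply Cmod_ge_0]).
assert (hA1 : forall z, length z = d -> M sg z * Cmod (th z) <= A).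
  intros z hz; generalize (hA z hz) (hZ z) (bn_pow_ge1 z (1 + 2 * d)); nra.
assert (hA0 : 0 <= A) by (generalize (hZ (zzero d)) (hA1 (zzero d) (zzero_length d)); lra).
eapply Rle_trans; [now apply transport_commutator|].
set (Y := gnorm sg ph).
apply Rle_trans with (Rsum_list (fun k => Rsum_list (fun l => C0 * K * (A *
  ((rho (zsub d k l) * Y k + rho (zsub d k l) * Y l)
   + (rho (zsub d k l) * Y k + rho (zsub d k l) * Y l)))) L) L).
- apply Rsum_le; intros k hk; apply Rsum_le; intros l hl.
  eapply Rle_trans; [apply commutator_term; auto; apply hr|].
  apply Rmult_le_compat_l; [nra|]; rewrite Rmult_plus_distr_l.
  apply Rplus_le_compat; [apply low_high_term; auto; lra|].
  assert (hz := zsub_length d k l); set (z := zsub d k l) in *.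
  assert (hX : forall k, 0 <= M sg k * Cmod (ph k))
    by (intros; apply Rmult_le_pos; [left; apply weight_pos | apply Cmod_ge_0]).
  assert (hgz : g z * (M sg z * Cmod (th z)) <= A * rho z).
    assert (h1 := hA z hz); rewrite pow_add, pow_1 in h1.
    assert (hgb : g z <= bn z) by (apply Rpower_le_self; auto using bn_ge1).
    assert (hr' := rho_ge_bn d z hz); assert (hp2 := bn_pow_ge1 z (2 * d)).
    apply Rle_trans with (A * / bn z ^ (2 * d)); [|apply Rmult_le_compat_l; auto].
    apply (Rmult_le_reg_r (bn z ^ (2 * d))); [lra|].
    replace (A * / bn z ^ (2 * d) * bn z ^ (2 * d)) with A by (field; lra).
    eapply Rle_trans; [|exact h1]; specialize (hZ z).
    rewrite (Rmult_comm (g z)), Rmult_assoc; apply Rmult_le_compat_l; auto.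
    apply Rmult_le_compat_r; lra.
  assert (hl1 : bn l * exp (sg * g l) * Cmod (ph l) <= M sg l * Cmod (ph l)).
    apply Rmult_le_compat_r; [apply Cmod_ge_0|]; unfold M; rewrite !mwE; fold (g l).
    apply Rmult_le_compat_r; [left; apply exp_pos|].
    rewrite <- (pow_1 (bn l)) at 1; apply bn_pow_mono; lia.
  set (xk := M sg k * Cmod (ph k)) in *; set (xl := M sg l * Cmod (ph l)) in *.
  assert (hxk : 0 <= xk) by apply hX; assert (hxl : 0 <= xl) by apply hX.
  assert (hrz := rho_pos z).
  apply Rle_trans with (xk * (A * rho z) * xl).
    apply Rmult_le_compat; auto.
    + apply Rmult_le_pos; auto; apply Rmult_le_pos; auto; generalize (bn_power_ge1 z); lra.
    + repeat apply Rmult_le_pos; auto using Cmod_ge_0;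
      [generalize (bn_ge1 l); lra | left; apply exp_pos].
    + apply Rmult_le_compat_l; auto.
  unfold Y, gnorm; fold xk xl; replace (xk * (A * rho z) * xl) with (A * (rho z * (xk * xl))) by ring.
  rewrite <- Rmult_plus_distr_l; apply Rmult_le_compat_l; auto; apply Rmult_le_compat_l; [lra|].
  generalize (bn_power_ge1 k) (bn_power_ge1 l) (pow2_ge_0 (xk - xl)) (pow2_ge_0 xk) (pow2_ge_0 xl); nra.
- assert (hYn : forall k, 0 <= Y k) by apply gnorm_nonneg.
  generalize (Schur_diff_row L Y hn hL hYn) (Schur_diff_col L Y hn hL hYn); intros s1 s2.
  eapply Rle_trans with (C0 * K * (A * ((10 ^ d * G + 10 ^ d * G) + (10 ^ d * G + 10 ^ d * G))));
    [|right; ring].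
  rewrite (Rsum_ext _ (fun k => C0 * K * (A *
    ((Rsum_list (fun l => rho (zsub d k l) * Y k) L + Rsum_list (fun l => rho (zsub d k l) * Y l) L)
    + (Rsum_list (fun l => rho (zsub d k l) * Y k) L + Rsum_list (fun l => rho (zsub d k l) * Y l) L))))).
    rewrite !Rsum_scal, !Rsum_plus; apply Rmult_le_compat_l; [nra|].
    apply Rmult_le_compat_l; auto; unfold G; fold Y; lra.
  intros k hk; rewrite !Rsum_scal, !Rsum_plus; reflexivity.
Qed.

(** No cancellation is used: the gradient falls on the smooth function ph, and the symbol costs g(j)
    on w, which the damping can pay. The extra decay of ph covers its gradient and the factor g(z)
    left by AM-GM, hence 2 + 2d powers. *)
Lemma stretching_energy w ph sg B L : 0 <= sg <= S0 -> NoDup L ->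
  (forall k, In k L -> length k = d) -> w (zzero d) = RtoC 0 ->
  (forall z, length z = d -> M sg z * Cmod (ph z) * bn z ^ (2 + 2 * d) <= B) ->
  Rabs (Rsum_list (fun k => Rsum_list (fun j =>
    M sg k ^ 2 * Re (Cmult (Cconj (w k)) (tm w ph k j))) L) L)
  <= 2 * C0 * 2 ^ p * 10 ^ d * B * Rsum_list (gnorm sg w) L.
Proof.
intros hs hn hL h0 hB; set (G := Rsum_list (gnorm sg w) L).
assert (h2p : 0 < 2 ^ p) by (apply pow_lt; lra).
assert (hZ : forall z, 0 <= M sg z * Cmod (ph z))
  by (intros; apply Rmult_le_pos; [left; apply weight_pos | apply Cmod_ge_0]).
assert (hB0 : 0 <= B).
  eapply Rle_trans; [|apply (hB (zzero d) (zzero_length d))].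
  apply Rmult_le_pos; auto; generalize (bn_pow_ge1 (zzero d) (2 + 2 * d)); lra.
set (Y := gnorm sg w).
apply Rle_trans with (Rsum_list (fun k => Rsum_list (fun j => C0 * 2 ^ p * (B *
  (rho (zsub d k j) * Y k + rho (zsub d k j) * Y j))) L) L).
- eapply Rle_trans; [apply Rsum_abs|]; apply Rsum_le; intros k hk.
  eapply Rle_trans; [apply Rsum_abs|]; apply Rsum_le; intros j hj.
  assert (hz := zsub_length d k j); unfold tm, nl_term; set (z := zsub d k j) in *.
  rewrite Rabs_mult, Rabs_pos_eq by apply pow2_ge_0.
  eapply Rle_trans.
    apply Rmult_le_compat_l; [apply pow2_ge_0 | apply Re_le_Cmod].
  rewrite !Cmod_mult, Cmod_conj, Cmod_Ci, Cmod_R, Rmult_1_l.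
  assert (h1 := sym_term d That C0 a hsym w j z (hL j hj) hz h0); fold (g j) in h1.
  set (V := Rabs (vdotZ d (That j) z)) in *.
  assert (hV : 0 <= V) by apply Rabs_pos.
  assert (hm : M sg k <= 2 ^ p * (M sg j * M sg z)).
    apply mw_submult; auto using bn_ge1; [lra|]; apply bn_add; auto.
  set (x := Cmod (w k)); set (y := Cmod (w j)) in *; set (t := Cmod (ph z)) in *.
  assert (hx : 0 <= x) by apply Cmod_ge_0; assert (hy : 0 <= y) by apply Cmod_ge_0.
  assert (ht : 0 <= t) by apply Cmod_ge_0.
  assert (hM := weight_pos sg k); assert (hMj := weight_pos sg j); assert (hMz := weight_pos sg z).
  assert (hg := bn_power_ge1 z); assert (hb := bn_ge1 z).
  replace (M sg k ^ 2 * (x * (V * (y * t)))) with ((M sg k * x) * (M sg k * ((V * y) * t))) by ring.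
  apply Rle_trans with ((M sg k * x) * ((2 ^ p * (M sg j * M sg z)) * ((C0 * g j * bn z * y) * t))).
    apply Rmult_le_compat_l; [nra|]; apply Rmult_le_compat; [lra | | exact hm |].
      repeat apply Rmult_le_pos; auto.
    apply Rmult_le_compat_r; auto.
  replace ((M sg k * x) * ((2 ^ p * (M sg j * M sg z)) * ((C0 * g j * bn z * y) * t))) with
    (C0 * 2 ^ p * ((bn z * (M sg z * t)) * (g j * (M sg k * x) * (M sg j * y)))) by ring.
  apply Rmult_le_compat_l; [nra|].
  assert (hgg : g j <= 2 * (g k * g z)) by
    (unfold z, g at 3; rewrite bn_zsub_sym; apply bn_power_submult; auto).
  assert (h2 := weighted_AMGM _ _ _ (M sg k * x) (M sg j * y) (bn_power_ge1 j) (bn_power_ge1 k) hg hgg).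
  assert (hc : 0 <= bn z * (M sg z * t)) by (repeat apply Rmult_le_pos; lra).
  eapply Rle_trans; [apply Rmult_le_compat_l; [exact hc | exact h2]|].
  unfold x, y; fold (gnorm sg w k) (gnorm sg w j); fold Y.
  assert (hY : 0 <= Y j + Y k) by (generalize (gnorm_nonneg sg w k) (gnorm_nonneg sg w j);
    unfold Y; lra).
  replace (bn z * (M sg z * t) * (g z * (Y j + Y k))) with
    ((g z * (bn z * (M sg z * t))) * (Y j + Y k)) by ring.
  replace (B * (rho z * Y k + rho z * Y j)) with ((B * rho z) * (Y j + Y k)) by ring.
  apply Rmult_le_compat_r; auto.
  assert (h3 := hB z hz); fold t in h3; rewrite pow_add in h3.
  assert (hgb : g z <= bn z) by (apply Rpower_le_self; auto using bn_ge1).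
  assert (hr' := rho_ge_bn d z hz); assert (hp2 := bn_pow_ge1 z (2 * d)).
  apply Rle_trans with (B * / bn z ^ (2 * d)); [|apply Rmult_le_compat_l; auto].
  apply (Rmult_le_reg_r (bn z ^ (2 * d))); [lra|].
  replace (B * / bn z ^ (2 * d) * bn z ^ (2 * d)) with B by (field; lra).
  eapply Rle_trans; [|exact h3]; specialize (hZ z); fold t in hZ.
  replace (g z * (bn z * (M sg z * t)) * bn z ^ (2 * d)) with
    (M sg z * t * (g z * bn z * bn z ^ (2 * d))) by ring.
  apply Rmult_le_compat_l; auto; apply Rmult_le_compat_r; [lra|].
  replace (bn z ^ 2) with (bn z * bn z) by ring; apply Rmult_le_compat_r; lra.
- assert (hYn : forall k, 0 <= Y k) by apply gnorm_nonneg.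
  generalize (Schur_diff_row L Y hn hL hYn) (Schur_diff_col L Y hn hL hYn); intros s1 s2.
  eapply Rle_trans with (C0 * 2 ^ p * (B * (10 ^ d * G + 10 ^ d * G)));
    [|right; ring].
  rewrite (Rsum_ext _ (fun k => C0 * 2 ^ p * (B *
    (Rsum_list (fun l => rho (zsub d k l) * Y k) L + Rsum_list (fun l => rho (zsub d k l) * Y l) L)))).
    rewrite !Rsum_scal, !Rsum_plus; apply Rmult_le_compat_l; [nra|].
    apply Rmult_le_compat_l; auto; unfold G; fold Y; lra.
  intros k hk; rewrite !Rsum_scal, !Rsum_plus; reflexivity.
Qed.

End Energy.

(** * Euler scheme for the truncated system *)

Section Euler.
Variables (d : nat) (That : list Z -> nat -> R) (C0 a S0 : R).
Hypothesis ha : 0 < a <= 1.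
Hypothesis hC0 : 0 < C0.
Hypothesis hS0 : 0 < S0.
Hypothesis hdiv : forall k, length k = d -> vdotZ d (That k) k = 0.
Hypothesis heven : forall k, length k = d -> forall i, (i < d)%nat ->
  That (zneg d k) i = That k i.
Hypothesis hsym : forall j l, length j = d -> length l = d -> zis0 j = false ->
  Rabs (vdotZ d (That j) l) <= C0 * Rpower (bn j) a * bn l.

(* Each convolution costs 2d + 1 powers of |k| (one derivative and the summability of [rho]);
   the Lipschitz bound in time iterates the nonlinearity once. *)
Let p := (4 * d + 5)%nat.
Let tm := nl_term d That.
Let g (k : list Z) := Rpower (bn k) a.
Let M (sg : R) (k : list Z) := mw a p sg (bn k).
Let K := 3 ^ p + 4 * (INR p + S0) * 2 ^ p.

Definition energy (N : nat) (sg : R) (th : list Z -> C) : R :=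
  Rsum_list (fun k => (M sg k * Cmod (th k)) ^ 2) (cube d N).

Definition galerkin_state (N : nat) (th : list Z -> C) : Prop :=
  real_meanfree d th /\ forall k, length k = d -> ~ In k (cube d N) -> th k = RtoC 0.

Definition euler_step (N : nat) (h : R) (th : list Z -> C) (k : list Z) : C :=
  if in_dec (list_eq_dec Z.eq_dec) k (cube d N)
  then Cminus (th k) (Cmult (RtoC h) (nonlin_psum d That th k N)) else RtoC 0.

Fixpoint euler (N : nat) (h : R) (th0 : list Z -> C) (n : nat) : list Z -> C :=
  match n with
  | O => fun k => if in_dec (list_eq_dec Z.eq_dec) k (cube d N) then th0 k else RtoC 0
  | S n' => euler_step N h (euler N h th0 n')
  end.

Lemma in_cube_zneg N k : length k = d -> (In (zneg d k) (cube d N) <-> In k (cube d N)).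
Proof.
intros hk; split; intros h; [rewrite <- (zneg_zneg d k hk)|]; now apply cube_zneg.
Qed.

Lemma nonlin_psum_zzero th N : nonlin_psum d That th (zzero d) N = RtoC 0.
Proof.
apply Csum_zero; intros j hj; apply cube_length in hj.
assert (E : zsub d (zzero d) j = zneg d j).
  apply (zlist_ext d); auto using zneg_length, zsub_length.
  intros i hi; rewrite zc_zneg, zc_zsub, zc_zzero by auto; lia.
rewrite E, vdotZ_zneg, hdiv, Ropp_0 by auto; ring.
Qed.

(** The reflection j -> -j maps the cube to itself; evenness of the symbol makes the velocity real,
    so the truncated flow keeps real functions real. *)
Lemma nonlin_psum_zneg th k N : real_meanfree d th -> length k = d ->
  nonlin_psum d That th (zneg d k) N = Cconj (nonlin_psum d That th k N).
Proof.
intros [_ hr] hk; unfold nonlin_psum.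
rewrite (Csum_support_eq _ (cube d N) (map (zneg d) (cube d N))).
- rewrite Csum_map; apply C_eq_parts.
  + change (Re (Cconj ?z)) with (Re z); rewrite !Re_Csum; apply Rsum_ext; intros j hj.
    apply cube_length in hj; rewrite zsub_zneg, vdotZ_zneg, !hr by auto using zsub_length.
    rewrite (vdotZ_ext d _ (That j)) by (intros; apply heven; auto).
    destruct (th j), (th (zsub d k j)); unfold Cmult, Cconj, Ci, RtoC, Re; simpl; ring.
  + change (Im (Cconj ?z)) with (- Im z); rewrite !Im_Csum, <- Rsum_opp.
    apply Rsum_ext; intros j hj.
    apply cube_length in hj; rewrite zsub_zneg, vdotZ_zneg, !hr by auto using zsub_length.
    rewrite (vdotZ_ext d _ (That j)) by (intros; apply heven; auto).
    destruct (th j), (th (zsub d k j)); unfold Cmult, Cconj, Ci, RtoC, Im; simpl; ring.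
- apply NoDup_cube.
- apply NoDup_map_inj; [apply NoDup_cube|]; intros x y hx hy E.
  apply cube_length in hx, hy; rewrite <- (zneg_zneg d x), E, zneg_zneg; auto.
- intros j _; split; intros h.
  + rewrite <- (zneg_zneg d j) by (now apply cube_length in h); apply in_map.
    now apply cube_zneg.
  + apply in_map_iff in h as (x & <- & hx); now apply cube_zneg.
Qed.

Lemma Cconj_minus z w : Cconj (Cminus z w) = Cminus (Cconj z) (Cconj w).
Proof. destruct z, w; unfold Cconj, Cminus, Cplus, Copp; simpl; f_equal; ring. Qed.

Lemma Cconj_Rmult x z : Cconj (Cmult (RtoC x) z) = Cmult (RtoC x) (Cconj z).
Proof. destruct z; unfold Cconj, Cmult, RtoC; simpl; f_equal; ring. Qed.

Lemma euler_step_state N h th : galerkin_state N th -> galerkin_state N (euler_step N h th).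
Proof.
intros [hr hs]; split; [split|].
- unfold euler_step; destruct in_dec; auto.
  rewrite nonlin_psum_zzero, (proj1 hr); ring.
- intros k hk; unfold euler_step; destruct in_dec as [i|i]; destruct in_dec as [i'|i'].
  + rewrite nonlin_psum_zneg, (proj2 hr), Cconj_minus, Cconj_Rmult by auto; reflexivity.
  + destruct i'; now apply in_cube_zneg.
  + destruct i; now apply in_cube_zneg.
  + unfold Cconj, RtoC; simpl; f_equal; ring.
- intros k hk hn; unfold euler_step; destruct in_dec; auto; contradiction.
Qed.

Lemma euler_state N h th0 n : real_meanfree d th0 -> galerkin_state N (euler N h th0 n).
Proof.
intros [h0 hr]; induction n as [|n IH]; [|now apply euler_step_state].
split; [split|]; simpl.
- destruct in_dec; auto.
- intros k hk; destruct in_dec as [i|i]; destruct in_dec as [i'|i']; auto.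
  + destruct i'; now apply in_cube_zneg.
  + destruct i; now apply in_cube_zneg.
  + unfold Cconj, RtoC; simpl; f_equal; ring.
- intros k hk hn; destruct in_dec; auto; contradiction.
Qed.

(** A nonzero term has both j and k - j in the cube, because th is supported there. This brings the
    truncated nonlinearity into the form in which k and l = k - j run through the same list, as the
    commutator estimate wants. *)
Lemma galerkin_reindex N th k : galerkin_state N th -> length k = d ->
  nonlin_psum d That th k N = Csum_list (fun l => tm th th k (zsub d k l)) (cube d N).
Proof.
intros [_ hs] hk; rewrite <- (Csum_map (tm th th k) (zsub d k)); apply Csum_support_eq.
- apply NoDup_cube.
- apply NoDup_map_inj; [apply NoDup_cube|]; intros x y hx hy.
  apply cube_length in hx, hy; apply zsub_inj_r; auto.
- intros j hne.
  assert (hz : forall z, length z = d -> th z <> RtoC 0 -> In z (cube d N)).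
    intros z hz hz'; apply NNPP; intros hn; apply hz', hs; auto.
  split; intros h.
  + apply cube_length in h; rewrite <- (zsub_zsub d k j) by auto; apply in_map.
    apply hz; [apply zsub_length|]; intros E; apply hne; rewrite E; ring.
  + apply in_map_iff in h as (l & <- & _); apply hz; [apply zsub_length|].
    intros E; apply hne; unfold nl_term; rewrite E; ring.
Qed.

Lemma weight_ge1 sg k : 0 <= sg -> 1 <= M sg k.
Proof.
intros hs; eapply Rle_trans; [apply (bn_pow_ge1 k p) | apply mw_ge_pow; auto using bn_ge1].
Qed.

Lemma energy_bound N sg th E1 k : galerkin_state N th -> energy N sg th <= E1 ->
  length k = d -> M sg k * Cmod (th k) <= sqrt E1.
Proof.
intros [_ hs] hE hk; assert (hM := weight_pos a p sg k).
assert (h0 : 0 <= M sg k * Cmod (th k))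
  by (apply Rmult_le_pos; [left; apply hM | apply Cmod_ge_0]).
destruct (in_dec (list_eq_dec Z.eq_dec) k (cube d N)) as [i|i].
- rewrite <- (sqrt_pow2 _ h0); apply sqrt_le_1_alt; eapply Rle_trans; [|exact hE].
  apply (Rsum_term (fun k => (M sg k * Cmod (th k)) ^ 2)); auto.
  intros; apply pow2_ge_0.
- rewrite hs, Cmod_0, Rmult_0_r by auto; apply sqrt_pos.
Qed.

Lemma weighted_decay sg A th : 0 <= sg ->
  (forall k, length k = d -> M sg k * Cmod (th k) <= A) -> decay d p A th.
Proof.
intros hs H k hk; eapply Rle_trans; [|apply (H k hk)]; rewrite Rmult_comm.
apply Rmult_le_compat_r; [apply Cmod_ge_0 | apply mw_ge_pow; auto using bn_ge1].
Qed.

Let B A := 2 ^ (2 * d + 4) * C0 * A * A * 10 ^ d.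

Lemma nonlin_decay A th L k : real_meanfree d th -> decay d p A th -> NoDup L ->
  (forall j, In j L -> length j = d) -> length k = d ->
  Cmod (Csum_list (tm th th k) L) * bn k ^ (2 * d + 3) <= B A.
Proof.
intros [h0 _] hA hn hL hk.
assert (h := nl_sum_decay d That C0 a ha hC0 hdiv hsym (2 * d + 4) A A th th k L hk hn hL h0).
assert (h1 : decay d (S (2 * d + 4) + 2 * d) A th)
  by (eapply decay_mono; [|exact hA]; unfold p; lia).
assert (h2 : decay d (2 * d + 4) A th) by (eapply decay_mono; [|exact hA]; unfold p; lia).
(* The estimate is applied with exponent 2d + 4; one power is cancelled by the derivative factor |k|
   on its right-hand side. *)
specialize (h h1 h2); replace (2 * d + 4)%nat with (S (2 * d + 3)) in h at 1 by lia.
rewrite <- tech_pow_Rmult in h; assert (hb := bn_ge1 k).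
apply (Rmult_le_reg_l (bn k)); [lra|]; unfold B.
eapply Rle_trans; [|eapply Rle_trans; [exact h|]]; right; unfold tm; ring.
Qed.

(** (1 - y + y^2)(1 + y) = 1 + y^3 >= 1, and 1 + y <= exp y. *)
Lemma exp_neg_le y : 0 <= y -> exp (- y) <= 1 - y + y ^ 2.
Proof.
intros hy; rewrite exp_Ropp.
assert (h : 1 + y <= exp y) by (destruct (Req_dec y 0) as [-> | n];
  [rewrite exp_0; lra | left; now apply exp_ineq1]).
apply (Rmult_le_reg_r (exp y)); [apply exp_pos|]; rewrite Rinv_l by (generalize (exp_pos y); lra).
assert (0 <= y ^ 3) by (apply pow_le; auto).
assert (0 < 1 - y + y ^ 2) by nra.
apply Rle_trans with ((1 - y + y ^ 2) * (1 + y)); [nra|].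
apply Rmult_le_compat_l; lra.
Qed.

Lemma Cmod_sqr z : Cmod z ^ 2 = Re z ^ 2 + Im z ^ 2.
Proof. unfold Cmod; rewrite pow2_sqrt; [reflexivity | nra]. Qed.

Lemma Cmod_minus_sqr z x w : Cmod (Cminus z (Cmult (RtoC x) w)) ^ 2 =
  Cmod z ^ 2 - 2 * x * Re (Cmult (Cconj z) w) + x ^ 2 * Cmod w ^ 2.
Proof.
rewrite !Cmod_sqr; destruct z, w; unfold Cminus, Cplus, Copp, Cmult, Cconj, RtoC, Re, Im; simpl; ring.
Qed.

(** One mode during one Euler step: w is the nonlinearity and exp(-hu) the factor lost by the
    squared weight. The terms of first order in h are the transport and the damping; all others are
    collected in the h^2 remainder. *)
Lemma step_scalar h u A b z w : 0 <= h <= 1 -> 0 <= u -> Cmod z <= A -> Cmod w <= b ->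
  exp (- (h * u)) * Cmod (Cminus z (Cmult (RtoC h) w)) ^ 2 <=
  Cmod z ^ 2 - 2 * h * Re (Cmult (Cconj z) w) - h * u * Cmod z ^ 2
   + h ^ 2 * (b ^ 2 + 2 * u * (A * b) + u ^ 2 * (A + b) ^ 2).
Proof.
intros hh hu hA hb; set (r := Re (Cmult (Cconj z) w)).
assert (hz := Cmod_ge_0 z); assert (hw := Cmod_ge_0 w).
assert (hr : Rabs r <= Cmod z * Cmod w).
  eapply Rle_trans; [apply Re_le_Cmod|]; rewrite Cmod_mult, Cmod_conj; lra.
assert (hr1 : r <= A * b).
  eapply Rle_trans; [apply Rle_abs|]; eapply Rle_trans; [exact hr|]; apply Rmult_le_compat; lra.
set (q := Cmod (Cminus z (Cmult (RtoC h) w)) ^ 2).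
assert (hq : q = Cmod z ^ 2 - 2 * h * r + h ^ 2 * Cmod w ^ 2) by apply Cmod_minus_sqr.
assert (hq0 : 0 <= q) by apply pow2_ge_0.
assert (hqb : q <= (A + b) ^ 2).
  apply pow_incr; split; [apply Cmod_ge_0|].
  eapply Rle_trans; [apply Cmod_triangle|]; rewrite Cmod_opp, Cmod_mult, Cmod_R, Rabs_pos_eq by lra.
  nra.
apply Rle_trans with ((1 - h * u + (h * u) ^ 2) * q).
  apply Rmult_le_compat_r; auto; apply exp_neg_le; nra.
assert (hw2 : Cmod w ^ 2 <= b ^ 2) by (apply pow_incr; lra).
assert (h2 : 0 <= h ^ 2) by apply pow2_ge_0; assert (u2 : 0 <= u ^ 2) by apply pow2_ge_0.
assert (w2 : 0 <= Cmod w ^ 2) by apply pow2_ge_0.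
assert (e1 : h ^ 2 * u ^ 2 * q <= h ^ 2 * u ^ 2 * (A + b) ^ 2).
  apply Rmult_le_compat_l; auto; now apply Rmult_le_pos.
assert (e2 : h ^ 2 * Cmod w ^ 2 <= h ^ 2 * b ^ 2) by now apply Rmult_le_compat_l.
assert (e3 : 2 * (h ^ 2 * u) * r <= 2 * (h ^ 2 * u) * (A * b)).
  apply Rmult_le_compat_l; auto; assert (0 <= h ^ 2 * u) by (now apply Rmult_le_pos); lra.
assert (e4 : 0 <= h * u * (h ^ 2 * Cmod w ^ 2)) by (repeat apply Rmult_le_pos; lra).
replace ((1 - h * u + (h * u) ^ 2) * q) with (q - h * u * q + h ^ 2 * u ^ 2 * q) by ring.
rewrite hq at 1 2; nra.
Qed.

(** The sum of the second-order remainders of [step_scalar] with u = 2 lam g(k), weighted at the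
    largest radius [S0]. There is no bound uniform in N, so the time step will be chosen after N. *)
Definition euler_defect (N : nat) (lam A : R) : R :=
  Rsum_list (fun k => M S0 k ^ 2 * (B A ^ 2 + 2 * (2 * lam * g k) * (A * B A)
    + (2 * lam * g k) ^ 2 * (A + B A) ^ 2)) (cube d N).

Lemma euler_defect_nonneg N lam A : 0 <= lam -> 0 <= A -> 0 <= euler_defect N lam A.
Proof.
intros hl hA; apply Rsum_nonneg; intros k _; apply Rmult_le_pos; [apply pow2_ge_0|].
assert (0 <= 2 * lam * g k) by (generalize (bn_power_ge1 a ha k); fold (g k); intros; nra).
assert (0 <= B A) by (unfold B; repeat apply Rmult_le_pos; try lra; apply pow_le; lra).
assert (0 <= A * B A) by (now apply Rmult_le_pos).
apply Rplus_le_le_0_compat; [apply Rplus_le_le_0_compat; [apply pow2_ge_0 | nra]|].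
apply Rmult_le_pos; apply pow2_ge_0.
Qed.

Lemma weight_shift sg lam h k : M (sg - lam * h) k ^ 2 = M sg k ^ 2 * exp (- (h * (2 * lam * g k))).
Proof.
unfold M; rewrite !mwE; fold (g k).
replace ((sg - lam * h) * g k) with (sg * g k + - (lam * h * g k)) by ring.
rewrite exp_plus; set (u := lam * h * g k).
replace (- (h * (2 * lam * g k))) with (- u + - u) by (unfold u; ring).
rewrite exp_plus; ring.
Qed.

Lemma weight_mono sg sg' k : sg <= sg' -> M sg k <= M sg' k.
Proof.
intros h; unfold M; rewrite !mwE; apply Rmult_le_compat_l.
- generalize (bn_pow_ge1 k p); lra.
- apply exp_le, Rmult_le_compat_r; auto; left; apply Rpower_pos.
Qed.

(** With G the sum of [gnorm], the transport contributes at most 2 h lam G as long as the energy is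
    below E1, and the damping is exactly -2 h lam G; the second-order defect is all that remains. *)
Lemma euler_step_energy N th sg lam h E1 : galerkin_state N th -> 0 <= sg <= S0 -> 0 <= h <= 1 ->
  energy N sg th <= E1 -> 4 * C0 * K * 10 ^ d * sqrt E1 <= lam ->
  energy N (sg - lam * h) (euler_step N h th) <= energy N sg th + h ^ 2 * euler_defect N lam (sqrt E1).
Proof.
intros hst hs hh hE hlam; set (A := sqrt E1) in *; set (L := cube d N).
assert (hA : forall k, length k = d -> M sg k * Cmod (th k) <= A)
  by (intros; now apply (energy_bound N)).
assert (hdec : decay d p A th) by (apply (weighted_decay sg); auto; lra).
assert (hK : 0 < K).
  apply Rplus_lt_le_0_compat; [apply pow_lt; lra|]; apply Rmult_le_pos; [|apply pow_le; lra].
  generalize (pos_INR p); lra.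
assert (hA0 : 0 <= A) by apply sqrt_pos.
assert (hl0 : 0 <= lam).
  eapply Rle_trans; [|exact hlam]; repeat apply Rmult_le_pos; try lra; apply pow_le; lra.
assert (hB0 : 0 <= B A) by (unfold B; repeat apply Rmult_le_pos; try lra; apply pow_le; lra).
assert (hg : forall k, 0 <= 2 * lam * g k)
  by (intros k; generalize (bn_power_ge1 a ha k); fold (g k); intros; nra).
set (r := fun k => Re (Cmult (Cconj (th k)) (nonlin_psum d That th k N))).
assert (T : Rsum_list (fun k => M sg k ^ 2 * r k) L >= - (lam * Rsum_list (gnorm a p sg th) L)).
  assert (hte := transport_energy d That C0 a S0 p ha hC0 hdiv heven hsym ltac:(unfold p; lia)
    th sg A L hs (NoDup_cube d N) (cube_length d N) (proj2 hst) (proj1 hst) hA).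
  fold K tm in hte; apply Rabs_le_between in hte.
  assert (hG : 0 <= Rsum_list (gnorm a p sg th) L)
    by (apply Rsum_nonneg; intros; now apply gnorm_nonneg).
  assert (h' : 4 * C0 * K * 10 ^ d * A * Rsum_list (gnorm a p sg th) L
    <= lam * Rsum_list (gnorm a p sg th) L) by (now apply Rmult_le_compat_r).
  rewrite (Rsum_ext _ (fun k => Rsum_list (fun l => mw a p sg (bn k) ^ 2 *
    Re (Cmult (Cconj (th k)) (tm th th k (zsub d k l)))) L)); [lra|].
  intros k hk; rewrite Rsum_scal; fold (M sg k); f_equal; unfold r.
  rewrite (galerkin_reindex N) by (auto; now apply cube_length in hk).
  rewrite <- Csum_scal, Re_Csum; reflexivity.
apply Rle_trans with (Rsum_list (fun k => (M sg k * Cmod (th k)) ^ 2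
  + (- 2 * h) * (M sg k ^ 2 * r k) + (- 2 * h * lam) * gnorm a p sg th k
  + h ^ 2 * (M S0 k ^ 2 * (B A ^ 2 + 2 * (2 * lam * g k) * (A * B A)
    + (2 * lam * g k) ^ 2 * (A + B A) ^ 2))) L).
- apply Rsum_le; intros k hk; assert (hkd := cube_length _ _ _ hk).
  rewrite Rpow_mult_distr, weight_shift, Rmult_assoc; unfold euler_step at 1.
  destruct in_dec as [_|n]; [|contradiction].
  assert (hF : Cmod (nonlin_psum d That th k N) <= B A).
    assert (hnd := nonlin_decay A th L k (proj1 hst) hdec (NoDup_cube d N) (cube_length d N) hkd).
    change (Csum_list (tm th th k) L) with (nonlin_psum d That th k N) in hnd.
    generalize (bn_pow_ge1 k (2 * d + 3)) (Cmod_ge_0 (nonlin_psum d That th k N)); nra.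
  assert (hss := step_scalar h (2 * lam * g k) A (B A) _ _ hh (hg k)
    (decay_bound _ _ _ _ k hdec hkd) hF); fold (r k) in hss.
  eapply Rle_trans; [apply Rmult_le_compat_l; [apply pow2_ge_0 | exact hss]|].
  set (D := B A ^ 2 + 2 * (2 * lam * g k) * (A * B A) + (2 * lam * g k) ^ 2 * (A + B A) ^ 2).
  assert (hD : 0 <= D).
    unfold D; specialize (hg k); assert (0 <= A * B A) by (now apply Rmult_le_pos).
    generalize (pow2_ge_0 (B A)) (pow2_ge_0 (2 * lam * g k)) (pow2_ge_0 (A + B A)); intros.
    apply Rplus_le_le_0_compat; [apply Rplus_le_le_0_compat|]; auto; nra.
  assert (hM2 : M sg k ^ 2 * (h ^ 2 * D) <= h ^ 2 * (M S0 k ^ 2 * D)).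
    rewrite <- Rmult_assoc, (Rmult_comm (M sg k ^ 2)), Rmult_assoc.
    apply Rmult_le_compat_l; [apply pow2_ge_0|]; apply Rmult_le_compat_r; auto.
    apply pow_incr; split; [left; apply weight_pos | apply weight_mono; lra].
  unfold gnorm; fold (M sg k) (g k); nra.
- rewrite !Rsum_plus, !Rsum_scal; fold (energy N sg th) (euler_defect N lam A).
  change (Rsum_list (fun k => (M sg k * Cmod (th k)) ^ 2) L) with (energy N sg th).
  change (Rsum_list _ L) with (euler_defect N lam A) at 3; nra.
Qed.

(** A bootstrap: the sharper bound E0 + (n h) h D is propagated, and T h D <= 1 keeps it below E0 +
    1, the level for which lam was chosen and which the next step presupposes. *)
Lemma euler_energy N th0 lam h T E0 : real_meanfree d th0 -> energy N S0 th0 <= E0 ->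
  4 * C0 * K * 10 ^ d * sqrt (E0 + 1) <= lam -> 0 <= h <= 1 -> lam * T <= S0 ->
  T * h * euler_defect N lam (sqrt (E0 + 1)) <= 1 ->
  forall n, INR n * h <= T ->
  energy N (S0 - lam * (INR n * h)) (euler N h th0 n) <= E0 + 1.
Proof.
intros hr hE hlam hh hT hD; set (D := euler_defect N lam (sqrt (E0 + 1))) in *.
assert (hK : 0 < K).
  apply Rplus_lt_le_0_compat; [apply pow_lt; lra|]; apply Rmult_le_pos; [|apply pow_le; lra].
  generalize (pos_INR p); lra.
assert (hl0 : 0 <= lam).
  eapply Rle_trans; [|exact hlam]; repeat apply Rmult_le_pos; try lra;
  [apply pow_le; lra | apply sqrt_pos].
assert (hD0 : 0 <= D) by (apply euler_defect_nonneg; auto; apply sqrt_pos).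
assert (claim : forall n, INR n * h <= T ->
  energy N (S0 - lam * (INR n * h)) (euler N h th0 n) <= E0 + INR n * h * h * D).
  induction n as [|n IH]; intros hn.
  - change (INR 0) with 0; rewrite !Rmult_0_l, Rmult_0_r, Rminus_0_r, Rplus_0_r.
    eapply Rle_trans; [|exact hE]; right; apply Rsum_ext; intros k hk; simpl.
    destruct in_dec; [reflexivity | contradiction].
  - rewrite S_INR in hn |- *; assert (hn' : INR n * h <= T) by nra.
    specialize (IH hn'); assert (hnh : 0 <= INR n * h) by (generalize (pos_INR n); nra).
    assert (hsg : 0 <= S0 - lam * (INR n * h) <= S0) by (split; nra).
    assert (h1 : energy N (S0 - lam * (INR n * h)) (euler N h th0 n) <= E0 + 1).
      eapply Rle_trans; [exact IH|]; assert (0 <= h * D) by nra; nra.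
    assert (h2 := euler_step_energy N _ _ lam h (E0 + 1) (euler_state N h th0 n hr) hsg hh h1 hlam).
    fold D in h2.
    replace (S0 - lam * ((INR n + 1) * h)) with (S0 - lam * (INR n * h) - lam * h) by ring.
    simpl euler; nra.
intros n hn; eapply Rle_trans; [now apply claim|].
assert (0 <= h * D) by nra; nra.
Qed.

End Euler.

(** * Regularity in time of the Euler approximations *)

Section EulerRegularity.
Variables (d : nat) (That : list Z -> nat -> R) (C0 a : R).
Hypothesis ha : 0 < a <= 1.
Hypothesis hC0 : 0 < C0.
Hypothesis hdiv : forall k, length k = d -> vdotZ d (That k) k = 0.
Hypothesis heven : forall k, length k = d -> forall i, (i < d)%nat ->
  That (zneg d k) i = That k i.
Hypothesis hsym : forall j l, length j = d -> length l = d -> zis0 j = false ->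
  Rabs (vdotZ d (That j) l) <= C0 * Rpower (bn j) a * bn l.

Let p := (4 * d + 5)%nat.
Let tm := nl_term d That.
Let B A := 2 ^ (2 * d + 4) * C0 * A * A * 10 ^ d.

Lemma nl_term_sub th ph k j : Cminus (tm th th k j) (tm ph ph k j) =
  Cplus (tm (fun i => Cminus (th i) (ph i)) th k j) (tm ph (fun i => Cminus (th i) (ph i)) k j).
Proof. unfold tm, nl_term; ring. Qed.

Lemma nonlin_sub A D th ph k L : length k = d -> NoDup L ->
  (forall j, In j L -> length j = d) -> th (zzero d) = RtoC 0 -> ph (zzero d) = RtoC 0 ->
  decay d p A th -> decay d p A ph -> decay d (1 + 2 * d) D (fun i => Cminus (th i) (ph i)) ->
  Cmod (Cminus (Csum_list (tm th th k) L) (Csum_list (tm ph ph k) L))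
  <= 2 * C0 * A * bn k * 10 ^ d * D.
Proof.
intros hk hn hL h0 h0' hA hA' hD.
rewrite <- Csum_minus; rewrite (Csum_ext _ _ L (fun j _ => nl_term_sub th ph k j)), Csum_plus.
eapply Rle_trans; [apply Cmod_triangle|].
assert (hz : Cminus (th (zzero d)) (ph (zzero d)) = RtoC 0) by (rewrite h0, h0'; ring).
assert (h1 := nl_sum_decay d That C0 a ha hC0 hdiv hsym 0 D A _ th k L hk hn hL hz hD
  (decay_mono d 0 p A th (Nat.le_0_l p) hA)).
assert (h2 := nl_sum_decay d That C0 a ha hC0 hdiv hsym 0 A D ph _ k L hk hn hL h0'
  (decay_mono d (1 + 2 * d) p A ph ltac:(unfold p; lia) hA') (decay_mono d 0 (1 + 2 * d) D _ (Nat.le_0_l _) hD)).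
rewrite !pow_O, !Rmult_1_r, !Rmult_1_l in h1, h2; unfold tm; lra.
Qed.

Variables (N : nat) (h A : R) (th0 : list Z -> C) (n1 : nat).
Hypothesis hh : 0 <= h.
Hypothesis hreal : real_meanfree d th0.
Let x := euler d That N h th0.
Hypothesis hdec : forall n, (n <= n1)%nat -> decay d p A (x n).

Lemma amplitude_nonneg : 0 <= A.
Proof. apply (decay_nonneg d p A (x 0%nat)), hdec; lia. Qed.

Lemma nonlin_const_nonneg : 0 <= B A.
Proof.
assert (hA := amplitude_nonneg).
unfold B; repeat apply Rmult_le_pos; try lra; apply pow_le; lra.
Qed.

Lemma euler_real n : real_meanfree d (x n).
Proof. apply (euler_state d That hdiv heven N h th0 n hreal). Qed.

Lemma euler_nonlin_decay n k : (n <= n1)%nat -> length k = d ->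
  Cmod (nonlin_psum d That (x n) k N) * bn k ^ (2 * d + 3) <= B A.
Proof.
intros hn hk; apply (nonlin_decay d That C0 a ha hC0 hdiv hsym); auto.
- apply euler_real.
- apply NoDup_cube.
- apply cube_length.
Qed.

Lemma euler_nonlin_bound n k : (n <= n1)%nat -> length k = d ->
  Cmod (nonlin_psum d That (x n) k N) <= B A.
Proof.
intros hn hk; generalize (euler_nonlin_decay n k hn hk) (bn_pow_ge1 k (2 * d + 3))
  (Cmod_ge_0 (nonlin_psum d That (x n) k N)); nra.
Qed.

(** Each step moves the state by h times the nonlinearity. The 2d + 3 powers of decay that survive
    suffice to feed the increment into the nonlinearity once more. *)
Lemma euler_lip n q : (n + q <= n1)%nat ->
  decay d (2 * d + 3) (INR q * h * B A) (fun k => Cminus (x (n + q)%nat k) (x n k)).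
Proof.
intros hq k hk; induction q as [|q IH].
- rewrite Nat.add_0_r; replace (Cminus (x n k) (x n k)) with (RtoC 0) by ring.
  rewrite Cmod_0; simpl; lra.
- rewrite S_INR, Nat.add_succ_r; specialize (IH ltac:(lia)).
  assert (hb := bn_pow_ge1 k (2 * d + 3)); assert (hB := nonlin_const_nonneg); assert (hqp := pos_INR q).
  set (y := x (n + q)%nat) in *.
  assert (E : x (S (n + q)) k = euler_step d That N h y k) by reflexivity.
  rewrite E; unfold euler_step; destruct in_dec as [i|i].
  + set (F := nonlin_psum d That y k N).
    assert (hF : Cmod F * bn k ^ (2 * d + 3) <= B A) by (apply euler_nonlin_decay; auto; lia).
    replace (Cminus (Cminus (y k) (Cmult (RtoC h) F)) (x n k)) with
      (Cplus (Cminus (y k) (x n k)) (Copp (Cmult (RtoC h) F))) by ring.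
    eapply Rle_trans; [apply Rmult_le_compat_r; [lra | apply Cmod_triangle]|].
    rewrite Cmod_opp, Cmod_mult, Cmod_R, Rabs_pos_eq by auto.
    assert (h * (Cmod F * bn k ^ (2 * d + 3)) <= h * B A) by (apply Rmult_le_compat_l; auto).
    nra.
  + assert (hx : x n k = RtoC 0) by (apply (euler_state d That hdiv heven N h th0 n hreal); auto).
    rewrite hx; replace (Cminus (RtoC 0) (RtoC 0)) with (RtoC 0) by ring; rewrite Cmod_0.
    rewrite Rmult_0_l; apply Rmult_le_pos; [apply Rmult_le_pos|]; lra.
Qed.

Let Lk k := 2 * C0 * A * bn k * 10 ^ d * B A.

Lemma taylor_const_nonneg k : 0 <= Lk k.
Proof.
generalize amplitude_nonneg nonlin_const_nonneg (bn_ge1 k); intros; unfold Lk.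
assert (0 <= 10 ^ d) by (apply pow_le; lra).
apply Rmult_le_pos; [repeat apply Rmult_le_pos|]; lra.
Qed.

Lemma euler_nonlin_lip n q k : (n + q <= n1)%nat -> length k = d ->
  Cmod (Cminus (nonlin_psum d That (x (n + q)%nat) k N) (nonlin_psum d That (x n) k N))
  <= Lk k * (INR q * h).
Proof.
intros hq hk; eapply Rle_trans.
  apply (nonlin_sub A (INR q * h * B A) (x (n + q)%nat) (x n) k (cube d N)); auto.
  - apply NoDup_cube.
  - apply cube_length.
  - apply euler_real.
  - apply euler_real.
  - apply hdec; lia.
  - apply (decay_mono _ _ (2 * d + 3)); [lia | apply euler_lip; auto].
right; unfold Lk; ring.
Qed.

(** The remainder is quadratic in the elapsed time with a constant independent of N and h, so it
    survives the limit and yields differentiability there. The nonlinearity may be frozen at any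
    intermediate index r, so that forward and backward increments are both covered. *)
Lemma euler_taylor n q r k : (n + q <= n1)%nat -> (n <= r <= n + q)%nat -> In k (cube d N) ->
  Cmod (Cplus (Cminus (x (n + q)%nat k) (x n k))
    (Cmult (RtoC (INR q * h)) (nonlin_psum d That (x r) k N))) <= Lk k * (INR q * h) ^ 2.
Proof.
intros hq hr hk; assert (hkd := cube_length _ _ _ hk).
assert (hL := taylor_const_nonneg k).
assert (claim : forall i, (i <= q)%nat ->
  Cmod (Cplus (Cminus (x (n + i)%nat k) (x n k))
    (Cmult (RtoC (INR i * h)) (nonlin_psum d That (x r) k N)))
  <= INR i * h * (Lk k * (INR q * h))).
  induction i as [|i IH]; intros hi.
    rewrite Nat.add_0_r; change (INR 0) with 0; rewrite !Rmult_0_l.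
    replace (Cplus _ _) with (RtoC 0) by ring; rewrite Cmod_0; lra.
  specialize (IH ltac:(lia)); rewrite S_INR, Nat.add_succ_r.
  set (y := x (n + i)%nat) in *; set (F := nonlin_psum d That (x r) k N) in *.
  assert (E : x (S (n + i)) k = euler_step d That N h y k) by reflexivity.
  rewrite E; unfold euler_step; destruct in_dec as [_|i0]; [|contradiction].
  set (F' := nonlin_psum d That y k N).
  assert (hF : Cmod (Cminus F F') <= Lk k * (INR q * h)).
    destruct (Nat.le_gt_cases r (n + i)) as [c|c].
    - replace (Cminus F F') with (Copp (Cminus F' F)) by ring; rewrite Cmod_opp.
      assert (e : (n + i = r + (n + i - r))%nat) by lia.
      unfold F', y; rewrite e; eapply Rle_trans; [apply euler_nonlin_lip; auto; lia|].
      apply Rmult_le_compat_l; auto; apply Rmult_le_compat_r; auto; apply le_INR; lia.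
    - assert (e : (r = n + i + (r - (n + i)))%nat) by lia.
      unfold F; rewrite e; eapply Rle_trans; [apply euler_nonlin_lip; auto; lia|].
      apply Rmult_le_compat_l; auto; apply Rmult_le_compat_r; auto; apply le_INR; lia.
  replace (Cplus (Cminus (Cminus (y k) (Cmult (RtoC h) F')) (x n k))
    (Cmult (RtoC ((INR i + 1) * h)) F)) with
    (Cplus (Cplus (Cminus (y k) (x n k)) (Cmult (RtoC (INR i * h)) F))
      (Cmult (RtoC h) (Cminus F F'))).
    eapply Rle_trans; [apply Cmod_triangle|]; rewrite Cmod_mult, Cmod_R, Rabs_pos_eq by auto.
    assert (h * Cmod (Cminus F F') <= h * (Lk k * (INR q * h))) by (apply Rmult_le_compat_l; auto).
    lra.
  rewrite !RtoC_mult, RtoC_plus; ring.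
eapply Rle_trans; [apply claim; auto|]; right; ring.
Qed.

End EulerRegularity.

(** * Limits along an ultrafilter *)

Lemma Cmod_parts_le z : Cmod z <= Rabs (Re z) + Rabs (Im z).
Proof.
rewrite <- (sqrt_pow2 (Rabs (Re z) + Rabs (Im z)))
  by (generalize (Rabs_pos (Re z)) (Rabs_pos (Im z)); lra).
apply sqrt_le_1_alt; change (fst z) with (Re z); change (snd z) with (Im z).
rewrite <- (pow2_abs (Re z)), <- (pow2_abs (Im z)).
generalize (Rabs_pos (Re z)) (Rabs_pos (Im z)); nra.
Qed.

Lemma filterlim_C {T} (F : (T -> Prop) -> Prop) {FF : Filter F} (f : T -> C) (z : C) :
  filterlim f F (locally z) <-> forall eps, 0 < eps -> F (fun x => Cmod (Cminus (f x) z) < eps).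
Proof.
split.
- intros H eps he; apply (H (fun y => Cmod (Cminus y z) < eps)).
  assert (he2 : 0 < eps / 2) by lra; exists (mkposreal _ he2); intros y [h1 h2].
  change (Rabs (Re y - Re z) < eps / 2) in h1; change (Rabs (Im y - Im z) < eps / 2) in h2.
  eapply Rle_lt_trans; [apply Cmod_parts_le|].
  change (Re (Cminus y z)) with (Re y - Re z); change (Im (Cminus y z)) with (Im y - Im z); lra.
- intros H P [eps hP]; unfold filtermap; generalize (H eps (cond_pos eps)); apply filter_imp.
  intros x hx; apply hP; split.
  + change (Rabs (Re (f x) - Re z) < eps); eapply Rle_lt_trans; [|exact hx].
    apply (Re_le_Cmod (Cminus (f x) z)).
  + change (Rabs (Im (f x) - Im z) < eps); eapply Rle_lt_trans; [|exact hx].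
    eapply Rle_trans; [|apply Rmax_Cmod]; apply Rmax_r.
Qed.

Lemma is_derive_C (f : R -> C) (t : R) (l : C) :
  (forall eps, 0 < eps -> exists del, 0 < del /\ forall t', Rabs (t' - t) < del ->
     Cmod (Cminus (Cminus (f t') (f t)) (Cmult (RtoC (t' - t)) l)) <= eps * Rabs (t' - t)) ->
  is_derive f t l.
Proof.
intros H; split; [apply is_linear_scal_l|].
intros t1 h1; assert (E : t = t1)
  by (apply (is_filter_lim_locally_unique (V := AbsRing_NormedModule R_AbsRing)); exact h1); subst t1; intros eps.
destruct (H eps (cond_pos eps)) as (del & hd & hdel); exists (mkposreal del hd); intros t' ht'.
specialize (hdel t' ht').
assert (hn : forall z : C, @norm R_AbsRing C_R_NormedModule z = Cmod z).
  intros z; change (sqrt (Rabs (Re z) ^ 2 + Rabs (Im z) ^ 2) = Cmod z).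
  rewrite !pow2_abs; reflexivity.
eapply Rle_trans; [right; apply hn|]; eapply Rle_trans; [|exact hdel]; right; f_equal.
destruct (f t'), (f t), l; unfold Cminus, Cplus, Copp, Cmult, RtoC; simpl.
unfold minus, plus, opp, scal; simpl.
unfold prod_plus, prod_opp, prod_scal, scal, plus, opp; simpl; unfold mult; simpl.
f_equal; ring.
Qed.

Lemma is_derive_C_parts (f : R -> C) (t : R) (l : C) : is_derive f t l ->
  is_derive (fun x => Re (f x)) t (Re l) /\ is_derive (fun x => Im (f x)) t (Im l).
Proof.
intros H; split.
- apply (filterdiff_comp' f (fun z : C_R_NormedModule => fst z) t _ (fun z => fst z) H).
  apply filterdiff_linear, is_linear_fst.
- apply (filterdiff_comp' f (fun z : C_R_NormedModule => snd z) t _ (fun z => snd z) H).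
  apply filterdiff_linear, is_linear_snd.
Qed.

(** An ultrafilter refining the filter of cofinite sets, recorded through the closure properties
    that the limits below rely on. *)
Lemma ultrafilter_exists : exists U : (nat -> Prop) -> Prop,
  (forall n0, U (fun n => (n0 <= n)%nat)) /\ (forall P Q : nat -> Prop, U P -> U Q -> U (fun n => P n /\ Q n)) /\
  (forall P Q : nat -> Prop, (forall n, P n -> Q n) -> U P -> U Q) /\
  ~ U (fun _ => False) /\ (forall P : nat -> Prop, U P \/ U (fun n => ~ P n)).
Proof.
set (F := fun P : nat -> Prop => exists n0, forall n, (n0 <= n)%nat -> P n).
destruct (@filter.ultraFilterLemma nat F) as (U & hU & hF).
- split; [intros [n0 h]; apply (h n0); auto|split].
  + exists 0%nat; intros; exact Logic.I.
  + intros P Q [n h] [m h']; exists (Nat.max n m); intros i hi; split; [apply h | apply h']; lia.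
  + intros P Q hPQ [n h]; exists n; intros i hi; apply hPQ, h, hi.
- exists U; destruct (@filter.ultra_proper nat U hU) as [h0 [h1 h2 h3]].
  split; [|split; [|split; [|split]]].
  + intros n0; apply hF; exists n0; auto.
  + exact h2.
  + intros P Q h; apply h3; exact h.
  + exact h0.
  + intros P; apply (@filter.in_ultra_setVsetC nat U P hU).
Qed.

Section UltraLimits.
Variable U : (nat -> Prop) -> Prop.
Hypothesis U_event : forall n0, U (fun n => (n0 <= n)%nat).
Hypothesis U_and : forall P Q : nat -> Prop, U P -> U Q -> U (fun n => P n /\ Q n).
Hypothesis U_imp : forall P Q : nat -> Prop, (forall n, P n -> Q n) -> U P -> U Q.
Hypothesis U_nonempty : ~ U (fun _ => False).
Hypothesis U_ultra : forall P : nat -> Prop, U P \/ U (fun n => ~ P n).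

Definition ulim (x : nat -> C) (z : C) : Prop :=
  forall eps, 0 < eps -> U (fun n => Cmod (Cminus (x n) z) < eps).

Lemma ultra_all (P : nat -> Prop) : (forall n, P n) -> U P.
Proof. intros h; apply (U_imp (fun n => (0 <= n)%nat)); auto. Qed.

(** The limit is the supremum of the numbers that lie below x n for almost all n in the sense of U;
    the ultrafilter decides on which side of a given level the sequence lies. *)
Lemma ulim_real_exists (x : nat -> R) b : U (fun n => Rabs (x n) <= b) ->
  exists y, forall eps, 0 < eps -> U (fun n => Rabs (x n - y) < eps).
Proof.
intros hb; set (E := fun y => U (fun n => y <= x n)).
destruct (completeness E) as [y [h1 h2]].
- exists b; intros y hy; apply Rnot_lt_le; intros hlt; apply U_nonempty.
  eapply U_imp; [|exact (U_and _ _ hb hy)]; intros n [h3 h4].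
  apply Rabs_le_between in h3; lra.
- exists (- b); eapply U_imp; [|exact hb]; intros n h3; apply Rabs_le_between in h3; lra.
- exists y; intros eps he.
  assert (hlo : U (fun n => y - eps / 2 <= x n)).
    destruct (U_ultra (fun n => y - eps / 2 <= x n)) as [|hn]; auto; exfalso.
    assert (y <= y - eps / 2); [|lra]; apply h2; intros u hu; apply Rnot_lt_le; intros hlt.
    apply U_nonempty; eapply U_imp; [|exact (U_and _ _ hn hu)]; simpl; intros n [h3 h4]; lra.
  assert (hup : U (fun n => ~ (y + eps / 2 <= x n))).
    destruct (U_ultra (fun n => y + eps / 2 <= x n)) as [hn|]; auto; exfalso.
    generalize (h1 _ hn); lra.
  eapply U_imp; [|exact (U_and _ _ hlo hup)]; intros n [h3 h4]; apply Rabs_def1; lra.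
Qed.

Lemma ulim_exists (x : nat -> C) b : U (fun n => Cmod (x n) <= b) -> exists z, ulim x z.
Proof.
intros hb.
destruct (ulim_real_exists (fun n => Re (x n)) b) as [u hu].
  eapply U_imp; [|exact hb]; intros n hn; eapply Rle_trans; [apply Re_le_Cmod | exact hn].
destruct (ulim_real_exists (fun n => Im (x n)) b) as [v hv].
  eapply U_imp; [|exact hb]; intros n hn; eapply Rle_trans; [|exact hn].
  eapply Rle_trans; [|apply Rmax_Cmod]; apply Rmax_r.
exists (u, v); intros eps he.
eapply U_imp; [|exact (U_and _ _ (hu (eps / 2) ltac:(lra)) (hv (eps / 2) ltac:(lra)))].
intros n [h1 h2]; eapply Rle_lt_trans; [apply Cmod_parts_le|].
change (Re (Cminus (x n) (u, v))) with (Re (x n) - u).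
change (Im (Cminus (x n) (u, v))) with (Im (x n) - v); lra.
Qed.

Lemma ulim_le (x : nat -> C) z b : ulim x z ->
  (forall eps, 0 < eps -> U (fun n => Cmod (x n) <= b + eps)) -> Cmod z <= b.
Proof.
intros hx hb; apply Rnot_lt_le; intros hlt; apply U_nonempty.
assert (he : 0 < (Cmod z - b) / 2) by lra.
eapply U_imp; [|exact (U_and _ _ (hx _ he) (hb _ he))]; intros n [h1 h2]; simpl in h1, h2.
assert (h3 : Cmod z <= Cmod (x n) + Cmod (Cminus (x n) z)).
  replace z with (Cplus (x n) (Copp (Cminus (x n) z))) at 1 by ring.
  eapply Rle_trans; [apply Cmod_triangle|]; rewrite Cmod_opp; lra.
lra.
Qed.

Lemma ulim_unique (x : nat -> C) z w : ulim x z -> ulim x w -> z = w.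
Proof.
intros hz hw; assert (h : Cmod (Cminus z w) <= 0).
  apply Rnot_lt_le; intros hlt; apply U_nonempty.
  assert (he : 0 < Cmod (Cminus z w) / 2) by lra.
  eapply U_imp; [|exact (U_and _ _ (hz _ he) (hw _ he))]; simpl; intros n [h1 h2].
  assert (h3 : Cmod (Cminus z w) <= Cmod (Cminus (x n) w) + Cmod (Cminus (x n) z)).
    replace (Cminus z w) with (Cplus (Cminus (x n) w) (Copp (Cminus (x n) z))) by ring.
    eapply Rle_trans; [apply Cmod_triangle|]; rewrite Cmod_opp; lra.
  lra.
assert (E : Cminus z w = RtoC 0) by (apply Cmod_eq_0; generalize (Cmod_ge_0 (Cminus z w)); lra).
replace z with (Cplus (Cminus z w) w) by ring; rewrite E; ring.
Qed.

Lemma ulim_eventually (x y : nat -> C) z : U (fun n => x n = y n) -> ulim x z -> ulim y z.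
Proof.
intros h hx eps he; eapply U_imp; [|exact (U_and _ _ h (hx eps he))].
simpl; intros n [-> h']; exact h'.
Qed.

Lemma ulim_const z : ulim (fun _ => z) z.
Proof.
intros eps he; apply ultra_all; intros _; replace (Cminus z z) with (RtoC 0) by ring.
now rewrite Cmod_0.
Qed.

Lemma ulim_plus x y z w : ulim x z -> ulim y w ->
  ulim (fun n => Cplus (x n) (y n)) (Cplus z w).
Proof.
intros hx hy eps he.
eapply U_imp; [|exact (U_and _ _ (hx (eps / 2) ltac:(lra)) (hy (eps / 2) ltac:(lra)))].
intros n [h1 h2]; replace (Cminus (Cplus (x n) (y n)) (Cplus z w)) with
  (Cplus (Cminus (x n) z) (Cminus (y n) w)) by ring.
eapply Rle_lt_trans; [apply Cmod_triangle|]; lra.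
Qed.

Lemma ulim_mult x y z w : ulim x z -> ulim y w ->
  ulim (fun n => Cmult (x n) (y n)) (Cmult z w).
Proof.
intros hx hy eps he; set (c := Cmod z + Cmod w + 1).
assert (hz := Cmod_ge_0 z); assert (hw := Cmod_ge_0 w).
assert (hc : 0 < c) by (unfold c; lra).
set (del := Rmin 1 (eps / (2 * c))).
assert (hd : 0 < del) by (apply Rmin_glb_lt; [lra | apply Rdiv_lt_0_compat; lra]).
assert (hd1 : del <= 1) by apply Rmin_l.
assert (hd2 : del * c <= eps / 2).
  apply Rle_trans with (eps / (2 * c) * c); [apply Rmult_le_compat_r; [lra | apply Rmin_r]|].
  right; field; lra.
eapply U_imp; [|exact (U_and _ _ (hx del hd) (hy del hd))]; intros n [h1 h2].
replace (Cminus (Cmult (x n) (y n)) (Cmult z w)) with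
  (Cplus (Cmult (Cminus (x n) z) (Cminus (y n) w))
    (Cplus (Cmult z (Cminus (y n) w)) (Cmult w (Cminus (x n) z)))) by ring.
eapply Rle_lt_trans; [apply Cmod_triangle|].
eapply Rle_lt_trans; [apply Rplus_le_compat_l, Cmod_triangle|]; rewrite !Cmod_mult.
set (u := Cmod (Cminus (x n) z)) in *; set (v := Cmod (Cminus (y n) w)) in *.
assert (0 <= u) by apply Cmod_ge_0; assert (0 <= v) by apply Cmod_ge_0.
assert (u * v <= del * 1) by (apply Rmult_le_compat; lra).
assert (Cmod z * v <= Cmod z * del) by (apply Rmult_le_compat_l; lra).
assert (Cmod w * u <= Cmod w * del) by (apply Rmult_le_compat_l; lra).
unfold c in hd2; nra.
Qed.

Lemma ulim_opp x z : ulim x z -> ulim (fun n => Copp (x n)) (Copp z).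
Proof.
intros hx eps he; eapply U_imp; [|exact (hx eps he)]; simpl; intros n h.
replace (Cminus (Copp (x n)) (Copp z)) with (Copp (Cminus (x n) z)) by ring.
now rewrite Cmod_opp.
Qed.

Lemma ulim_minus x y z w : ulim x z -> ulim y w ->
  ulim (fun n => Cminus (x n) (y n)) (Cminus z w).
Proof. intros hx hy; apply ulim_plus; auto; now apply ulim_opp. Qed.

Lemma ulim_conj x z : ulim x z -> ulim (fun n => Cconj (x n)) (Cconj z).
Proof.
intros hx eps he; eapply U_imp; [|exact (hx eps he)]; simpl; intros n h.
rewrite <- Cconj_minus, Cmod_conj; exact h.
Qed.

Lemma ulim_Csum {A} (x : nat -> A -> C) (z : A -> C) l :
  (forall j, In j l -> ulim (fun n => x n j) (z j)) ->
  ulim (fun n => Csum_list (x n) l) (Csum_list z l).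
Proof.
induction l as [|j l IH]; intros H; [exact (ulim_const (RtoC 0))|].
apply (ulim_plus (fun n => x n j) (fun n => Csum_list (x n) l)).
- apply H; now left.
- apply IH; intros; apply H; now right.
Qed.

(** Dominated convergence for lattice sums. L is obtained as the limit of the diagonal sums of f n
    over the n-th cube, and the uniform tail bound then shows that the series of f0 along cubes
    converges to the same L. *)
Lemma ulim_dominated d D (f : nat -> list Z -> C) (f0 : list Z -> C) : 0 <= D ->
  U (fun n => forall j, length j = d -> Cmod (f n j) <= D * rho j) ->
  (forall j, length j = d -> ulim (fun n => f n j) (f0 j)) ->
  exists L, filterlim (fun n => Csum_list f0 (cube d n)) eventually (locally L) /\
    ulim (fun n => Csum_list (f n) (cube d n)) L.
Proof.
intros hD hf hl.
assert (hf0 : forall j, length j = d -> Cmod (f0 j) <= D * rho j).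
  intros j hj; apply (ulim_le (fun n => f n j)); auto; intros eps he.
  eapply U_imp; [|exact hf]; simpl; intros n hn; specialize (hn j hj); lra.
assert (hb : U (fun n => Cmod (Csum_list (f n) (cube d n)) <= D * 10 ^ d)).
  eapply U_imp; [|exact hf]; intros n hn; eapply Rle_trans; [apply Cmod_Csum|].
  apply Rle_trans with (Rsum_list (fun j => D * rho j) (cube d n)).
    apply Rsum_le; intros j hj; apply hn; now apply cube_length in hj.
  rewrite Rsum_scal; apply Rmult_le_compat_l; auto.
  apply rho_sum_bound; [apply NoDup_cube | apply cube_length].
destruct (ulim_exists _ _ hb) as [L hL]; exists L; split; auto.
apply filterlim_C; [apply eventually_filter|]; intros eps he.
(* D + 1 rather than D, since D may be 0. *)
assert (he1 : 0 < eps / (4 * (D + 1))) by (apply Rdiv_lt_0_compat; lra).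
destruct (Csum_dominated_tail d _ he1) as [N0 hN].
assert (hDe : D * (eps / (4 * (D + 1))) <= eps / 4).
  apply (Rmult_le_reg_r (D + 1)); [lra|].
  replace (D * (eps / (4 * (D + 1))) * (D + 1)) with (D * (eps / 4)) by (field; lra); nra.
assert (hN0 := fun f hf L h1 h2 h3 => Rle_trans _ _ _ (hN D f hD hf L h1 h2 h3) hDe).
assert (h1 : Cmod (Cminus (Csum_list f0 (cube d N0)) L) <= eps / 2).
  apply (ulim_le (fun n => Cminus (Csum_list (f n) (cube d N0)) (Csum_list (f n) (cube d n)))).
    apply ulim_minus; auto; apply ulim_Csum; intros j hj; apply hl; now apply cube_length in hj.
  intros e he'; eapply U_imp; [|exact (U_and _ _ hf (U_event N0))]; simpl; intros n [h2 h3].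
  assert (h4 := hN0 (f n) h2 (cube d n) (NoDup_cube d n) (cube_length d n)
    (fun k => cube_mono d N0 n k h3)).
  replace (Cminus (Csum_list (f n) (cube d N0)) (Csum_list (f n) (cube d n))) with
    (Copp (Cminus (Csum_list (f n) (cube d n)) (Csum_list (f n) (cube d N0)))) by ring.
  rewrite Cmod_opp; lra.
exists N0; intros n hn.
assert (h4 := hN0 f0 hf0 (cube d n) (NoDup_cube d n) (cube_length d n)
    (fun k => cube_mono d N0 n k hn)).
replace (Cminus (Csum_list f0 (cube d n)) L) with
  (Cplus (Cminus (Csum_list f0 (cube d n)) (Csum_list f0 (cube d N0)))
    (Cminus (Csum_list f0 (cube d N0)) L)) by ring.
eapply Rle_lt_trans; [apply Cmod_triangle|]; lra.
Qed.

End UltraLimits.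

(** * Existence *)

Definition time_index (h t : R) : nat := Z.to_nat (Int_part (t / h)).

Lemma time_index_spec h t : 0 < h -> 0 <= t ->
  INR (time_index h t) * h <= t < INR (time_index h t) * h + h.
Proof.
intros hh ht; assert (hq : 0 <= t / h) by (apply Rdiv_le_0_compat; lra).
destruct (base_Int_part (t / h)) as [h1 h2].
assert (h3 : (0 <= Int_part (t / h))%Z).
  assert (-1 < Int_part (t / h))%Z; [apply lt_IZR; simpl; lra | lia].
assert (E : t = t / h * h) by (field; lra).
unfold time_index; rewrite INR_IZR_INZ, Z2Nat.id by auto.
set (m := IZR (Int_part (t / h))) in *; clearbody m; rewrite E; split; nra.
Qed.

Lemma time_index_mono h t t' : 0 < h -> 0 <= t -> t <= t' ->
  (time_index h t <= time_index h t')%nat.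
Proof.
intros hh ht htt; generalize (time_index_spec h t hh ht) (time_index_spec h t' hh ltac:(lra)).
intros h1 h2; assert (INR (time_index h t) < INR (S (time_index h t'))).
  rewrite S_INR; apply (Rmult_lt_reg_r h); lra.
apply INR_lt in H; lia.
Qed.

Section Existence.
Variable U : (nat -> Prop) -> Prop.
Hypothesis U_event : forall n0, U (fun n => (n0 <= n)%nat).
Hypothesis U_and : forall P Q : nat -> Prop, U P -> U Q -> U (fun n => P n /\ Q n).
Hypothesis U_imp : forall P Q : nat -> Prop, (forall n, P n -> Q n) -> U P -> U Q.
Hypothesis U_nonempty : ~ U (fun _ => False).
Hypothesis U_ultra : forall P : nat -> Prop, U P \/ U (fun n => ~ P n).

Variables (d : nat) (That : list Z -> nat -> R) (C0 a S0 : R).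
Hypothesis ha : 0 < a <= 1.
Hypothesis hC0 : 0 < C0.
Hypothesis hS0 : 0 < S0.
Hypothesis hdiv : forall k, length k = d -> vdotZ d (That k) k = 0.
Hypothesis heven : forall k, length k = d -> forall i, (i < d)%nat ->
  That (zneg d k) i = That k i.
Hypothesis hsym : forall j l, length j = d -> length l = d -> zis0 j = false ->
  Rabs (vdotZ d (That j) l) <= C0 * Rpower (bn j) a * bn l.

Let p := (4 * d + 5)%nat.
Let M (sg : R) (k : list Z) := mw a p sg (bn k).
Let K := 3 ^ p + 4 * (INR p + S0) * 2 ^ p.

Variables (th0 : list Z -> C) (E0 lam : R).
Hypothesis hreal : real_meanfree d th0.
Hypothesis hE0 : forall N, energy d a N S0 th0 <= E0.
Hypothesis hlam : 0 < lam.
Hypothesis hlamK : 4 * C0 * K * 10 ^ d * sqrt (E0 + 1) <= lam.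

(** Up to this time the radius loses lam T = S0/2, so every approximation can be measured with the
    fixed radius S0/2. *)
Let T := S0 / (2 * lam).
Let A := sqrt (E0 + 1).
Let B := 2 ^ (2 * d + 4) * C0 * A * A * 10 ^ d.
(* The second summand makes the accumulated second-order Euler errors at most 1. *)
Let h N := / (INR N + 1 + T * euler_defect d C0 a S0 N lam A).
Let X N t := euler d That N (h N) th0 (time_index (h N) t).

Lemma lifespan_pos : 0 < T.
Proof. apply Rdiv_lt_0_compat; lra. Qed.

Lemma amplitude_ge0 : 0 <= A.
Proof. apply sqrt_pos. Qed.

Lemma defect_nonneg N : 0 <= T * euler_defect d C0 a S0 N lam A.
Proof.
apply Rmult_le_pos; [left; apply lifespan_pos|]; apply euler_defect_nonneg; auto using amplitude_ge0; lra.
Qed.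

Lemma mesh_pos N : 0 < h N.
Proof. apply Rinv_0_lt_compat; generalize (pos_INR N) (defect_nonneg N); lra. Qed.

Lemma mesh_small N : h N * (INR N + 1) <= 1.
Proof.
generalize (pos_INR N) (defect_nonneg N); intros hN hD; unfold h.
set (D := T * _) in *; apply (Rmult_le_reg_l (INR N + 1 + D)); [lra|].
rewrite <- Rmult_assoc, Rinv_r; lra.
Qed.

Lemma mesh_le1 N : h N <= 1.
Proof. generalize (mesh_small N) (mesh_pos N) (pos_INR N); nra. Qed.

Lemma mesh_defect N : T * h N * euler_defect d C0 a S0 N lam A <= 1.
Proof.
generalize (pos_INR N) (defect_nonneg N); intros hN hD.
replace (T * h N * euler_defect d C0 a S0 N lam A) with
  (h N * (T * euler_defect d C0 a S0 N lam A)) by ring.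
unfold h; set (D := T * _) in *; apply (Rmult_le_reg_l (INR N + 1 + D)); [lra|].
rewrite <- Rmult_assoc, Rinv_r; lra.
Qed.

Lemma energy_mono N sg sg' th : sg <= sg' -> energy d a N sg th <= energy d a N sg' th.
Proof.
intros hs; apply Rsum_le; intros k _; apply pow_incr; split.
- apply Rmult_le_pos; [left; apply weight_pos | apply Cmod_ge_0].
- apply Rmult_le_compat_r; [apply Cmod_ge_0 | now apply weight_mono].
Qed.

Lemma euler_half_energy N n : INR n * h N <= T ->
  energy d a N (S0 / 2) (euler d That N (h N) th0 n) <= E0 + 1.
Proof.
intros hn; assert (hT := lifespan_pos).
assert (hlT : lam * T = S0 / 2) by (unfold T; field; lra).
eapply Rle_trans; [|apply (euler_energy d That C0 a S0 ha hC0 hS0 hdiv heven hsym N th0 lam (h N) T E0);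
  auto using mesh_defect].
- apply energy_mono; nra.
- generalize (mesh_pos N) (mesh_le1 N); lra.
- lra.
- exact hn.
Qed.

Lemma euler_weighted N n k : INR n * h N <= T -> length k = d ->
  M (S0 / 2) k * Cmod (euler d That N (h N) th0 n k) <= A.
Proof.
intros hn hk; apply (energy_bound d a N); auto.
- now apply euler_state.
- now apply euler_half_energy.
Qed.

Lemma euler_decay N n : INR n * h N <= T -> decay d p A (euler d That N (h N) th0 n).
Proof.
intros hn; apply (weighted_decay d a (S0 / 2)); [lra|].
intros; now apply euler_weighted.
Qed.

Lemma index_le N t : 0 <= t <= T -> INR (time_index (h N) t) * h N <= T.
Proof. intros ht; generalize (time_index_spec (h N) t (mesh_pos N) (proj1 ht)); lra. Qed.

Lemma approx_decay N t : 0 <= t <= T -> decay d p A (X N t).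
Proof. intros ht; now apply euler_decay, index_le. Qed.

Lemma approx_real N t : real_meanfree d (X N t).
Proof. apply (euler_state d That hdiv heven); auto. Qed.

Lemma euler_le_decay N t n : 0 <= t <= T -> (n <= time_index (h N) t)%nat ->
  decay d p A (euler d That N (h N) th0 n).
Proof.
intros ht hn; apply euler_decay; eapply Rle_trans; [|apply (index_le N t ht)].
apply Rmult_le_compat_r; [left; apply mesh_pos | now apply le_INR].
Qed.

(** The approximations are step functions of time, bounded at each t in [0,T] and each k; a limit
    along U is picked pointwise, and its continuity in time is recovered afterwards from the Taylor
    estimate. *)
Definition limit_flow (t : R) (k : list Z) : C :=
  epsilon (inhabits (RtoC 0)) (ulim U (fun N => X N t k)).

Lemma limit_flow_spec t k : 0 <= t <= T -> length k = d ->
  ulim U (fun N => X N t k) (limit_flow t k).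
Proof.
intros ht hk; unfold limit_flow; apply epsilon_spec.
apply (ulim_exists U U_and U_imp U_nonempty U_ultra _ A).
apply (ultra_all U U_event U_imp); intros N; apply (decay_bound d p); auto; now apply approx_decay.
Qed.

Lemma limit_flow_0 k : length k = d -> limit_flow 0 k = th0 k.
Proof.
intros hk; assert (hT := lifespan_pos).
apply (ulim_unique U U_and U_imp U_nonempty (fun N => X N 0 k)).
  apply limit_flow_spec; auto; lra.
destruct (cube_exists d k hk) as [N0 hN0].
apply (ulim_eventually U U_and U_imp (fun _ => th0 k)); [|apply ulim_const; auto].
eapply U_imp; [|exact (U_event N0)]; simpl; intros N hN; unfold X.
assert (E : time_index (h N) 0 = 0%nat).
  generalize (time_index_spec (h N) 0 (mesh_pos N) ltac:(lra)) (mesh_pos N); intros h1 h2.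
  destruct (time_index (h N) 0) as [|m]; auto; exfalso; rewrite S_INR in h1.
  generalize (pos_INR m); nra.
rewrite E; simpl; destruct in_dec as [|n]; auto; destruct n; now apply (cube_mono d N0).
Qed.

Lemma limit_flow_real t : 0 <= t <= T -> real_meanfree d (limit_flow t).
Proof.
intros ht; split.
- apply (ulim_unique U U_and U_imp U_nonempty (fun N => X N t (zzero d))).
    apply limit_flow_spec; auto using zzero_length.
  apply (ulim_eventually U U_and U_imp (fun _ => RtoC 0)); [|apply ulim_const; auto].
  apply (ultra_all U U_event U_imp); intros N; symmetry; apply approx_real.
- intros k hk; apply (ulim_unique U U_and U_imp U_nonempty (fun N => X N t (zneg d k))).
    apply limit_flow_spec; auto using zneg_length.
  apply (ulim_eventually U U_and U_imp (fun N => Cconj (X N t k))).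
  + apply (ultra_all U U_event U_imp); intros N; symmetry; now apply approx_real.
  + apply ulim_conj; auto; now apply limit_flow_spec.
Qed.

(** Writing the energy as a polynomial in the coefficients and their conjugates lets the algebra of
    limits along U apply to it. *)
Lemma Csum_energy sg th L :
  Csum_list (fun k => Cmult (RtoC (M sg k ^ 2)) (Cmult (Cconj (th k)) (th k))) L =
  RtoC (Rsum_list (fun k => (M sg k * Cmod (th k)) ^ 2) L).
Proof.
apply C_eq_parts.
- rewrite Re_Csum; apply Rsum_ext; intros k _; rewrite Rpow_mult_distr, Cmod_sqr.
  destruct (th k); unfold Cmult, Cconj, RtoC, Re, Im; simpl; ring.
- rewrite Im_Csum; apply Rsum_zero; intros k _.
  destruct (th k); unfold Cmult, Cconj, RtoC, Im; simpl; ring.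
Qed.

(** As in Fatou's lemma: the energy on a fixed cube passes to the limit, and for n >= N it is at
    most the energy of the n-th approximation on its own cube. *)
Lemma limit_flow_energy t N : 0 <= t <= T -> energy d a N (S0 / 2) (limit_flow t) <= E0 + 1.
Proof.
intros ht; assert (h0 : 0 <= energy d a N (S0 / 2) (limit_flow t))
  by (apply Rsum_nonneg; intros; apply pow2_ge_0).
rewrite <- (Rabs_pos_eq _ h0), <- Cmod_R; unfold energy; fold p.
change (fun k => (mw a p (S0 / 2) (bn k) * Cmod (limit_flow t k)) ^ 2) with
  (fun k => (M (S0 / 2) k * Cmod (limit_flow t k)) ^ 2).
rewrite <- Csum_energy.
apply (ulim_le U U_and U_imp U_nonempty (fun n => Csum_list (fun k =>
  Cmult (RtoC (M (S0 / 2) k ^ 2)) (Cmult (Cconj (X n t k)) (X n t k))) (cube d N))).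
- apply ulim_Csum; auto; intros k hk; apply cube_length in hk.
  apply ulim_mult; auto; [apply ulim_const; auto|].
  apply ulim_mult; auto; [apply ulim_conj; auto|]; now apply limit_flow_spec.
- intros eps he; eapply U_imp; [|exact (U_event N)]; cbv beta; intros n hn.
  rewrite Csum_energy, Cmod_R, Rabs_pos_eq by (apply Rsum_nonneg; intros; apply pow2_ge_0).
  apply Rle_trans with (energy d a n (S0 / 2) (X n t)).
  + apply Rsum_support_le; [apply NoDup_cube | intros; apply pow2_ge_0|].
    intros k hk _; now apply (cube_mono d N).
  + assert (hx := euler_half_energy n _ (index_le n t ht)); fold (X n t) in hx; lra.
Qed.

Lemma limit_nonlin t k : 0 <= t <= T -> length k = d -> exists L,
  filterlim (nonlin_psum d That (limit_flow t) k) eventually (locally L) /\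
  ulim U (fun N => nonlin_psum d That (X N t) k N) L.
Proof.
intros ht hk; assert (hA := amplitude_ge0); assert (hb := bn_ge1 k).
apply (ulim_dominated U U_event U_and U_imp U_nonempty U_ultra d (C0 * A * A * bn k)
  (fun N => nl_term d That (X N t) (X N t) k)
  (nl_term d That (limit_flow t) (limit_flow t) k)).
- repeat apply Rmult_le_pos; lra.
- apply (ultra_all U U_event U_imp); intros N j hj.
  assert (hd := approx_decay N t ht).
  apply (nl_term_rho d That C0 a ha hC0 hdiv hsym); auto.
  + apply approx_real.
  + apply (decay_mono d _ p); auto; unfold p; lia.
  + apply (decay_mono d _ p); auto; lia.
- intros j hj; apply ulim_mult; auto; [apply ulim_const; auto|].
  apply ulim_mult; auto; apply limit_flow_spec; auto using zsub_length.
Qed.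

Let Lk k := 2 * C0 * A * bn k * 10 ^ d * B.

Lemma taylor_const_ge0 k : 0 <= Lk k.
Proof.
assert (hA := amplitude_ge0); assert (hb := bn_ge1 k).
assert (0 < 10 ^ d) by (apply pow_lt; lra); assert (0 < 2 ^ (2 * d + 4)) by (apply pow_lt; lra).
assert (0 <= B) by (unfold B; repeat apply Rmult_le_pos; lra).
apply Rmult_le_pos; auto; repeat apply Rmult_le_pos; lra.
Qed.

Lemma limit_taylor t t' u k L : 0 <= t -> t <= t' -> t' <= T -> (u = t \/ u = t') -> length k = d ->
  ulim U (fun N => nonlin_psum d That (X N u) k N) L ->
  Cmod (Cplus (Cminus (limit_flow t' k) (limit_flow t k)) (Cmult (RtoC (t' - t)) L))
  <= Lk k * (t' - t) ^ 2.
Proof.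
intros ht htt hT hu hk hL; assert (hLk := taylor_const_ge0 k).
apply (ulim_le U U_and U_imp U_nonempty (fun N => Cplus (Cminus (X N t' k) (X N t k))
  (Cmult (RtoC (t' - t)) (nonlin_psum d That (X N u) k N)))).
  apply ulim_plus; auto; [apply ulim_minus; auto; apply limit_flow_spec; auto; lra|].
  apply ulim_mult; auto; apply ulim_const; auto.
intros eps he; destruct (cube_exists d k hk) as [N0 hN0].
(* h N c bounds the mesh errors: q h replaces t' - t once inside the square, where h <= 1 is used,
   and once in front of the nonlinearity, which is bounded by B. *)
set (c := Lk k * (2 * (t' - t) + 1) + Rabs B).
assert (hc : 0 <= c) by (apply Rplus_le_le_0_compat; [apply Rmult_le_pos; lra | apply Rabs_pos]).
destruct (INR_unbounded (c / eps)) as [N1 hN1].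
eapply U_imp; [|exact (U_event (Nat.max N0 N1))]; cbv beta; intros N hN.
assert (hh := mesh_pos N); assert (hh1 := mesh_le1 N).
assert (hhc : h N * c <= eps).
  assert (h1 := mesh_small N); assert (h2 : INR N1 <= INR N) by (apply le_INR; lia).
  assert (h3 : c <= eps * INR N).
    apply (Rmult_le_reg_r (/ eps)); [now apply Rinv_0_lt_compat|].
    replace (eps * INR N * / eps) with (INR N) by (field; lra); unfold Rdiv in hN1; lra.
  assert (h N * c <= h N * (eps * INR N)) by (apply Rmult_le_compat_l; lra).
  assert (0 <= h N * eps) by (apply Rmult_le_pos; lra); nra.
assert (hi := time_index_mono (h N) t t' hh ht htt).
set (q := (time_index (h N) t' - time_index (h N) t)%nat).
assert (hq : time_index (h N) t' = (time_index (h N) t + q)%nat) by (unfold q; lia).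
assert (s1 := time_index_spec (h N) t hh ht); assert (s2 := time_index_spec (h N) t' hh ltac:(lra)).
rewrite hq, plus_INR in s2.
assert (hqh : Rabs (t' - t - INR q * h N) <= h N) by (apply Rabs_le; lra).
assert (hqh2 : 0 <= INR q * h N <= t' - t + h N)
  by (split; [apply Rmult_le_pos; [apply pos_INR | lra] | lra]).
assert (hdec : forall n, (n <= time_index (h N) t')%nat -> decay d p A (euler d That N (h N) th0 n))
  by (intros n hn; apply (euler_le_decay N t'); auto; lra).
set (r := time_index (h N) u).
assert (hr : (time_index (h N) t <= r <= time_index (h N) t + q)%nat)
  by (unfold r; destruct hu; subst u; lia).
assert (hk' : In k (cube d N)) by (apply (cube_mono d N0); auto; lia).
assert (tay := euler_taylor d That C0 a ha hC0 hdiv heven hsym N (h N) A th0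
  (time_index (h N) t') (Rlt_le _ _ hh) hreal hdec (time_index (h N) t) q r k ltac:(lia) hr hk').
assert (hF := euler_nonlin_bound d That C0 a ha hC0 hdiv heven hsym N (h N) A th0
  (time_index (h N) t') hreal hdec r k ltac:(lia) hk).
rewrite <- hq in tay; fold (X N t) (X N t') in tay; fold r; unfold r in tay, hF.
fold (X N u) in tay, hF; fold B in tay, hF; fold (Lk k) in tay.
set (F := nonlin_psum d That (X N u) k N) in *.
replace (Cplus (Cminus (X N t' k) (X N t k)) (Cmult (RtoC (t' - t)) F)) with
  (Cplus (Cplus (Cminus (X N t' k) (X N t k)) (Cmult (RtoC (INR q * h N)) F))
    (Cmult (RtoC (t' - t - INR q * h N)) F)).
  eapply Rle_trans; [apply Cmod_triangle|]; rewrite (Cmod_mult (RtoC _) F), Cmod_R.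
  assert (e1 : Rabs (t' - t - INR q * h N) * Cmod F <= h N * Rabs B).
    apply Rmult_le_compat; auto using Rabs_pos, Cmod_ge_0.
    eapply Rle_trans; [exact hF | apply Rle_abs].
  assert (e2 : Lk k * (INR q * h N) ^ 2 <= Lk k * (t' - t + h N) ^ 2).
    apply Rmult_le_compat_l; auto; apply pow_incr; auto.
  assert (e3 : Lk k * (t' - t + h N) ^ 2 <= Lk k * ((t' - t) ^ 2 + h N * (2 * (t' - t) + 1))).
    apply Rmult_le_compat_l; auto; nra.
  unfold c in hhc; nra.
rewrite (RtoC_minus (t' - t)); ring.
Qed.

Lemma limit_solution k : length k = d ->
  filterlim (fun t => limit_flow t k) (at_right 0) (locally (th0 k)) /\
  forall t, 0 < t < T -> exists L,
    filterlim (nonlin_psum d That (limit_flow t) k) eventually (locally L) /\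
    is_derive (fun t' => limit_flow t' k) t (Copp L).
Proof.
intros hk; assert (hT := lifespan_pos); assert (hLk := taylor_const_ge0 k); split.
- destruct (limit_nonlin 0 k ltac:(lra) hk) as (L & _ & hL).
  apply filterlim_C; [apply at_right_proper_filter|]; intros eps he.
  set (c := Lk k * T + Cmod L + 1).
  assert (hc : 0 < c) by (unfold c; generalize (Cmod_ge_0 L) (Rmult_le_pos _ _ hLk (Rlt_le _ _ hT)); lra).
  assert (hd : 0 < Rmin T (eps / c)) by (apply Rmin_glb_lt; auto; now apply Rdiv_lt_0_compat).
  exists (mkposreal _ hd); intros t hb ht.
  change (Rabs (t - 0) < Rmin T (eps / c)) in hb; rewrite Rminus_0_r, Rabs_pos_eq in hb by lra.
  assert (h1 : t < T) by (eapply Rlt_le_trans; [exact hb | apply Rmin_l]).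
  assert (h2 : t < eps / c) by (eapply Rlt_le_trans; [exact hb | apply Rmin_r]).
  assert (h3 : t * c < eps).
    replace eps with (eps / c * c) by (field; lra); now apply Rmult_lt_compat_r.
  assert (h4 := limit_taylor 0 t 0 k L ltac:(lra) ltac:(lra) ltac:(lra) ltac:(auto) hk hL).
  rewrite limit_flow_0, Rminus_0_r in h4 by auto.
  replace (Cminus (limit_flow t k) (th0 k)) with
    (Cplus (Cplus (Cminus (limit_flow t k) (th0 k)) (Cmult (RtoC t) L)) (Copp (Cmult (RtoC t) L)))
    by ring.
  eapply Rle_lt_trans; [apply Cmod_triangle|].
  rewrite Cmod_opp, (Cmod_mult (RtoC t)), Cmod_R, (Rabs_pos_eq t) by lra.
  assert (Lk k * t ^ 2 <= t * (Lk k * T)) by (assert (Lk k * t <= Lk k * T) by nra; nra).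
  unfold c in h3; nra.
- intros t ht; destruct (limit_nonlin t k ltac:(lra) hk) as (L & hL & hU); exists L; split; auto.
  apply is_derive_C; intros eps he.
  exists (Rmin (Rmin t (T - t)) (eps / (Lk k + 1))); split.
    apply Rmin_glb_lt; [apply Rmin_glb_lt; lra | apply Rdiv_lt_0_compat; lra].
  intros t' ht'.
  assert (h1 : Rabs (t' - t) < t)
    by (eapply Rlt_le_trans; [exact ht'|]; eapply Rle_trans; [apply Rmin_l | apply Rmin_l]).
  assert (h2 : Rabs (t' - t) < T - t)
    by (eapply Rlt_le_trans; [exact ht'|]; eapply Rle_trans; [apply Rmin_l | apply Rmin_r]).
  assert (h3 : Lk k * Rabs (t' - t) <= eps).
    assert (Rabs (t' - t) * (Lk k + 1) <= eps); [|generalize (Rabs_pos (t' - t)); nra].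
    replace eps with (eps / (Lk k + 1) * (Lk k + 1)) by (field; lra).
    apply Rmult_le_compat_r; [lra|]; left; eapply Rlt_le_trans; [exact ht' | apply Rmin_r].
  apply Rabs_def2 in h1; apply Rabs_def2 in h2.
  assert (key : Cmod (Cminus (Cminus (limit_flow t' k) (limit_flow t k))
    (Cmult (RtoC (t' - t)) (Copp L))) <= Lk k * (t' - t) ^ 2).
    (* The nonlinearity is always taken at t: the left endpoint for a forward increment, the right
       one for a backward increment. *)
    destruct (Rle_dec t t') as [c|c].
    + eapply Rle_trans; [|apply (limit_taylor t t' t k L); auto; lra]; right; f_equal; ring.
    + rewrite <- Cmod_opp.
      replace ((t' - t) ^ 2) with ((t - t') ^ 2) by ring.
      eapply Rle_trans; [|apply (limit_taylor t' t t k L); auto; lra]; right; f_equal.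
      rewrite !RtoC_minus; ring.
  eapply Rle_trans; [exact key|]; rewrite <- (pow2_abs (t' - t)); simpl; rewrite Rmult_1_r.
  rewrite <- Rmult_assoc; apply Rmult_le_compat_r; auto using Rabs_pos.
Qed.

End Existence.

(** * Uniqueness *)

(** Nothing is known of the derivative at ta itself, so the mean value theorem starts from a point x
    slightly to the right of ta at which f is at most eps. *)
Lemma right_growth_bound (f : R -> R) c ta tb : ta < tb -> 0 <= c ->
  (forall t, ta < t <= tb -> exists l, is_derive f t l /\ l <= c) ->
  (forall eps, 0 < eps -> at_right ta (fun x => f x <= eps)) ->
  f tb <= c * (tb - ta).
Proof.
intros ht hc hd h0; apply le_epsilon; intros eps he.
destruct (h0 eps he) as [del hdel]; set (x := ta + Rmin (del / 2) ((tb - ta) / 2)).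
assert (hm1 := Rmin_l (del / 2) ((tb - ta) / 2)); assert (hm2 := Rmin_r (del / 2) ((tb - ta) / 2)).
assert (hm0 : 0 < Rmin (del / 2) ((tb - ta) / 2))
  by (apply Rmin_glb_lt; [generalize (cond_pos del); lra | lra]).
assert (hx : ta < x < tb) by (unfold x; lra).
assert (hfx : f x <= eps).
  apply hdel; [|lra]; change (Rabs (x - ta) < del); rewrite Rabs_pos_eq by lra.
  unfold x; generalize (cond_pos del); lra.
assert (hD : forall t, x <= t <= tb -> is_derive f t (Derive f t) /\ Derive f t <= c).
  intros t htt; destruct (hd t ltac:(lra)) as (l & hl & hlc).
  rewrite (is_derive_unique _ _ _ hl); auto.
destruct (MVT_gen f x tb (Derive f)) as (y & hy & E).
- intros t htt; rewrite Rmin_left, Rmax_right in htt by lra; apply hD; lra.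
- intros t htt; rewrite Rmin_left, Rmax_right in htt by lra.
  apply derivable_continuous_pt; eexists; apply is_derive_Reals, hD; lra.
- rewrite Rmin_left, Rmax_right in hy by lra; destruct (hD y ltac:(lra)) as [_ hyc].
  assert (Derive f y * (tb - x) <= c * (tb - x)) by (apply Rmult_le_compat_r; lra).
  assert (c * (tb - x) <= c * (tb - ta)) by (apply Rmult_le_compat_l; lra).
  lra.
Qed.

Lemma is_derive_Rsum {A} (f : A -> R -> R) (df : A -> R) t l :
  (forall x, In x l -> is_derive (f x) t (df x)) ->
  is_derive (fun s => Rsum_list (fun x => f x s) l) t (Rsum_list df l).
Proof.
induction l as [|x l IH]; intros H; [apply (is_derive_const (0 : R))|].
apply (is_derive_plus (f x) (fun s => Rsum_list (fun y => f y s) l)).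
- apply H; now left.
- apply IH; intros; apply H; now right.
Qed.

Lemma filter_Rsum_small {T A} (F : (T -> Prop) -> Prop) {FF : Filter F} (f : A -> T -> R) l :
  (forall x, In x l -> forall eps, 0 < eps -> F (fun s => f x s <= eps)) ->
  forall eps, 0 < eps -> F (fun s => Rsum_list (fun x => f x s) l <= eps).
Proof.
induction l as [|x l IH]; intros H eps he.
  apply filter_forall; intros s; unfold Rsum_list; simpl; lra.
assert (h1 := H x (or_introl eq_refl) (eps / 2) ltac:(lra)).
assert (h2 := IH (fun y hy => H y (or_intror hy)) (eps / 2) ltac:(lra)).
generalize (filter_and _ _ h1 h2); apply filter_imp; intros s [h3 h4].
unfold Rsum_list in *; simpl; lra.
Qed.

Section Uniqueness.
Variables (d : nat) (That : list Z -> nat -> R) (C0 a S0 : R).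
Hypothesis ha : 0 < a <= 1.
Hypothesis hC0 : 0 < C0.
Hypothesis hS0 : 0 < S0.
Hypothesis hdiv : forall k, length k = d -> vdotZ d (That k) k = 0.
Hypothesis heven : forall k, length k = d -> forall i, (i < d)%nat ->
  That (zneg d k) i = That k i.
Hypothesis hsym : forall j l, length j = d -> length l = d -> zis0 j = false ->
  Rabs (vdotZ d (That j) l) <= C0 * Rpower (bn j) a * bn l.

Let p := (4 * d + 5)%nat.
Let tm := nl_term d That.
Let g (k : list Z) := Rpower (bn k) a.
Let M (sg : R) (k : list Z) := mw a p sg (bn k).
Let K := 3 ^ p + 4 * (INR p + S0) * 2 ^ p.

(** The weight is squared because the truncation error of the nonlinearity is small only coefficient
    by coefficient, with a factor |k|: in the energy it meets m(k)^2 |w^(k)| |k|, which must be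
    summable by itself. *)
Definition strong_decay (A : R) (th : list Z -> C) : Prop :=
  real_meanfree d th /\
  forall z, length z = d -> M S0 z ^ 2 * Cmod (th z) * bn z ^ (2 * d + 3) <= A.

Lemma strong_decay_nonneg A th : strong_decay A th -> 0 <= A.
Proof.
intros [_ H]; eapply Rle_trans; [|exact (H (zzero d) (zzero_length d))].
apply Rmult_le_pos; [apply Rmult_le_pos; [apply pow2_ge_0 | apply Cmod_ge_0]|].
generalize (bn_pow_ge1 (zzero d) (2 * d + 3)); lra.
Qed.

Lemma strong_decay_weighted A th q sg z : strong_decay A th -> (q <= 2 * d + 3)%nat ->
  0 <= sg <= S0 -> length z = d -> M sg z * Cmod (th z) * bn z ^ q <= A.
Proof.
intros [_ H] hq hs hz; eapply Rle_trans; [|exact (H z hz)].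
assert (h1 : M sg z <= M S0 z) by (apply weight_mono; lra).
assert (h2 : 1 <= M S0 z) by (apply weight_ge1; lra).
assert (h3 : 0 < M sg z) by exact (weight_pos a p sg z).
assert (hc := Cmod_ge_0 (th z)); assert (hb := bn_pow_mono z q _ hq).
assert (hb1 := bn_pow_ge1 z q).
apply Rmult_le_compat; try lra; [apply Rmult_le_pos; lra|].
apply Rmult_le_compat_r; auto; nra.
Qed.

Lemma strong_decay_decay A th q : strong_decay A th -> (q <= 2 * d + 3)%nat -> decay d q A th.
Proof.
intros H hq z hz; eapply Rle_trans;
  [|apply (strong_decay_weighted A th q 0 z H hq ltac:(lra) hz)].
assert (h2 : 1 <= M 0 z) by (apply weight_ge1; lra).
assert (hc := Cmod_ge_0 (th z)); assert (hb1 := bn_pow_ge1 z q).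
apply Rmult_le_compat_r; [lra | nra].
Qed.

Lemma strong_decay_sub A th1 th2 : strong_decay A th1 -> strong_decay A th2 ->
  strong_decay (2 * A) (fun k => Cminus (th1 k) (th2 k)).
Proof.
intros [[z1 r1] H1] [[z2 r2] H2]; split; [split|].
- rewrite z1, z2; ring.
- intros k hk; rewrite r1, r2, Cconj_minus; auto.
- intros z hz; specialize (H1 z hz); specialize (H2 z hz).
  assert (hc : Cmod (Cminus (th1 z) (th2 z)) <= Cmod (th1 z) + Cmod (th2 z)).
    eapply Rle_trans; [apply Cmod_triangle|]; rewrite Cmod_opp; lra.
  assert (hb := bn_pow_ge1 z (2 * d + 3)); assert (hM := pow2_ge_0 (M S0 z)).
  apply Rle_trans with (M S0 z ^ 2 * (Cmod (th1 z) + Cmod (th2 z)) * bn z ^ (2 * d + 3)); [|nra].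
  apply Rmult_le_compat_r; [lra|]; now apply Rmult_le_compat_l.
Qed.

(* u1.grad th1 - u2.grad th2 = u1.grad w + (T w).grad th2 with w = th1 - th2; the first sum is
   truncated in the frequency of w, the second in that of T w. *)
Lemma nonlin_difference_limit eps : 0 < eps -> exists N0, forall A th1 th2 k L1 L2 N,
  (N0 <= N)%nat -> length k = d -> strong_decay A th1 -> strong_decay A th2 ->
  filterlim (nonlin_psum d That th1 k) eventually (locally L1) ->
  filterlim (nonlin_psum d That th2 k) eventually (locally L2) ->
  let w := fun k => Cminus (th1 k) (th2 k) in
  Cmod (Cminus (Cminus L1 L2)
    (Cplus (Csum_list (fun l => tm th1 w k (zsub d k l)) (cube d N))
           (Csum_list (tm w th2 k) (cube d N)))) <= 4 * C0 * A ^ 2 * bn k * eps.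
Proof.
intros he; destruct (Csum_dominated_close d eps he) as [N0 hN0]; exists N0.
intros A th1 th2 k L1 L2 N hN hk hs1 hs2 hL1 hL2 w.
assert (hsw := strong_decay_sub A th1 th2 hs1 hs2); fold w in hsw.
assert (hA := strong_decay_nonneg A th1 hs1); assert (hb := bn_ge1 k).
set (D := 2 * C0 * A ^ 2 * bn k).
assert (hD : 0 <= D) by (unfold D; repeat apply Rmult_le_pos; try lra; apply pow2_ge_0).
apply le_epsilon; intros eta heta.
assert (hl1 := proj1 (filterlim_C _ _ _) hL1); assert (hl2 := proj1 (filterlim_C _ _ _) hL2).
destruct (hl1 (eta / 2) ltac:(lra)) as [n1 hn1]; destruct (hl2 (eta / 2) ltac:(lra)) as [n2 hn2].
(* The partial sums run over j in a cube, the truncated first sum over l = k - j in a cube; n must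
   be large enough for the reflected cube to contain the small one. *)
destruct (list_in_cube d (map (zsub d k) (cube d N))) as [n3 hn3].
  intros z hz; apply in_map_iff in hz as (y & <- & _); apply zsub_length.
set (n := Nat.max (Nat.max n1 n2) (Nat.max n3 N)).
specialize (hn1 n ltac:(unfold n; lia)); specialize (hn2 n ltac:(unfold n; lia)).
set (P1 := Csum_list (tm th1 w k) (cube d n)); set (P2 := Csum_list (tm w th2 k) (cube d n)).
assert (hsplit : Cminus (nonlin_psum d That th1 k n) (nonlin_psum d That th2 k n) = Cplus P1 P2).
  unfold P1, P2; rewrite <- Csum_plus; unfold nonlin_psum; rewrite <- Csum_minus.
  apply Csum_ext; intros j _; unfold tm, nl_term, w; ring.
assert (e2 : Cmod (Cminus P2 (Csum_list (tm w th2 k) (cube d N))) <= D * eps).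
  apply (hN0 D); [exact hD | | apply NoDup_cube | apply NoDup_cube | apply cube_length
    | apply cube_length | |].
  - intros j hj; unfold D; replace (2 * C0 * A ^ 2 * bn k) with (C0 * (2 * A) * A * bn k) by ring.
    apply (nl_term_rho d That C0 a ha hC0 hdiv hsym); auto; [apply hsw | |].
    + apply strong_decay_decay; auto; lia.
    + apply strong_decay_decay; auto; lia.
  - intros j hj; apply (cube_mono d N0); auto; unfold n; lia.
  - intros j hj; apply (cube_mono d N0); auto.
assert (hP1 : P1 = Csum_list (fun l => tm th1 w k (zsub d k l)) (map (zsub d k) (cube d n))).
  rewrite Csum_map; apply Csum_ext; intros j hj; rewrite zsub_zsub; auto.
  now apply cube_length in hj.
assert (e1 : Cmod (Cminus P1 (Csum_list (fun l => tm th1 w k (zsub d k l)) (cube d N))) <= D * eps).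
  rewrite hP1; apply (hN0 D); [exact hD | | | apply NoDup_cube | | apply cube_length | |].
  - intros l hl; unfold D; replace (2 * C0 * A ^ 2 * bn k) with (C0 * A * (2 * A) * bn k) by ring.
    rewrite <- (zsub_zsub d k l) at 2 by auto.
    apply (nl_term_rho_swap d That C0 a ha hC0 hdiv hsym); auto using zsub_length; [apply hs1 | |].
    + apply strong_decay_decay; auto; lia.
    + apply strong_decay_decay; auto; lia.
  - apply NoDup_map_inj; [apply NoDup_cube|]; intros x y hx hy.
    apply cube_length in hx, hy; apply zsub_inj_r; auto.
  - intros z hz; apply in_map_iff in hz as (y & <- & _); apply zsub_length.
  - intros l hl; assert (hld := cube_length _ _ _ hl).
    rewrite <- (zsub_zsub d k l) by auto; apply in_map, (cube_mono d n3); [unfold n; lia|].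
    apply hn3, in_map, (cube_mono d N0); auto.
  - intros j hj; apply (cube_mono d N0); auto.
set (Q1 := Csum_list (fun l => tm th1 w k (zsub d k l)) (cube d N)) in *.
set (Q2 := Csum_list (tm w th2 k) (cube d N)) in *.
replace (Cminus (Cminus L1 L2) (Cplus Q1 Q2)) with
  (Cplus (Cplus (Cminus P1 Q1) (Cminus P2 Q2))
    (Cplus (Copp (Cminus (nonlin_psum d That th1 k n) L1))
           (Cminus (nonlin_psum d That th2 k n) L2))).
  eapply Rle_trans; [apply Cmod_triangle|].
  assert (t1 := Cmod_triangle (Cminus P1 Q1) (Cminus P2 Q2)).
  assert (t2 := Cmod_triangle (Copp (Cminus (nonlin_psum d That th1 k n) L1))
    (Cminus (nonlin_psum d That th2 k n) L2)).
  rewrite Cmod_opp in t2; unfold D in e1, e2; lra.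
replace P1 with (Cminus (Cminus (nonlin_psum d That th1 k n) (nonlin_psum d That th2 k n)) P2)
  by (rewrite hsplit; ring).
ring.
Qed.

(** The left-hand side is the time derivative of the energy of w on a cube when the radius shrinks
    at speed lam. Damping absorbs both the transport of w and the transport by T w; what is left is
    the tail outside the cube. N0 precedes the radius and the solutions, so one cube works at all
    times. *)
Lemma difference_energy_rate eps A lam : 0 < eps -> 0 <= lam ->
  4 * C0 * K * 10 ^ d * A + 2 * C0 * 2 ^ p * 10 ^ d * A <= lam ->
  exists N0, forall sg th1 th2 (L1 L2 : list Z -> C) N,
  (N0 <= N)%nat -> 0 <= sg <= S0 -> strong_decay A th1 -> strong_decay A th2 ->
  (forall k, length k = d -> filterlim (nonlin_psum d That th1 k) eventually (locally (L1 k))) ->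
  (forall k, length k = d -> filterlim (nonlin_psum d That th2 k) eventually (locally (L2 k))) ->
  let w := fun k => Cminus (th1 k) (th2 k) in
  Rsum_list (fun k => M sg k ^ 2 * (- 2 * lam * g k * Cmod (w k) ^ 2
    + 2 * Re (Cmult (Cconj (w k)) (Copp (Cminus (L1 k) (L2 k)))))) (cube d N) <= eps.
Proof.
intros he hlam0 hlam.
assert (h10 : 0 < 10 ^ d) by (apply pow_lt; lra).
(* Twice the summed tail error is at most 16 C0 A^3 10^d times eps / c, hence at most eps. The sign
   of A is only known once a function with this decay is given, hence [Rabs A]. *)
set (c := 16 * C0 * (Rabs A) ^ 3 * 10 ^ d + 1).
assert (hc : 0 < c).
  assert (0 <= Rabs A ^ 3) by (apply pow_le, Rabs_pos).
  apply Rplus_le_lt_0_compat; [|lra]; apply Rmult_le_pos; [apply Rmult_le_pos|]; lra.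
assert (hec : 0 < eps / c) by now apply Rdiv_lt_0_compat.
destruct (nonlin_difference_limit _ hec) as [N0 hN0]; exists N0.
intros sg th1 th2 L1 L2 N hN hs hs1 hs2 hL1 hL2 w; set (L := cube d N).
assert (hA := strong_decay_nonneg A th1 hs1).
assert (hsw := strong_decay_sub A th1 th2 hs1 hs2); fold w in hsw.
set (G := Rsum_list (gnorm a p sg w) L).
assert (hG : 0 <= G) by (apply Rsum_nonneg; intros; now apply gnorm_nonneg).
set (Q1 := fun k => Csum_list (fun l => tm th1 w k (zsub d k l)) L).
set (Q2 := fun k => Csum_list (tm w th2 k) L).
assert (T1 : Rabs (Rsum_list (fun k => M sg k ^ 2 * Re (Cmult (Cconj (w k)) (Q1 k))) L)
  <= 4 * C0 * K * 10 ^ d * A * G).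
  rewrite (Rsum_ext _ (fun k => Rsum_list (fun l => mw a p sg (bn k) ^ 2 *
    Re (Cmult (Cconj (w k)) (tm th1 w k (zsub d k l)))) L)).
  - apply (transport_energy_smooth d That C0 a S0 p ha hC0 hdiv heven hsym ltac:(unfold p; lia)
      th1 w sg A L hs (NoDup_cube d N) (cube_length d N) (proj1 hs1)).
    intros z hz; apply (strong_decay_weighted A th1); auto; lia.
  - intros k hk; rewrite Rsum_scal; fold (M sg k); f_equal; unfold Q1.
    rewrite <- Csum_scal, Re_Csum; reflexivity.
assert (T2 : Rabs (Rsum_list (fun k => M sg k ^ 2 * Re (Cmult (Cconj (w k)) (Q2 k))) L)
  <= 2 * C0 * 2 ^ p * 10 ^ d * A * G).
  rewrite (Rsum_ext _ (fun k => Rsum_list (fun l => mw a p sg (bn k) ^ 2 *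
    Re (Cmult (Cconj (w k)) (tm w th2 k l))) L)).
  - apply (stretching_energy d That C0 a S0 p ha hC0 hsym w th2 sg A L hs (NoDup_cube d N)
      (cube_length d N) (proj1 (proj1 hsw))).
    intros z hz; apply (strong_decay_weighted A th2); auto; lia.
  - intros k hk; rewrite Rsum_scal; fold (M sg k); f_equal; unfold Q2.
    rewrite <- Csum_scal, Re_Csum; reflexivity.
assert (T3 : Rsum_list (fun k => M sg k ^ 2 * (Cmod (w k) * (4 * C0 * A ^ 2 * bn k * (eps / c)))) L
  <= eps / 2).
  apply Rle_trans with (Rsum_list (fun k => (8 * C0 * A ^ 3 * (eps / c)) * rho k) L).
  - apply Rsum_le; intros k hk; assert (hkd := cube_length _ _ _ hk).
    assert (h1 := proj2 hsw k hkd).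
    assert (hM : M sg k ^ 2 <= M S0 k ^ 2).
      apply pow_incr; split; [left; apply weight_pos | apply weight_mono; lra].
    assert (hb := bn_ge1 k); assert (hw := Cmod_ge_0 (w k)).
    assert (h2 : M S0 k ^ 2 * Cmod (w k) * bn k <= 2 * A * rho k).
      assert (hp2 := bn_pow_ge1 k (2 * d)); assert (hr := rho_ge_bn d k hkd).
      apply Rle_trans with (2 * A * / bn k ^ (2 * d)); [|apply Rmult_le_compat_l; lra].
      apply (Rmult_le_reg_r (bn k ^ (2 * d))); [lra|].
      replace (2 * A * / bn k ^ (2 * d) * bn k ^ (2 * d)) with (2 * A) by (field; lra).
      eapply Rle_trans; [|exact h1]; rewrite !Rmult_assoc.
      apply Rmult_le_compat_l; [apply pow2_ge_0|]; apply Rmult_le_compat_l; auto.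
      rewrite tech_pow_Rmult; apply bn_pow_mono; lia.
    replace (M sg k ^ 2 * (Cmod (w k) * (4 * C0 * A ^ 2 * bn k * (eps / c)))) with
      ((4 * C0 * A ^ 2 * (eps / c)) * (M sg k ^ 2 * Cmod (w k) * bn k)) by ring.
    replace (8 * C0 * A ^ 3 * (eps / c) * rho k) with
      ((4 * C0 * A ^ 2 * (eps / c)) * (2 * A * rho k)) by ring.
    apply Rmult_le_compat_l.
      assert (hA2 := pow2_ge_0 A); apply Rmult_le_pos; [apply Rmult_le_pos|]; lra.
    eapply Rle_trans; [|exact h2]; apply Rmult_le_compat_r; [lra|].
    now apply Rmult_le_compat_r.
  - rewrite Rsum_scal.
    assert (hR : Rsum_list rho L <= 10 ^ d) by (apply rho_sum_bound; [apply NoDup_cube | apply cube_length]).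
    assert (hA3 : 0 <= A ^ 3) by (apply pow_le; auto).
    assert (hk0 : 0 <= 8 * C0 * A ^ 3 * (eps / c))
      by (apply Rmult_le_pos; [apply Rmult_le_pos|]; lra).
    apply Rle_trans with (8 * C0 * A ^ 3 * (eps / c) * 10 ^ d); [now apply Rmult_le_compat_l|].
    rewrite <- (Rabs_pos_eq A hA) at 1.
    apply (Rmult_le_reg_r c); auto.
    replace (8 * C0 * Rabs A ^ 3 * (eps / c) * 10 ^ d * c) with
      (8 * C0 * Rabs A ^ 3 * 10 ^ d * eps) by (field; lra).
    unfold c; nra.
apply Rle_trans with (Rsum_list (fun k => (- 2 * lam) * gnorm a p sg w k
  + (- 2) * (M sg k ^ 2 * Re (Cmult (Cconj (w k)) (Q1 k)))
  + (- 2) * (M sg k ^ 2 * Re (Cmult (Cconj (w k)) (Q2 k)))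
  + 2 * (M sg k ^ 2 * (Cmod (w k) * (4 * C0 * A ^ 2 * bn k * (eps / c))))) L).
- apply Rsum_le; intros k hk; assert (hkd := cube_length _ _ _ hk).
  assert (h1 := hN0 A th1 th2 k (L1 k) (L2 k) N hN hkd hs1 hs2 (hL1 k hkd) (hL2 k hkd)).
  simpl in h1; fold w in h1; fold L in h1; fold (Q1 k) (Q2 k) in h1.
  set (E := Cminus (Cminus (L1 k) (L2 k)) (Cplus (Q1 k) (Q2 k))) in *.
  replace (Copp (Cminus (L1 k) (L2 k))) with (Copp (Cplus (Cplus (Q1 k) (Q2 k)) E))
    by (unfold E; ring).
  assert (hE : - Re (Cmult (Cconj (w k)) E) <= Cmod (w k) * (4 * C0 * A ^ 2 * bn k * (eps / c))).
    eapply Rle_trans; [apply Rle_abs|]; rewrite Rabs_Ropp.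
    eapply Rle_trans; [apply Re_le_Cmod|]; rewrite Cmod_mult, Cmod_conj.
    apply Rmult_le_compat_l; [apply Cmod_ge_0|]; replace (A ^ 2) with (A * (A * 1)) by ring; exact h1.
  replace (Re (Cmult (Cconj (w k)) (Copp (Cplus (Cplus (Q1 k) (Q2 k)) E)))) with
    (- Re (Cmult (Cconj (w k)) (Q1 k)) - Re (Cmult (Cconj (w k)) (Q2 k))
     + - Re (Cmult (Cconj (w k)) E)).
    assert (hM2 := pow2_ge_0 (M sg k)).
    assert (h2 := Rmult_le_compat_l _ _ _ hM2 hE).
    unfold gnorm; fold (M sg k) (g k); rewrite Rpow_mult_distr; nra.
  destruct (w k), (Q1 k), (Q2 k), E; unfold Cmult, Cconj, Copp, Cplus, Re; simpl; ring.
- rewrite !Rsum_plus, !Rsum_scal; fold G.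
  apply Rabs_le_between in T1; apply Rabs_le_between in T2.
  assert ((4 * C0 * K * 10 ^ d * A + 2 * C0 * 2 ^ p * 10 ^ d * A) * G <= lam * G)
    by (now apply Rmult_le_compat_r).
  lra.
Qed.

(** The energy of the difference on a large cube starts from 0 and grows at rate at most eps, and it
    dominates the coefficient under consideration; eps is arbitrary. The interval is so short that
    the radius, starting from S0, stays nonnegative. *)
Lemma unique_on_short_interval A lam ta tb (th1 th2 : R -> list Z -> C) : 0 < lam ->
  4 * C0 * K * 10 ^ d * A + 2 * C0 * 2 ^ p * 10 ^ d * A <= lam ->
  ta < tb -> lam * (tb - ta) <= S0 ->
  (forall t, ta < t <= tb -> strong_decay A (th1 t) /\ strong_decay A (th2 t)) ->
  (forall k, length k = d -> th1 ta k = th2 ta k) ->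
  (forall k, length k = d -> filterlim (fun t => th1 t k) (at_right ta) (locally (th1 ta k))) ->
  (forall k, length k = d -> filterlim (fun t => th2 t k) (at_right ta) (locally (th2 ta k))) ->
  (forall k, length k = d -> forall t, ta < t <= tb -> exists L,
     filterlim (nonlin_psum d That (th1 t) k) eventually (locally L) /\
     is_derive (fun t' => th1 t' k) t (Copp L)) ->
  (forall k, length k = d -> forall t, ta < t <= tb -> exists L,
     filterlim (nonlin_psum d That (th2 t) k) eventually (locally L) /\
     is_derive (fun t' => th2 t' k) t (Copp L)) ->
  forall k, length k = d -> th1 tb k = th2 tb k.
Proof.
intros hlam0 hlam htt hS hdec hinit hc1 hc2 hd1 hd2 k0 hk0.
set (sg := fun t => S0 - lam * (t - ta)).
set (w := fun t k => Cminus (th1 t k) (th2 t k)).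
set (e := fun k t => M (sg t) k ^ 2 * (Re (w t k) ^ 2 + Im (w t k) ^ 2)).
assert (hsg : forall t, ta < t <= tb -> 0 <= sg t <= S0) by (intros t ht; unfold sg; split; nra).
assert (small : forall eps, 0 < eps -> Cmod (w tb k0) ^ 2 <= eps * (tb - ta)).
  intros eps he.
  destruct (difference_energy_rate eps A lam he (Rlt_le _ _ hlam0) hlam) as [N0 hN0].
  destruct (cube_exists d k0 hk0) as [N1 hN1].
  set (N := Nat.max N0 N1); set (L := cube d N).
  apply Rle_trans with (Rsum_list (fun k => e k tb) L).
    apply Rle_trans with (e k0 tb).
    - unfold e; rewrite <- Cmod_sqr.
      assert (1 <= M (sg tb) k0) by (apply weight_ge1; apply hsg; lra).
      assert (1 <= M (sg tb) k0 ^ 2) by nra; generalize (pow2_ge_0 (Cmod (w tb k0))); nra.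
    - apply (Rsum_term (fun k => e k tb)).
        intros y _; unfold e; apply Rmult_le_pos; [apply pow2_ge_0|]; nra.
      apply (cube_mono d N1); auto; unfold N; lia.
  apply (right_growth_bound (fun t => Rsum_list (fun k => e k t) L)); auto; [lra | |].
  - intros t ht.
    set (l1 := fun k => epsilon (inhabits (RtoC 0)) (fun L =>
      filterlim (nonlin_psum d That (th1 t) k) eventually (locally L) /\
      is_derive (fun t' => th1 t' k) t (Copp L))).
    set (l2 := fun k => epsilon (inhabits (RtoC 0)) (fun L =>
      filterlim (nonlin_psum d That (th2 t) k) eventually (locally L) /\
      is_derive (fun t' => th2 t' k) t (Copp L))).
    assert (H1 : forall k, length k = d ->
      filterlim (nonlin_psum d That (th1 t) k) eventually (locally (l1 k)) /\
      is_derive (fun t' => th1 t' k) t (Copp (l1 k)))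
      by (intros k hk; unfold l1; apply epsilon_spec; auto).
    assert (H2 : forall k, length k = d ->
      filterlim (nonlin_psum d That (th2 t) k) eventually (locally (l2 k)) /\
      is_derive (fun t' => th2 t' k) t (Copp (l2 k)))
      by (intros k hk; unfold l2; apply epsilon_spec; auto).
    exists (Rsum_list (fun k => M (sg t) k ^ 2 * (- 2 * lam * g k * Cmod (w t k) ^ 2
      + 2 * Re (Cmult (Cconj (w t k)) (Copp (Cminus (l1 k) (l2 k)))))) L); split.
    + apply is_derive_Rsum; intros k hk; assert (hkd := cube_length _ _ _ hk).
      destruct (is_derive_C_parts _ _ _ (proj2 (H1 k hkd))) as [d1r d1i].
      destruct (is_derive_C_parts _ _ _ (proj2 (H2 k hkd))) as [d2r d2i].
      assert (dM : is_derive (fun s => M (sg s) k ^ 2) t (- 2 * lam * g k * M (sg t) k ^ 2)).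
        apply (is_derive_ext (fun s => (bn k ^ p * exp (sg s * g k)) ^ 2)).
          intros s; unfold M; rewrite mwE; reflexivity.
        unfold M; rewrite mwE; fold (g k); unfold sg; auto_derive; auto.
        replace (S0 + - (lam * (t + - ta))) with (S0 - lam * (t - ta)) by ring; ring.
      assert (dw : is_derive (fun s => Re (w s k) ^ 2 + Im (w s k) ^ 2) t
        (2 * Re (Cmult (Cconj (w t k)) (Copp (Cminus (l1 k) (l2 k)))))).
        assert (dr : is_derive (fun s => Re (w s k)) t (Re (Copp (l1 k)) - Re (Copp (l2 k)))).
          apply (is_derive_minus (fun s => Re (th1 s k)) (fun s => Re (th2 s k))); auto.
        assert (di : is_derive (fun s => Im (w s k)) t (Im (Copp (l1 k)) - Im (Copp (l2 k)))).
          apply (is_derive_minus (fun s => Im (th1 s k)) (fun s => Im (th2 s k))); auto.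
        assert (dr2 := is_derive_pow _ 2 _ _ dr); assert (di2 := is_derive_pow _ 2 _ _ di).
        assert (dd := is_derive_plus _ _ _ _ _ dr2 di2).
        evar_last; [exact dd|]; unfold plus; simpl.
        destruct (w t k), (l1 k), (l2 k); unfold Cmult, Cconj, Copp, Cminus, Cplus, Re, Im; simpl; ring.
      evar_last; [exact (is_derive_mult _ _ _ _ _ dM dw Rmult_comm)|].
      rewrite Cmod_sqr; unfold plus, mult; simpl; ring.
    + apply (hN0 (sg t) (th1 t) (th2 t) l1 l2); auto; try apply hdec; auto; [unfold N; lia | |];
      intros k hk; [apply H1 | apply H2]; auto.
  - apply filter_Rsum_small; [apply at_right_proper_filter|]; intros k hk eps' he'.
    assert (hkd := cube_length _ _ _ hk).
    assert (hM : 0 < M S0 k) by exact (weight_pos a p S0 k).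
    (* Each solution moves by at most eta, and 2 eta times the largest weight is the square root of
       eps'. *)
    set (eta := sqrt eps' / (2 * M S0 k)).
    assert (hsq := sqrt_lt_R0 eps' he').
    assert (heta : 0 < eta) by (apply Rdiv_lt_0_compat; lra).
    assert (F1 := proj1 (filterlim_C _ _ _) (hc1 k hkd) eta heta).
    assert (F2 := proj1 (filterlim_C _ _ _) (hc2 k hkd) eta heta).
    assert (F3 : at_right ta (fun t => ta < t <= tb)).
      assert (hp : 0 < tb - ta) by lra; exists (mkposreal _ hp); intros y hy hy'.
      apply Rabs_def2 in hy; unfold minus, plus, opp in hy; simpl in hy; lra.
    generalize (filter_and _ _ F3 (filter_and _ _ F1 F2)); apply filter_imp.
    intros t (ht & h1 & h2); unfold e; rewrite <- Cmod_sqr.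
    assert (hw : Cmod (w t k) <= 2 * eta).
      unfold w; replace (Cminus (th1 t k) (th2 t k)) with
        (Cplus (Cminus (th1 t k) (th1 ta k)) (Copp (Cminus (th2 t k) (th2 ta k))))
        by (rewrite hinit by auto; ring).
      eapply Rle_trans; [apply Cmod_triangle|]; rewrite Cmod_opp; lra.
    assert (hMs : M (sg t) k <= M S0 k) by (apply weight_mono; apply hsg; auto).
    assert (hM0 : 0 < M (sg t) k) by exact (weight_pos a p (sg t) k).
    rewrite <- Rpow_mult_distr, <- (sqrt_sqrt eps') by lra.
    replace (sqrt eps' * sqrt eps') with (sqrt eps' ^ 2) by ring; apply pow_incr; split.
      apply Rmult_le_pos; [lra | apply Cmod_ge_0].
    apply Rle_trans with (M S0 k * (2 * eta)).
      apply Rmult_le_compat; auto; [lra | apply Cmod_ge_0].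
    unfold eta; right; field; lra.
assert (hz : Cmod (w tb k0) ^ 2 <= 0).
  apply le_epsilon; intros eps he; rewrite Rplus_0_l.
  eapply Rle_trans; [apply (small (eps / (tb - ta))); apply Rdiv_lt_0_compat; lra|].
  right; field; lra.
assert (hw0 : w tb k0 = RtoC 0) by (apply Cmod_eq_0; generalize (Cmod_ge_0 (w tb k0)); nra).
replace (th1 tb k0) with (Cplus (w tb k0) (th2 tb k0)) by (unfold w; ring); rewrite hw0; ring.
Qed.

End Uniqueness.

Lemma is_derive_filterlim_right (f : R -> C) t l : is_derive f t l ->
  filterlim f (at_right t) (locally (f t)).
Proof.
intros H; apply (filterlim_filter_le_1 (F := locally t)); [apply filter_le_within|].
apply (ex_derive_continuous (V := C_R_NormedModule) f t); now exists l.
Qed.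

(** * Comparison of the Gevrey norm with the weighted energy *)

Section GevreyNorms.
Variables (d : nat) (r s : R).
Hypothesis hr : 0 <= r.
Hypothesis hs : 1 <= s.
Let a := 1 / s.
Let p := (4 * d + 5)%nat.

Lemma inv_s_bounds : 0 < a <= 1.
Proof.
unfold a; split; [apply Rdiv_lt_0_compat; lra|].
apply (Rmult_le_reg_r s); [lra|]; unfold Rdiv; rewrite Rmult_assoc, Rinv_l; lra.
Qed.

Let gw tau k := Rpower (bn k) (2 * r) * exp (2 * tau * Rpower (bn k) a).

Lemma Rpower_2r_ge1 k : 1 <= Rpower (bn k) (2 * r).
Proof.
generalize (bn_ge1 k); intros; rewrite <- (Rpower_O (bn k)) by lra; apply Rle_Rpower; lra.
Qed.

Lemma gev_psum_bn tau th N : th (zzero d) = RtoC 0 ->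
  gev_psum d r s tau th N = Rsum_list (fun k => gw tau k * Cmod (th k) ^ 2) (cube d N).
Proof.
intros h0; apply Rsum_ext; intros k hk; apply cube_length in hk.
destruct (zis0 k) eqn:E.
- rewrite (zis0_true d k hk E), h0, Cmod_0; ring.
- unfold gw; now rewrite (bn_zis0_false d).
Qed.

(** The gap tau - sg absorbs |k|^(2p), and |k|^(2r) >= 1. In the converse comparison below the gap
    absorbs |k|^(2r). *)
Lemma energy_le_gev tau sg : sg < tau -> exists B, 0 < B /\ forall th N,
  th (zzero d) = RtoC 0 -> energy d a N sg th <= B * gev_psum d r s tau th N.
Proof.
intros h; destruct (pow_le_exp_Rpower a inv_s_bounds (p + p) (2 * tau - 2 * sg) ltac:(lra))
  as (B & hB & H); exists B; split; auto.
intros th N h0; rewrite gev_psum_bn, <- Rsum_scal by auto; apply Rsum_le; intros k _.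
rewrite Rpow_mult_distr, <- Rmult_assoc; apply Rmult_le_compat_r; [apply pow2_ge_0|].
rewrite mwE; unfold gw; set (G := Rpower (bn k) a).
apply Rle_trans with (B * exp (2 * tau * G)).
- replace (2 * tau * G) with ((2 * tau - 2 * sg) * G + (sg * G + sg * G)) by ring.
  rewrite !exp_plus; replace ((bn k ^ (4 * d + 5) * exp (sg * G)) ^ 2) with
    (bn k ^ (p + p) * (exp (sg * G) * exp (sg * G))) by (rewrite pow_add; unfold p; ring).
  rewrite <- (Rmult_assoc B); apply Rmult_le_compat_r.
    apply Rmult_le_pos; left; apply exp_pos.
  apply H, bn_ge1.
- apply Rmult_le_compat_l; [lra|].
  generalize (Rpower_2r_ge1 k) (exp_pos (2 * tau * G)); nra.
Qed.

Lemma gev_le_energy tau sg : tau < sg -> exists B, 0 < B /\ forall th N,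
  th (zzero d) = RtoC 0 -> gev_psum d r s tau th N <= B * energy d a N sg th.
Proof.
intros h; destruct (INR_unbounded (2 * r)) as [n hn].
destruct (pow_le_exp_Rpower a inv_s_bounds n (2 * sg - 2 * tau) ltac:(lra)) as (B & hB & H).
exists B; split; auto; intros th N h0; rewrite gev_psum_bn by auto; unfold energy.
rewrite <- Rsum_scal; apply Rsum_le; intros k _.
rewrite Rpow_mult_distr, <- Rmult_assoc; apply Rmult_le_compat_r; [apply pow2_ge_0|].
rewrite mwE; unfold gw; set (G := Rpower (bn k) a); assert (hb := bn_ge1 k).
assert (h1 : Rpower (bn k) (2 * r) <= B * exp ((2 * sg - 2 * tau) * G)).
  eapply Rle_trans; [|apply H; auto]; rewrite <- Rpower_pow by lra; apply Rle_Rpower; lra.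
apply Rle_trans with (B * (exp (sg * G) * exp (sg * G))).
- apply Rle_trans with (B * exp ((2 * sg - 2 * tau) * G) * exp (2 * tau * G)).
    apply Rmult_le_compat_r; [left; apply exp_pos | auto].
  rewrite Rmult_assoc, <- !exp_plus; right; do 2 f_equal; ring.
- apply Rmult_le_compat_l; [lra|].
  assert (hp := bn_pow_ge1 k (4 * d + 5)); assert (he := exp_pos (sg * G)).
  rewrite Rpow_mult_distr; replace (exp (sg * G) ^ 2) with (exp (sg * G) * exp (sg * G)) by ring.
  rewrite <- (Rmult_1_l (exp (sg * G) * exp (sg * G))) at 1.
  apply Rmult_le_compat_r; nra.
Qed.

(** Each coefficient is at most a constant times exp(-tau |z|^(1/s)). Half of tau pays for all
    powers of |z|, the other half for the squared exponential, as 2 sg <= tau/2. A is the same for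
    all th with the bound Mb, hence for all times. *)
Lemma gev_strong_decay tau sg Mb : 0 < tau -> 4 * sg <= tau -> exists A, forall th,
  real_meanfree d th -> (forall N, gev_psum d r s tau th N <= Mb) -> strong_decay d a sg A th.
Proof.
intros ht hsg; destruct (pow_le_exp_Rpower a inv_s_bounds (p + p + (2 * d + 3)) (tau / 2) ltac:(lra))
  as (B & hB & H); exists (B * sqrt Mb); intros th hth hM; split; auto; intros z hz.
destruct (cube_exists d z hz) as [N hN]; set (G := Rpower (bn z) a).
assert (h1 : (exp (tau * G) * Cmod (th z)) ^ 2 <= Mb).
  eapply Rle_trans; [|apply (hM N)]; rewrite gev_psum_bn by apply hth.
  assert (hpos : forall k, 0 <= gw tau k * Cmod (th k) ^ 2).
    intros k; apply Rmult_le_pos; [|apply pow2_ge_0]; unfold gw.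
    apply Rmult_le_pos; left; apply exp_pos.
  eapply Rle_trans; [|apply (Rsum_term (fun k => gw tau k * Cmod (th k) ^ 2) _ z); auto].
  rewrite Rpow_mult_distr; apply Rmult_le_compat_r; [apply pow2_ge_0|].
  replace (exp (tau * G) ^ 2) with (exp (tau * G) * exp (tau * G)) by ring.
  rewrite <- exp_plus; unfold gw; fold G; replace (tau * G + tau * G) with (2 * tau * G) by ring.
  generalize (Rpower_2r_ge1 z) (exp_pos (2 * tau * G)); nra.
assert (h2 : exp (tau * G) * Cmod (th z) <= sqrt Mb).
  rewrite <- (sqrt_pow2 (exp (tau * G) * Cmod (th z))).
    now apply sqrt_le_1_alt.
  apply Rmult_le_pos; [left; apply exp_pos | apply Cmod_ge_0].
apply Rle_trans with (B * (exp (tau * G) * Cmod (th z))); [|apply Rmult_le_compat_l; lra].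
rewrite mwE; fold p G.
replace ((bn z ^ p * exp (sg * G)) ^ 2 * Cmod (th z) * bn z ^ (2 * d + 3)) with
  (bn z ^ (p + p + (2 * d + 3)) * (exp (sg * G) * exp (sg * G)) * Cmod (th z))
  by (rewrite !pow_add; ring).
rewrite <- (Rmult_assoc B); apply Rmult_le_compat_r; [apply Cmod_ge_0|].
apply Rle_trans with (B * exp (tau / 2 * G) * (exp (sg * G) * exp (sg * G))).
- apply Rmult_le_compat_r; [apply Rmult_le_pos; left; apply exp_pos | apply H, bn_ge1].
- rewrite Rmult_assoc, <- !exp_plus; apply Rmult_le_compat_l; [lra|]; apply exp_le.
  assert (0 < G) by apply exp_pos; nra.
Qed.

End GevreyNorms.

Lemma strong_decay_mono d a S0 A A' th : A <= A' ->
  strong_decay d a S0 A th -> strong_decay d a S0 A' th.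
Proof. intros h [H1 H2]; split; auto; intros z hz; specialize (H2 z hz); lra. Qed.

(** * Existence and uniqueness in Gevrey classes *)

Section WellPosedness.
Variables (d : nat) (That : list Z -> nat -> R) (C0 r s : R).
Hypothesis hC0 : 0 < C0.
Hypothesis hdiv : forall k, length k = d -> vdotZ d (That k) k = 0.
Hypothesis heven : forall k, length k = d -> forall i, (i < d)%nat ->
  That (zneg d k) i = That k i.
Hypothesis hr : 0 <= r.
Hypothesis hs : 1 <= s.
Hypothesis hsym : forall j l, length j = d -> length l = d -> zis0 j = false ->
  Rabs (vdotZ d (That j) l) <= C0 * Rpower (bn j) (1 / s) * bn l.

Lemma Gevrey_solution_continuous th0 Tstar th t k : is_Gevrey_solution d That r s th0 Tstar th ->
  length k = d -> 0 <= t < Tstar -> filterlim (fun t => th t k) (at_right t) (locally (th t k)).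
Proof.
intros (h1 & _ & _ & h2 & h3) hk [[ht| <-] ht'].
- destruct (h3 k hk t ltac:(lra)) as (L & _ & hL).
  apply (is_derive_filterlim_right (fun t => th t k) t _ hL).
- rewrite h1 by auto; now apply h2.
Qed.

Lemma Gevrey_solution_unique th0 Tstar th1 th2 :
  is_Gevrey_solution d That r s th0 Tstar th1 ->
  is_Gevrey_solution d That r s th0 Tstar th2 ->
  forall t, 0 <= t < Tstar -> forall k, length k = d -> th1 t k = th2 t k.
Proof.
intros hs1 hs2 t ht.
assert (ha := inv_s_bounds s hs).
destruct (hs1) as (i1 & m1 & g1 & c1 & d1); destruct (hs2) as (i2 & m2 & g2 & c2 & d2).
destruct (g1 t ht) as (tau1 & M1 & ht1 & hM1); destruct (g2 t ht) as (tau2 & M2 & ht2 & hM2).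
(* A quarter of the radius available to both solutions, as [gev_strong_decay] demands. *)
set (S0 := Rmin tau1 tau2 / 4).
assert (hmin : 0 < Rmin tau1 tau2) by now apply Rmin_glb_lt.
assert (hS0 : 0 < S0) by (unfold S0; lra).
assert (hm1 := Rmin_l tau1 tau2); assert (hm2 := Rmin_r tau1 tau2).
destruct (gev_strong_decay d r s hr hs tau1 S0 M1 ht1 ltac:(unfold S0; lra)) as [A1 hA1].
destruct (gev_strong_decay d r s hr hs tau2 S0 M2 ht2 ltac:(unfold S0; lra)) as [A2 hA2].
set (A := Rmax A1 A2).
assert (hD1 : forall u, 0 <= u <= t -> strong_decay d (1 / s) S0 A (th1 u)).
  intros u hu; apply (strong_decay_mono _ _ _ A1); [apply Rmax_l|]; apply hA1.
    apply m1; lra.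
  apply hM1; lra.
assert (hD2 : forall u, 0 <= u <= t -> strong_decay d (1 / s) S0 A (th2 u)).
  intros u hu; apply (strong_decay_mono _ _ _ A2); [apply Rmax_r|]; apply hA2.
    apply m2; lra.
  apply hM2; lra.
(* The maximum with 0 and the added 1 make lam positive whatever the sign of A. *)
set (lam := Rmax 0 (4 * C0 * (3 ^ (4 * d + 5) + 4 * (INR (4 * d + 5) + S0) * 2 ^ (4 * d + 5))
  * 10 ^ d * A + 2 * C0 * 2 ^ (4 * d + 5) * 10 ^ d * A) + 1).
assert (hl1 := Rmax_l 0 (4 * C0 * (3 ^ (4 * d + 5) + 4 * (INR (4 * d + 5) + S0) * 2 ^ (4 * d + 5))
  * 10 ^ d * A + 2 * C0 * 2 ^ (4 * d + 5) * 10 ^ d * A)).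
assert (hl2 := Rmax_r 0 (4 * C0 * (3 ^ (4 * d + 5) + 4 * (INR (4 * d + 5) + S0) * 2 ^ (4 * d + 5))
  * 10 ^ d * A + 2 * C0 * 2 ^ (4 * d + 5) * 10 ^ d * A)).
assert (hlam : 0 < lam) by (unfold lam; lra).
(* The length of the short intervals comes from bounds valid on all of [0,t], so finitely many of
   them reach t; the weight starts again from S0 on each. *)
set (del := S0 / lam); assert (hdel : 0 < del) by now apply Rdiv_lt_0_compat.
assert (claim : forall n u, 0 <= u <= t -> u <= INR n * del ->
  forall k, length k = d -> th1 u k = th2 u k).
  induction n as [|n IH]; intros u hu hun k hk.
  - change (INR 0) with 0 in hun; replace u with 0 by lra; now rewrite i1, i2.
  - rewrite S_INR in hun; destruct (Rle_dec u (INR n * del)) as [c|c]; [now apply IH|].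
    assert (hn := pos_INR n); assert (hnd : 0 <= INR n * del) by nra.
    apply (unique_on_short_interval d That C0 (1 / s) S0 ha hC0 hS0 hdiv heven hsym A lam
      (INR n * del) u); auto.
    + unfold lam; lra.
    + lra.
    + apply Rle_trans with (lam * del); [apply Rmult_le_compat_l; lra|].
      unfold del; right; field; lra.
    + intros v hv; split; [apply hD1 | apply hD2]; lra.
    + intros k' hk'; apply IH; auto; lra.
    + intros k' hk'; apply (Gevrey_solution_continuous th0 Tstar); auto; lra.
    + intros k' hk'; apply (Gevrey_solution_continuous th0 Tstar); auto; lra.
    + intros k' hk' v hv; apply d1; auto; lra.
    + intros k' hk' v hv; apply d2; auto; lra.
destruct (INR_unbounded (t / del)) as [n hn]; apply (claim n); [lra|].
replace t with (t / del * del) by (field; lra); apply Rmult_le_compat_r; lra.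
Qed.

Lemma Gevrey_solution_exists tau0 K0 : 0 < tau0 -> exists Tstar, 0 < Tstar /\
  forall th0, real_meanfree d th0 -> Gevrey_norm_le d r s tau0 th0 K0 ->
  exists th, is_Gevrey_solution d That r s th0 Tstar th.
Proof.
(* The radii: tau0 for the data, S0 for the initial energy with its power p, at least S0/2 along the
   flow, and S0/4 when returning to the Gevrey norm. E0, lam and the lifespan are fixed by tau0 and
   K0 before the data are given. *)
intros ht; set (S0 := tau0 / 4); assert (hS0 : 0 < S0) by (unfold S0; lra).
assert (ha := inv_s_bounds s hs).
destruct (energy_le_gev d r s hr hs tau0 S0 ltac:(unfold S0; lra)) as (B1 & hB1 & H1).
destruct (gev_le_energy d r s hs (S0 / 4) (S0 / 2) ltac:(lra)) as (B2 & hB2 & H2).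
set (E0 := B1 * K0 ^ 2).
set (lam := 4 * C0 * (3 ^ (4 * d + 5) + 4 * (INR (4 * d + 5) + S0) * 2 ^ (4 * d + 5))
  * 10 ^ d * sqrt (E0 + 1) + 1).
assert (hlam : 0 < lam).
  unfold lam; apply Rplus_le_lt_0_compat; [|lra].
  assert (0 <= sqrt (E0 + 1)) by apply sqrt_pos; assert (0 < 10 ^ d) by (apply pow_lt; lra).
  assert (0 < 3 ^ (4 * d + 5)) by (apply pow_lt; lra).
  assert (0 < 2 ^ (4 * d + 5)) by (apply pow_lt; lra).
  assert (0 <= 4 * (INR (4 * d + 5) + S0) * 2 ^ (4 * d + 5))
    by (generalize (pos_INR (4 * d + 5)); intros; apply Rmult_le_pos; lra).
  apply Rmult_le_pos; auto; apply Rmult_le_pos; [|lra]; apply Rmult_le_pos; lra.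
assert (hlamK : 4 * C0 * (3 ^ (4 * d + 5) + 4 * (INR (4 * d + 5) + S0) * 2 ^ (4 * d + 5))
  * 10 ^ d * sqrt (E0 + 1) <= lam) by (unfold lam; lra).
exists (S0 / (2 * lam)); split; [apply Rdiv_lt_0_compat; lra|]; intros th0 hth0 hK.
assert (hE0 : forall N, energy d (1 / s) N S0 th0 <= E0).
  intros N; eapply Rle_trans; [apply H1, hth0|]; apply Rmult_le_compat_l; [lra | apply hK].
destruct ultrafilter_exists as (U & u1 & u2 & u3 & u4 & u5).
exists (limit_flow U d That C0 (1 / s) S0 th0 E0 lam).
assert (hsol := limit_solution U u1 u2 u3 u4 u5 d That C0 (1 / s) S0 ha hC0 hS0 hdiv heven hsym
  th0 E0 lam hth0 hE0 hlam hlamK).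
assert (hre := limit_flow_real U u1 u2 u3 u4 u5 d That C0 (1 / s) S0 ha hC0 hS0 hdiv heven hsym
  th0 E0 lam hth0 hE0 hlam hlamK).
split; [|split; [|split; [|split]]].
- intros k hk; apply (limit_flow_0 U u1 u2 u3 u4 u5); auto.
- intros t htt; apply hre; lra.
- intros T' hT'; exists (S0 / 4), (B2 * (E0 + 1)); split; [lra|]; intros t htt N.
  eapply Rle_trans; [apply H2; apply hre; lra|]; apply Rmult_le_compat_l; [lra|].
  apply (limit_flow_energy U u1 u2 u3 u4 u5); auto; lra.
- intros k hk; now apply hsol.
- intros k hk; now apply hsol.
Qed.

End WellPosedness.

(** A nonzero frequency has |j| >= 1, so |j|^r0 <= |j|^a. This is how the order of the symbol is
    matched with the 1/s powers that the damping controls. *)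
Lemma symbol_bound d That C0 r0 a : 0 < C0 -> r0 <= a ->
  (forall k, length k = d -> vnorm d (That k) <= C0 * pw (znorm k) r0) ->
  forall j l, length j = d -> length l = d -> zis0 j = false ->
  Rabs (vdotZ d (That j) l) <= C0 * Rpower (bn j) a * bn l.
Proof.
intros hC hra hT j l hj hl h0; assert (hz := zis0_false d j hj h0).
eapply Rle_trans; [now apply vdotZ_bound|].
apply Rmult_le_compat; [apply sqrt_pos | apply sqrt_pos | | apply znorm_le_bn].
eapply Rle_trans; [now apply hT|]; apply Rmult_le_compat_l; [lra|].
rewrite (bn_zis0_false d) by auto; unfold pw; destruct Req_EM_T as [E|_]; [lra|].
apply Rle_Rpower; auto.
Qed.

Theorem theorem3p1 :
  forall (d : nat) (That : list Z -> nat -> R) (C0 r0 r K0 : R),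
    (2 <= d)%nat ->
    0 < C0 -> 0 <= r0 <= 1 ->
    (* T theta is divergence-free for every theta:  k . That(k) = 0 *)
    (forall k, length k = d -> vdotZ d (That k) k = 0) ->
    (* u = T theta is a real velocity field for real theta (That even) *)
    (forall k, length k = d -> forall i, (i < d)%nat ->
        That (zneg d k) i = That k i) ->
    (* |That(k)| <= C |k|^{r0} for all k in Z^d *)
    (forall k, length k = d -> vnorm d (That k) <= C0 * pw (znorm k) r0) ->
    3 < r -> 0 < K0 ->
    forall s : R, 1 <= s ->
    ((0 < r0 /\ s <= 1 / r0) \/ r0 = 0) ->
    forall tau0 : R, 0 < tau0 ->
    exists Tstar : R, 0 < Tstar /\
      forall th0 : list Z -> C,
        real_meanfree d th0 ->
        Gevrey_norm_le d r s tau0 th0 K0 ->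
        (exists th : R -> list Z -> C, is_Gevrey_solution d That r s th0 Tstar th) /\
        (forall th1 th2 : R -> list Z -> C,
            is_Gevrey_solution d That r s th0 Tstar th1 ->
            is_Gevrey_solution d That r s th0 Tstar th2 ->
            forall t, 0 <= t < Tstar -> forall k, length k = d ->
              th1 t k = th2 t k).
Proof.
intros d That C0 r0 r K0 hd hC0 hr0 hdiv heven hT hr hK0 s hs hcase tau0 htau0.
(* Both cases of the statement come down to this inequality: s <= 1/r0 when r0 > 0, and 0 < 1/s when
   r0 = 0. *)
assert (hra : r0 <= 1 / s).
  destruct hcase as [[h0 hs0]| ->]; [|left; apply Rdiv_lt_0_compat; lra].
  apply (Rmult_le_reg_r s); [lra|]; replace (1 / s * s) with 1 by (field; lra).
  apply (Rmult_le_compat_l r0) in hs0; [|lra].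
  replace (r0 * (1 / r0)) with 1 in hs0 by (field; lra); lra.
assert (hsym := symbol_bound d That C0 r0 (1 / s) hC0 hra hT).
assert (hr' : 0 <= r) by lra.
destruct (Gevrey_solution_exists d That C0 r s hC0 hdiv heven hr' hs hsym tau0 K0 htau0)
  as (Tstar & hpos & hex).
exists Tstar; split; auto; intros th0 hth0 hK; split; [now apply hex|].
intros th1 th2; now apply (Gevrey_solution_unique d That C0 r s hC0 hdiv heven hr' hs hsym th0).
Qed.
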